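(* Let $\ell\geqslant 1$, $J\subset\mathbb{Z}/\ell\mathbb{Z}$, and let $\theta\in\mathbb{C}^{\mathbb{Z}/\ell\mathbb{Z}}$ be $J$-standard with $\sum_{i}\theta_i\neq 0$. Let $\mathbf{d}\in E_\theta$, and write $\mathbf{d}=\mathrm{Res}_\ell(\nu)+n\delta_\ell$ with $\nu\in\mathcal{C}_\ell\cap\mathcal{C}_J$ and $n\geqslant 0$ (such an expression exists). For $\mathbf{d}'\in\mathbb{Z}^{\mathbb{Z}/\ell\mathbb{Z}}$ the following conditions are equivalent: (a) $\mathfrak{L}^{\mathbf{d}}_{\mathbf{d}'}\neq\emptyset$. (b) There exist $n'\in\{0,1,\dots,n\}$ and a partition $\lambda\in\mathcal{P}_\nu[n'\ell+|\nu|]$ such that $\mathbf{d}'=\mathrm{Res}_\ell(\mathrm{Core}_J(\lambda))+(n-n')\delta_\ell$.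
   Context: Partitions. Partitions are identified with Young diagrams; the box in row $r$ and column $s$ has $\ell$-residue $s-r \bmod \ell$. $|\lambda|$ is the number of boxes. $\mathrm{Res}_\ell(\lambda)\in\mathbb{Z}^{\mathbb{Z}/\ell\mathbb{Z}}$ has $i$-th coordinate the number of boxes of $\lambda$ of $\ell$-residue $i$. $\delta_\ell=(1)_{i\in\mathbb{Z}/\ell\mathbb{Z}}$. A box is removable if there is no box to its right and none below it. Write $\mu\leqslant\lambda$ if $\mu$ is obtained from $\lambda$ by removing successively removable boxes. $\lambda$ is an $\ell$-core if there is no $\mu\leqslant\lambda$ such that $\lambda\setminus\mu$ consists of $\ell$ boxes with $\ell$ different $\ell$-residues; $\mathcal{C}_\ell$ is the set of $\ell$-cores. $\mathrm{Core}_\ell(\lambda)$ is the $\ell$-core obtained from $\lambda$ by repeatedly removing such sets of $\ell$ boxes (it is independent of choices). For $\nu\in\mathcal{C}_\ell$, $\mathcal{P}_\nu[m]$ is the set of partitions $\lambda$ of $m$ with $\mathrm{Core}_\ell(\lambda)=\nu$. A box is $J$-removable if it is removable and its $\ell$-residue is in $J$; a $J$-core is a partition with no $J$-removable box; $\mathcal{C}_J$ is the set of $J$-cores; $\mathrm{Core}_J(\lambda)$ is the $J$-core obtained from $\lambda$ by successively removing $J$-removable boxes until none is left (independent of choices). $J$-standard parameters. For $\ell\geqslant 2$ the affine Weyl group $W_\ell^{\mathrm{aff}}$ of type $\tilde A_{\ell-1}$, with simple reflections $s_j$ ($j\in\mathbb{Z}/\ell\mathbb{Z}$), acts linearly on $\mathbb{C}^{\mathbb{Z}/\ell\mathbb{Z}}$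 by $s_j(\theta)_j=-\theta_j$ and $s_j(\theta)_i=\theta_i+(\delta_{i,j+1}+\delta_{i,j-1})\theta_j$ for $i\neq j$; for $\ell=1$ it is trivial. $\theta$ is $J$-standard if its stabilizer in $W_\ell^{\mathrm{aff}}$ is the parabolic subgroup $W_J$ generated by $s_j$, $j\in J$; then $J=\{i:\theta_i=0\}$. Quiver varieties. $\overline{Q}_\ell$ is the quiver with vertex set $\mathbb{Z}/\ell\mathbb{Z}$ and arrows $y_i:i\to i+1$, $x_i:i+1\to i$. $\widehat{Q}_\ell$ is obtained by adding a vertex $\infty$ and arrows $0\to\infty$, $\infty\to 0$. For $\mathbf{d}\in\mathbb{Z}_{\geqslant0}^{\mathbb{Z}/\ell\mathbb{Z}}$, $\widehat{\mathbf{d}}$ is the dimension vector of $\widehat{Q}_\ell$ equal to $\mathbf{d}$ on $\mathbb{Z}/\ell\mathbb{Z}$ and to $1$ at $\infty$. $\mathrm{Rep}_\theta(\overline{Q}_\ell)$ is the category of finite dimensional representations $(X,Y)$ of $\overline{Q}_\ell$ ($X_i:V_{i+1}\to V_i$, $Y_i:V_i\to V_{i+1}$) with $X_iY_i-Y_{i-1}X_{i-1}=\theta_i\mathrm{Id}$ for all $i$. $\mathrm{Rep}_\theta(\widehat{Q}_\ell)$ is the category of representations $(X,Y,x,y)$ of $\widehat{Q}_\ell$ of dimension vector of the form $\widehat{\mathbf{d}}$ ($x:\mathbb{C}\to V_0$, $y:V_0\to\mathbb{C}$) with $X_iY_i-Y_{i-1}X_{i-1}+\delta_{i,0}xy=\theta_i\mathrm{Id}$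 for all $i$. $\mathcal{X}_\theta(\mathbf{d})$ is the (reduced) affine quotient by $\prod_i\mathrm{GL}_{d_i}(\mathbb{C})$ of the variety of such $(X,Y,x,y)$ on $V_i=\mathbb{C}^{d_i}$; it is empty if some $d_i<0$. Its points $[M]$ correspond to isomorphism classes of semisimple $M\in\mathrm{Rep}_\theta(\widehat{Q}_\ell)$ of dimension vector $\widehat{\mathbf{d}}$. $E_\theta$ is the set of $\mathbf{d}$ such that $\mathrm{Rep}_\theta(\widehat{Q}_\ell)$ contains a simple representation of dimension vector $\widehat{\mathbf{d}}$. Every $M\in\mathrm{Rep}_\theta(\widehat{Q}_\ell)$ decomposes uniquely (up to isomorphism) as $M=M_0\oplus M_1$ with $M_0\in\mathrm{Rep}_\theta(\widehat{Q}_\ell)$ indecomposable and $M_1\in\mathrm{Rep}_\theta(\overline{Q}_\ell)$; $\dim^{\mathrm{reg}}M\in\mathbb{Z}^{\mathbb{Z}/\ell\mathbb{Z}}$ is the dimension vector of $M_0$ (with the coordinate at $\infty$ dropped). $\mathfrak{L}^{\mathbf{d}}_{\mathbf{d}'}=\{[M]\in\mathcal{X}_\theta(\mathbf{d}) : M \text{ semisimple},\ \dim^{\mathrm{reg}}(M)=\mathbf{d}'\}$. The nonempty sets $\mathfrak{L}^{\mathbf{d}}_{\mathbf{d}'}$ are exactly the symplectic leaves of $\mathcal{X}_\theta(\mathbf{d})$. *)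

(* Defs.v *)
From mathcomp Require Import all_boot all_order all_algebra.
From mathcomp Require Import boolp classical_sets reals complex.
From Stdlib Require Import Relation_Operators.

Set Implicit Arguments.
Unset Strict Implicit.
Unset Printing Implicit Defensive.

Import GRing.Theory.
Local Open Scope ring_scope.

(* Throughout, ell = l.+1 >= 1 and Z/ell is 'I_l.+1 with its canonical
   additive group structure; its element 1 is [Zp1], which is 0 when l = 0. *)

(* Boxes are 0-indexed, which does not change the residue column - row. *)

Definition box := (nat * nat)%type.

Record int_partition := IntPartition {
  parts :> seq nat;
  partsP : sorted geq parts && (0%N \notin parts) }.

Definition boxes (la : seq nat) : seq box :=
  [seq (r, c) | r <- iota 0 (size la), c <- iota 0 (nth 0%N la r)].

Definition residue (l : nat) (b : box) : 'I_l.+1 := inZp b.2 - inZp b.1.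

Definition Res (l : nat) (la : int_partition) : {ffun 'I_l.+1 -> int} :=
  [ffun i => (count (fun b => residue l b == i) (boxes la))%:Z].

Definition delta (l : nat) : {ffun 'I_l.+1 -> int} := [ffun=> 1].

Definition removable (la : int_partition) (b : box) : bool :=
  [&& b \in boxes la, (b.1, b.2.+1) \notin boxes la
    & (b.1.+1, b.2) \notin boxes la].

Definition remove_box (P : pred box) (la mu : int_partition) : Prop :=
  exists b, [/\ removable la b, P b
    & boxes mu =i [seq b' <- boxes la | b' != b]].

Definition subpartition (mu la : int_partition) : Prop :=
  clos_refl_trans_1n int_partition (remove_box predT) la mu.

Definition remove_ell (l : nat) (la mu : int_partition) : Prop :=
  let s := [seq b <- boxes la | b \notin boxes mu] in
  [/\ subpartition mu la, size s = l.+1 & uniq [seq residue l b | b <- s]].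

Definition ell_core (l : nat) (la : int_partition) : Prop :=
  ~ exists mu, remove_ell l la mu.

(* The cores are given as relations: [is_Core_ell l la nu] means that the
   ell-core nu can be reached from la, and likewise for [is_Core_J]. Each la is
   related to exactly one nu. *)
Definition is_Core_ell (l : nat) (la nu : int_partition) : Prop :=
  clos_refl_trans_1n int_partition (remove_ell l) la nu /\ ell_core l nu.

(* la is in P_nu[m]. *)
Definition block (l : nat) (nu : int_partition) (m : nat) (la : int_partition) :
    Prop :=
  size (boxes la) = m /\ is_Core_ell l la nu.

Definition J_box (l : nat) (J : {set 'I_l.+1}) : pred box :=
  fun b => residue l b \in J.

Definition J_core (l : nat) (J : {set 'I_l.+1}) (la : int_partition) : Prop :=
  forall b, ~~ (removable la b && J_box J b).

Definition is_Core_J (l : nat) (J : {set 'I_l.+1}) (la ka : int_partition) :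
    Prop :=
  clos_refl_trans_1n int_partition (remove_box (J_box J)) la ka /\ J_core J ka.

(* The affine Weyl group is given by its Coxeter presentation: its elements are
   words in the simple reflections, [:: i1; ...; ik] being s_i1 ... s_ik, up to
   the congruence [weyl_eq]. It is trivial for ell = 1, and there is no braid
   relation for ell = 2. *)

Definition adjacent (l : nat) (i j : 'I_l.+1) : bool :=
  (i == j + Zp1) || (i == j - Zp1).

Inductive coxeter_rel (l : nat) : seq 'I_l.+1 -> seq 'I_l.+1 -> Prop :=
| Cox_trivial i of l = 0%N : coxeter_rel [:: i] [::]
| Cox_square i : coxeter_rel [:: i; i] [::]
| Cox_commute i j of ~~ adjacent i j : coxeter_rel [:: i; j] [:: j; i]
| Cox_braid i j of (3 <= l.+1)%N & adjacent i j :
    coxeter_rel [:: i; j; i] [:: j; i; j].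

Inductive weyl_eq (l : nat) : seq 'I_l.+1 -> seq 'I_l.+1 -> Prop :=
| Weyl_rel u v a b of coxeter_rel a b : weyl_eq (u ++ a ++ v) (u ++ b ++ v)
| Weyl_refl a : weyl_eq a a
| Weyl_sym a b of weyl_eq a b : weyl_eq b a
| Weyl_trans a b c of weyl_eq a b & weyl_eq b c : weyl_eq a c.

(* The word w represents an element of the parabolic subgroup W_J. *)
Definition in_parabolic (l : nat) (J : {set 'I_l.+1}) (w : seq 'I_l.+1) : Prop :=
  exists2 u, {subset u <= J} & weyl_eq w u.

Section WeylAction.
Variables (F : fieldType) (l : nat).
Implicit Types (th : {ffun 'I_l.+1 -> F}) (w : seq 'I_l.+1).

(* For ell = 2 one has j + 1 = j - 1 and both Kronecker symbols count. *)
Definition refl (j : 'I_l.+1) th : {ffun 'I_l.+1 -> F} :=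
  if l == 0%N then th else
  [ffun i => if i == j then - th j
             else th i + ((i == j + Zp1)%:R + (i == j - Zp1)%:R) * th j].

Definition weyl_act w th : {ffun 'I_l.+1 -> F} := foldr refl th w.

(* For ell >= 2 the equality of the stabilizer with W_J forces
   J = {i | th i = 0}. For ell = 1 the group is trivial and does not see J, so
   this has to be required. *)
Definition standard (J : {set 'I_l.+1}) th : Prop :=
  (forall w, weyl_act w th = th <-> in_parabolic J w) /\
  (l = 0%N -> forall i, (i \in J) = (th i == 0)).

End WeylAction.

(* The framed quiver; the vertex at infinity is [None]. *)

Inductive arrow (l : nat) : Type :=
| ArrX of 'I_l.+1
| ArrY of 'I_l.+1
| Arrx
| Arry.
Arguments Arrx {l}.
Arguments Arry {l}.

Definition src (l : nat) (a : arrow l) : option 'I_l.+1 :=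
  match a with
  | ArrX i => Some (i + Zp1)
  | ArrY i => Some i
  | Arrx => None
  | Arry => Some 0
  end.

Definition tgt (l : nat) (a : arrow l) : option 'I_l.+1 :=
  match a with
  | ArrX i => Some i
  | ArrY i => Some (i + Zp1)
  | Arrx => Some 0
  | Arry => None
  end.

Definition hatd (l : nat) (d : {ffun 'I_l.+1 -> nat}) (v : option 'I_l.+1) : nat :=
  if v is Some i then d i else 1%N.

Section Representations.
Variables (F : fieldType) (l : nat) (d : {ffun 'I_l.+1 -> nat}).

(* Linear maps act on row vectors, on the right: the composite f g (first g,
   then f) is the matrix product g *m f. *)
Definition rep := forall a : arrow l, 'M[F]_(hatd d (src a), hatd d (tgt a)).

(* The relation of Rep_th at the vertex i + 1, for all i:
   X_(i+1) Y_(i+1) - Y_i X_i + delta_(i+1,0) x y = th_(i+1) Id.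
   Here [conform_mx] only transports the endomorphism x y of V_0 to V_(i+1)
   when i + 1 = 0. *)
Definition in_Rep (th : {ffun 'I_l.+1 -> F}) (M : rep) : Prop :=
  forall i : 'I_l.+1,
    (M (ArrY (i + Zp1)) *m M (ArrX (i + Zp1)) : 'M_(d (i + Zp1)))
    - (M (ArrX i) *m M (ArrY i) : 'M_(d (i + Zp1)))
    + (i + Zp1 == 0)%:R *:
        conform_mx (0 : 'M_(d (i + Zp1))) (M Arry *m M Arrx : 'M_(d 0))
    = (th (i + Zp1))%:M.

(* A graded subspace is given, vertex by vertex, by a row space. *)
Definition grsub := forall v : option 'I_l.+1, 'M[F]_(hatd d v).

Definition gr_full : grsub := fun=> 1%:M.

Definition gr_nonzero (U : grsub) : Prop := exists v, U v != 0.

Definition gr_le (U W : grsub) : Prop := forall v, (U v <= W v)%MS.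

Definition gr_dsum (U A B : grsub) : Prop :=
  forall v, (A v + B v == U v)%MS /\ (A v :&: B v = 0)%MS.

Definition subrep (M : rep) (U : grsub) : Prop :=
  forall a, (U (src a) *m M a <= U (tgt a))%MS.

Definition simple_subrep (M : rep) (U : grsub) : Prop :=
  [/\ subrep M U, gr_nonzero U
    & forall W, subrep M W -> gr_le W U -> gr_nonzero W -> gr_le U W].

Definition simple_rep (M : rep) : Prop := simple_subrep M gr_full.

Definition semisimple_rep (M : rep) : Prop :=
  exists k (U : 'I_k -> grsub), (forall i, simple_subrep M (U i)) /\
    forall v, (\sum_(i < k) U i v == (1%:M : 'M_(hatd d v)))%MS
              /\ mxdirect (\sum_(i < k) U i v)%MS.

Definition indecomposable_subrep (M : rep) (U : grsub) : Prop :=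
  [/\ subrep M U, gr_nonzero U
    & forall A B, subrep M A -> subrep M B -> gr_dsum U A B ->
        ~ (gr_nonzero A /\ gr_nonzero B)].

(* [e] is dim^reg of M, read off a decomposition M = M0 (+) M1. The
   subrepresentations M1 that vanish at infinity are those in Rep_th of the
   unframed quiver; M0 then has dimension 1 at infinity. *)
Definition is_dimreg (M : rep) (e : {ffun 'I_l.+1 -> int}) : Prop :=
  exists M0 M1 : grsub,
    [/\ indecomposable_subrep M M0, subrep M M1, M1 None = 0,
        gr_dsum gr_full M0 M1
      & e = [ffun i => (\rank (M0 (Some i)))%:Z]].

(* The points of the affine quotient of Rep_th by prod_i GL_(d i): two
   representations have the same image iff every invariant regular function
   takes the same value on them, and a point is identified with its fibre. *)

Inductive polynomial_fun : (rep -> F) -> Prop :=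
| Poly_const c : polynomial_fun (fun=> c)
| Poly_coord a p q : polynomial_fun (fun M => M a p q)
| Poly_add f g of polynomial_fun f & polynomial_fun g :
    polynomial_fun (fun M => f M + g M)
| Poly_mul f g of polynomial_fun f & polynomial_fun g :
    polynomial_fun (fun M => f M * g M).

Definition hatg (g : forall i, 'M[F]_(d i)) (v : option 'I_l.+1) :
    'M[F]_(hatd d v) :=
  match v with Some i => g i | None => 1%:M end.

Definition gl_act (g : forall i, 'M[F]_(d i)) (M : rep) : rep :=
  fun a => invmx (hatg g (src a)) *m M a *m hatg g (tgt a).

Definition invariant_fun (th : {ffun 'I_l.+1 -> F}) (f : rep -> F) : Prop :=
  polynomial_fun f /\
  forall g M, (forall i, g i \in unitmx) -> in_Rep th M -> f (gl_act g M) = f M.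

(* [M] for M in Rep_th. *)
Definition point (th : {ffun 'I_l.+1 -> F}) (M : rep) : set rep :=
  [set N | in_Rep th N /\ forall f, invariant_fun th f -> f N = f M]%classic.

Definition quiver_variety (th : {ffun 'I_l.+1 -> F}) : set (set rep) :=
  [set p | exists2 M, in_Rep th M & p = point th M]%classic.

(* The leaf L^d_e. *)
Definition leaf (th : {ffun 'I_l.+1 -> F}) (e : {ffun 'I_l.+1 -> int}) :
    set (set rep) :=
  [set p | quiver_variety th p /\
     exists M, [/\ in_Rep th M, semisimple_rep M, is_dimreg M e
                 & p = point th M]]%classic.

(* d is in E_th. *)
Definition in_E (th : {ffun 'I_l.+1 -> F}) : Prop :=
  exists2 M : rep, in_Rep th M & simple_rep M.

End Representations.

Arguments quiver_variety {F l} d th.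
Arguments leaf {F l} d th e.

Definition intd (l : nat) (d : {ffun 'I_l.+1 -> nat}) : {ffun 'I_l.+1 -> int} :=
  [ffun i => (d i)%:Z].

(* Main.v *)
Require Import Defs.
From mathcomp Require Import all_boot all_order all_algebra.
From mathcomp Require Import boolp classical_sets reals complex.
From mathcomp Require Import zify ring lra.
From Stdlib Require Import Relation_Operators.

Set Implicit Arguments.
Unset Strict Implicit.
Unset Printing Implicit Defensive.

Import Order.TTheory GRing.Theory Num.Theory.
Local Open Scope ring_scope.

(** Fix theta with nonzero sum. A point of the leaf of d' is a semisimple
representation M = M0 + M1, where M0 is simple, one-dimensional at infinity and
of dimension vector d' elsewhere, and M1 vanishes at infinity. So the leaf is
nonempty exactly when d' carries a simple framed representation and d - d' is the
dimension vector of a semisimple unframed one. The two questions are answered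
separately.

Unframed representations ([unframed_support]). On an eigenvector of the
composite of the two arrows between consecutive vertices, each arrow shifts the
eigenvalue by a coordinate of theta. One turn around the cycle shifts it by the
sum of theta, which is not 0, so the string through the eigenvector stops on
both sides, and theta adds up to 0 along it. The string is a real root; the
reflection in this root is a product of simple reflections that fixes theta,
hence lies in W_J when theta is J-standard, and this forces the root to be
supported on J ([standard_root_support]). Thus unframed representations live on
J. Conversely each vertex of J carries the one-dimensional representation with
zero arrows.

Simple framed representations. Let <d, j> be the value of the j-th coroot on
the weight Lambda_0 - sum_i d_i alpha_i ([coroot_val]), and let
wt(d) = d_0 - (d, d) / 2 ([weight2] is twice this number). At a vertex j with
theta_j = 0 a simple representation has <d, j> >= 0
([has_simple_coroot_val]); at a vertex with theta_j <> 0 the reflection functor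
turns a simple representation for (theta, d) into one for
(s_j theta, d + <d, j> alpha_j) ([has_simple_refl]) and preserves wt. Reflecting
down as long as some <d, j> is negative gives wt(d) >= 0 for every simple
representation. The same descent shows that d carries a simple representation
as soon as wt(d) >= 0 and d is dominant for the real roots orthogonal to theta
([has_simple_of_root_dominant]): it ends at n delta, where explicit
Calogero-Moser matrices are simple ([CM_has_simple]).

Partitions. For d = Res(lambda) the number <d, j> counts the addable minus the
removable j-boxes ([coroot_val_Res]), an ell-core never has both kinds
([flush_not_both]), has wt = 0 ([flush_weight2]), and is determined by its
residues modulo delta ([core_unique]). Every class modulo delta occurs
([residue_class_exists]). Hence wt(d) >= 0 holds exactly for the vectors
Res(nu) + n delta with nu an ell-core and n >= 0, and dominance on J says that
nu is a J-core.

The two implications. If the leaf is nonempty, then d' = Res(nu') + n'' delta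
with nu' an ell-core and J-core, and d - d' is nonnegative and supported on J.
As d is dominant on J and the form is positive definite there, J-boxes can be
added to nu' one at a time until the residues are those of d - n'' delta
([grow_to]); this gives lambda. Conversely, if kappa = Core_J(lambda), then
Res(kappa) + (n - n') delta has nonnegative weight and is dominant on J, so it
carries a simple M0, and lambda \ kappa says how many one-dimensional
representations at the vertices of J have to be added to M0. *)

(** * The affine root lattice and the stabilizer of theta *)

Section Lattice.
Variable l : nat.
Notation I := 'I_l.+1.
Implicit Types (x y : {ffun I -> int}) (i j : I).

(** The pairing of x with the i-th simple root, for the affine Cartan matrix; for
ell = 1 the matrix is 0 and for ell = 2 both neighbours coincide, as they should. *)
Definition lap x i : int := x i *+ 2 - x (i + Zp1) - x (i - Zp1).
Definition form x y : int := \sum_i x i * lap y i.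
Definition sroot j : {ffun I -> int} := [ffun i => (i == j)%:R].

Lemma lapD x y i : lap (x + y) i = lap x i + lap y i.
Proof. by rewrite /lap !ffunE; ring. Qed.

Lemma lapN x i : lap (- x) i = - lap x i.
Proof. by rewrite /lap !ffunE; ring. Qed.

Lemma lapZ x (t : int) i : lap [ffun k => t * x k] i = t * lap x i.
Proof. by rewrite /lap !ffunE; ring. Qed.

Lemma sum_shift (V : nmodType) (f : I -> V) (a : I) : \sum_i f (i + a) = \sum_i f i.
Proof. by rewrite [RHS](reindex_inj (addIr a)). Qed.

Lemma sum_delta (V : pzRingType) (f : I -> V) j : \sum_i f i * (i == j)%:R = f j.
Proof.
rewrite (bigD1 j) //= eqxx mulr1 big1 ?addr0 // => i /negPf ->.
by rewrite mulr0.
Qed.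

Lemma formC x y : form x y = form y x.
Proof.
rewrite /form /lap.
under eq_bigr do rewrite !mulrBr -addrA -opprD mulrnAr.
under [RHS]eq_bigr do rewrite !mulrBr -addrA -opprD mulrnAr [y _ * x _]mulrC.
rewrite !big_split /= !sumrN; congr (_ - _); rewrite !big_split /= addrC.
congr (_ + _).
  rewrite -(sum_shift (fun i => x i * y (i - Zp1)) Zp1).
  by apply: eq_bigr => i _; rewrite addrK mulrC.
rewrite -(sum_shift (fun i => x i * y (i + Zp1)) (- Zp1)).
by apply: eq_bigr => i _; rewrite subrK mulrC.
Qed.

Lemma form_sroot x j : form x (sroot j) = lap x j.
Proof.
by rewrite formC /form; under eq_bigr do rewrite ffunE mulrC; rewrite sum_delta.
Qed.

Lemma formDl x y z : form (x + y) z = form x z + form y z.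
Proof.
by rewrite /form -big_split; apply: eq_bigr => i _ /=; rewrite !ffunE mulrDl.
Qed.

Lemma formZl t x z : form [ffun k => t * x k] z = t * form x z.
Proof. by rewrite /form mulr_sumr; apply: eq_bigr => i _; rewrite ffunE mulrA. Qed.

Lemma formDr x y z : form z (x + y) = form z x + form z y.
Proof. by rewrite formC formDl ![form z _]formC. Qed.

Lemma formZr t x z : form z [ffun k => t * x k] = t * form z x.
Proof. by rewrite formC formZl formC. Qed.

(** This shows at once that the form is positive semidefinite with radical spanned
by delta. *)
Lemma form_sq x : form x x = \sum_i (x i - x (i + Zp1)) ^+ 2.
Proof.
rewrite /form /lap.
transitivity (\sum_i (x i * (x i - x (i + Zp1))) + \sum_i (x i * (x i - x (i - Zp1)))).
  by rewrite -big_split; apply: eq_bigr => i _ /=; ring.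
rewrite -[X in _ + X](sum_shift _ Zp1) -big_split; apply: eq_bigr => i _ /=.
rewrite addrK; ring.
Qed.

Lemma form_ge0 x : 0 <= form x x.
Proof. by rewrite form_sq; apply: sumr_ge0 => i _; apply: sqr_ge0. Qed.

Lemma Zp1_mulrn_ord (i : I) : Zp1 *+ i = i.
Proof.
apply/val_inj; rewrite Zp_mulrn /=; case: (l) i => [|m] i /=; first by rewrite ord1.
by rewrite mul1n !modn_small.
Qed.

(** Zp1 generates the cyclic group. *)
Lemma const_on_cycle (T : Type) (f : I -> T) :
  (forall i, f (i + Zp1) = f i) -> forall i, f i = f 0.
Proof.
move=> fS i; have [k ->] : exists k, i = Zp1 *+ k.
  by exists i; rewrite Zp1_mulrn_ord.
by elim: k => [|k IH]; rewrite ?mulr0n // mulrSr fS.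
Qed.

Lemma form_le0 x : form x x <= 0 -> forall i, x i = x 0.
Proof.
rewrite form_sq => le0; apply: const_on_cycle => i.
have /psumr_eq0P E : \sum_i (x i - x (i + Zp1)) ^+ 2 = 0.
  by apply/eqP; rewrite eq_le le0 sumr_ge0 // => k _; apply: sqr_ge0.
have /eqP := E (fun k _ => sqr_ge0 _) i isT.
by rewrite sqrf_eq0 subr_eq0 => /eqP.
Qed.

Lemma Zp1_neq0 : (0 < l)%N -> (Zp1 : I) != 0.
Proof. by case: l => // m _; rewrite -val_eqE /= modn_small. Qed.

Lemma addZp1_neq j : (0 < l)%N -> j + Zp1 != j.
Proof. by move=> l0; rewrite -subr_eq0 addrAC subrr add0r Zp1_neq0. Qed.

Lemma subZp1_neq j : (0 < l)%N -> j - Zp1 != j.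
Proof. by move=> l0; rewrite -subr_eq0 addrAC subrr add0r oppr_eq0 Zp1_neq0. Qed.

Lemma lap_sroot j i :
  lap (sroot j) i = (i == j)%:R *+ 2 - (i + Zp1 == j)%:R - (i - Zp1 == j)%:R.
Proof. by rewrite /lap !ffunE. Qed.

Lemma lap_sroot_diag j : (0 < l)%N -> lap (sroot j) j = 2.
Proof.
move=> l0; rewrite lap_sroot eqxx.
by rewrite (negPf (addZp1_neq _ l0)) (negPf (subZp1_neq _ l0)).
Qed.

Lemma lap_delta n i : lap (delta l *+ n) i = 0.
Proof. by rewrite /lap !ffunMnE !ffunE; ring. Qed.

Lemma lap_const x (t : int) i : (forall k, x k = t) -> lap x i = 0.
Proof. by move=> xt; rewrite /lap !xt; ring. Qed.

(** The value of the j-th simple coroot on Lambda_0 - sum_i x_i alpha_i, that is,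
minus the pairing of alpha_j with the framed dimension vector alpha_oo + x. *)
Definition coroot_val x j : int := (j == 0)%:R - lap x j.
(** Twice the weight x_0 - (x, x) / 2, which is 1 minus half the norm of
alpha_oo + x; doubling avoids a division. *)
Definition weight2 x : int := x 0 *+ 2 - form x x.
(** The reflection s_j on framed dimension vectors alpha_oo + x, which is affine
in x. *)
Definition dot_refl j x : {ffun I -> int} := [ffun i => x i + (i == j)%:R * coroot_val x j].
Definition root_refl j x : {ffun I -> int} := [ffun i => x i - (i == j)%:R * lap x j].

(** In this form the weight is visibly nonnegative on dominant nonnegative vectors. *)
Lemma weight2_coroot_val x : weight2 x = \sum_j x j * coroot_val x j + x 0.
Proof.
rewrite /weight2 /form /coroot_val.
under [in RHS]eq_bigr do rewrite mulrBr.
rewrite big_split /= sumrN sum_delta; ring.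
Qed.

Lemma weight2_add (t : int) j x : (0 < l)%N ->
  weight2 [ffun i => x i + (i == j)%:R * t] = weight2 x + (t * coroot_val x j - t ^+ 2) *+ 2.
Proof.
move=> l0; have -> : [ffun i => x i + (i == j)%:R * t] = x + [ffun k => t * sroot j k].
  by apply/ffunP => i; rewrite !ffunE mulrC.
rewrite /weight2 !formDl !formDr !formZl !formZr (formC _ x) !form_sroot.
rewrite lap_sroot_diag // /coroot_val !ffunE eq_sym; ring.
Qed.

Lemma weight2_dot_refl j x : (0 < l)%N -> weight2 (dot_refl j x) = weight2 x.
Proof. by move=> l0; rewrite /dot_refl weight2_add //; ring. Qed.

Lemma weight2_delta n x : weight2 (x + delta l *+ n) = weight2 x + n%:R *+ 2.
Proof.
have E : delta l *+ n = [ffun k => n%:R * delta l k].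
  by apply/ffunP => i; rewrite ffunMnE !ffunE mulr1.
have Z y : form y (delta l) = 0.
  rewrite /form big1 // => i _; rewrite (@lap_const _ 1) ?mulr0 // => k.
  by rewrite ffunE.
rewrite /weight2 !formDl !formDr E !formZl !formZr (formC (delta l)) !Z !ffunE; ring.
Qed.

Lemma root_reflE j x : root_refl j x = x + [ffun k => - lap x j * sroot j k].
Proof. by apply/ffunP => i; rewrite !ffunE mulrC mulNr. Qed.

Lemma form_root_refl j x : (0 < l)%N -> form (root_refl j x) (root_refl j x) = form x x.
Proof.
move=> l0; rewrite root_reflE !formDl !formDr !formZl !formZr (formC _ x) !form_sroot.
rewrite lap_sroot_diag //.
ring.
Qed.

Lemma root_refl_trivial j x : l = 0%N -> root_refl j x = x.
Proof.
move=> l0; apply/ffunP => i; rewrite ffunE (@lap_const x (x 0)) ?mulr0 ?subr0 //.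
by move=> k; congr (x _); apply/val_inj; move: k; rewrite l0 => k; rewrite (ord1 k).
Qed.

Lemma root_reflK j x : root_refl j (root_refl j x) = x.
Proof.
case: (posnP l) => [l0|l0]; first by rewrite !root_refl_trivial.
rewrite [root_refl j x in X in X = _]root_reflE.
apply/ffunP => i; rewrite ffunE lapD lapZ lap_sroot_diag // !ffunE; ring.
Qed.

Lemma root_reflN j x : root_refl j (- x) = - root_refl j x.
Proof. apply/ffunP => i; rewrite !ffunE lapN; ring. Qed.

Lemma root_refl_sroot j : (0 < l)%N -> root_refl j (sroot j) = - sroot j.
Proof. by move=> l0; apply/ffunP => i; rewrite !ffunE lap_sroot_diag //; ring. Qed.

Definition nonneg x := forall i, 0 <= x i.

(** A simple reflection permutes the positive real roots other than its own simple
root. If y = s_j(x) had a negative j-th coordinate, then (y, alpha_j) <= -2 and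
y + alpha_j would be isotropic, hence a multiple of delta; it vanishes at j, so
y = - alpha_j. *)
Lemma root_refl_nonneg j x : (0 < l)%N -> nonneg x -> form x x = 2 ->
  x <> sroot j -> nonneg (root_refl j x).
Proof.
move=> l0 x0 x2 xj i; have [->{i}|ij] := eqVneq i j; last first.
  by rewrite ffunE (negPf ij) mul0r subr0.
rewrite leNgt; apply/negP => neg; apply: xj.
have yi k : k != j -> 0 <= root_refl j x k.
  by move=> kj; rewrite ffunE (negPf kj) mul0r subr0.
have y2 : form (root_refl j x) (root_refl j x) = 2 by rewrite form_root_refl.
rewrite -[x](root_reflK j).
move: (root_refl j x) neg yi y2 => y neg yi y2 {x x0 x2}.
have lapy : lap y j <= y j *+ 2.
  have := yi _ (addZp1_neq j l0); have := yi _ (subZp1_neq j l0).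
  by rewrite /lap => ? ?; rewrite -addrA gerDl -opprD oppr_le0 addr_ge0.
have zz : form (y + sroot j) (y + sroot j) = 2 + lap y j *+ 2 + 2.
  rewrite formDl !formDr (formC _ y) !form_sroot lap_sroot_diag // y2; ring.
have := form_ge0 (y + sroot j); rewrite zz => ge.
(* semidefiniteness gives (y, alpha_j) >= -2, and (y, alpha_j) <= 2 y_j <= -2 *)
have lapj : lap y j = - 2 by lia.
have yj : y j = -1 by lia.
have := @form_le0 (y + sroot j); rewrite zz lapj => /(_ isT) cst.
have y0 : y 0 + sroot j 0 = 0 by have := cst j; rewrite !ffunE eqxx yj.
have yE : y = - sroot j.
  apply/eqP; rewrite -addr_eq0; apply/eqP/ffunP => k.
  by rewrite cst [LHS]ffunE y0 ffunE.
by rewrite yE root_reflN root_refl_sroot // opprK.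
Qed.

Definition pair (F : fieldType) (th : {ffun I -> F}) x : F := \sum_i th i * (x i)%:~R.

Lemma pairD (F : fieldType) (th : {ffun I -> F}) x y :
  pair th (x + y) = pair th x + pair th y.
Proof.
by rewrite -big_split; apply: eq_bigr => i _ /=; rewrite ffunE rmorphD mulrDr.
Qed.

Lemma pair_sroot (F : fieldType) (th : {ffun I -> F}) j : pair th (sroot j) = th j.
Proof.
rewrite /pair -[RHS](sum_delta th); apply: eq_bigr => i _; rewrite ffunE.
by case: (i == j).
Qed.

Lemma reflE (F : fieldType) (th : {ffun I -> F}) j i : (0 < l)%N ->
  refl j th i = th i - th j * (lap (sroot j) i)%:~R.
Proof.
move=> l0; rewrite /refl -[l == _]negbK -lt0n l0 /= ffunE; case: eqP => [->|/eqP ij].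
  by rewrite lap_sroot_diag //; ring.
rewrite lap_sroot (negPf ij) [i + Zp1 == j](_ : _ = (i == j - Zp1)); last first.
  by rewrite -[i in RHS](addrK Zp1) (inj_eq (addIr _)).
rewrite [i - Zp1 == j](_ : _ = (i == j + Zp1)); last first.
  by rewrite -[i in RHS](subrK Zp1) (inj_eq (addIr _)).
case: (i == j + Zp1); case: (i == j - Zp1); rewrite /=; ring.
Qed.

Lemma refl_diag (F : fieldType) (th : {ffun I -> F}) j : (0 < l)%N ->
  refl j th j = - th j.
Proof. by move=> l0; rewrite reflE // lap_sroot_diag //; ring. Qed.

Lemma refl0 (F : fieldType) (th : {ffun I -> F}) j : l = 0%N -> refl j th = th.
Proof. by rewrite /refl; case: eqP. Qed.

(** The action on parameters is dual to the action on roots. *)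
Lemma pair_refl (F : fieldType) (th : {ffun I -> F}) j x :
  pair (refl j th) x = pair th (root_refl j x).
Proof.
case: (posnP l) => [l0|l0]; first by rewrite root_refl_trivial // refl0.
rewrite root_reflE pairD /pair.
under eq_bigr do rewrite reflE // mulrBl.
rewrite big_split /= sumrN; congr (_ + _).
transitivity (- (th j * (form x (sroot j))%:~R)).
  rewrite /form rmorph_sum mulr_sumr; congr (- _); apply: eq_bigr => i _ /=.
  by rewrite rmorphM /=; ring.
rewrite form_sroot -(sum_delta th j) mulr_suml -sumrN; apply: eq_bigr => i _.
by rewrite !ffunE; case: (i == j); rewrite /= ?(mulr1, mulr0, rmorphN, rmorph0) /=; ring.
Qed.


Lemma reflK (F : fieldType) (th : {ffun I -> F}) j : refl j (refl j th) = th.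
Proof.
case: (posnP l) => [l0|l0]; first by rewrite !refl0.
by apply/ffunP => i; rewrite !reflE // lap_sroot_diag //; ring.
Qed.

Lemma refl_fix (F : fieldType) (th : {ffun I -> F}) j : th j = 0 -> refl j th = th.
Proof.
case: (posnP l) => [l0|l0 thj]; first by rewrite refl0.
by apply/ffunP => i; rewrite reflE // thj mul0r subr0.
Qed.

Lemma sum_root_refl j x : \sum_i root_refl j x i = \sum_i x i - lap x j.
Proof.
under eq_bigr do rewrite ffunE.
rewrite big_split /= sumrN; congr (_ - _).
by rewrite -[RHS](sum_delta (fun i => lap x j) j); apply: eq_bigr => i _; rewrite mulrC.
Qed.

(** Expand (x, x) = 2 > 0 along the coordinates of x. *)
Lemma root_descent x : nonneg x -> form x x = 2 -> exists j, 0 < x j /\ 0 < lap x j.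
Proof.
move=> x0 x2.
have [j /andP[]|none] := pickP (fun j => (0 < x j) && (0 < lap x j)); first by exists j.
have: form x x <= 0; last by rewrite x2.
rewrite /form; apply: sumr_le0 => i _; have := none i; have := x0 i.
rewrite le_eqVlt => /predU1P[<-|xi]; first by rewrite mul0r.
by rewrite xi /= => /negbT; rewrite -leNgt pmulr_rle0.
Qed.

(** By induction on the height: conjugate by a simple reflection that lowers the
root until it is simple. The resulting palindromic word represents the
reflection in x, so it fixes every theta orthogonal to x. *)
Lemma root_word x : (0 < l)%N -> nonneg x -> form x x = 2 ->
  exists w : seq I, foldr (@root_refl) x w = - x /\
    forall (F : fieldType) (th : {ffun I -> F}), pair th x = 0 -> weyl_act w th = th.
Proof.
move=> l0; have [n] := ubnP `|(\sum_i x i)%R|%N.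
elim: n x => // n IH x /ltnSE le x0 x2.
have [j [xj lapj]] := root_descent x0 x2.
have [->|/eqP xs] := eqVneq x (sroot j).
  exists [:: j]; split; first exact: root_refl_sroot.
  by move=> F th; rewrite pair_sroot => /refl_fix.
have y0 := root_refl_nonneg l0 x0 x2 xs.
have [||w [wx wth]] := IH (root_refl j x) _ y0; last 1 first.
- exists (j :: rcons w j); split=> [|F th th0] /=.
    by rewrite -cats1 foldr_cat /= wx root_reflN root_reflK.
  rewrite -cats1 /weyl_act foldr_cat /= -/(weyl_act _ _) wth ?reflK //.
  by rewrite pair_refl root_reflK.
- rewrite sum_root_refl; have : 0 <= \sum_i root_refl j x i by apply: sumr_ge0.
  rewrite sum_root_refl; lia.
- by rewrite form_root_refl.
Qed.

Lemma lap_root_refl i j x : lap (root_refl j x) i = lap x i - lap x j * lap (sroot j) i.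
Proof. by rewrite root_reflE lapD lapZ mulNr. Qed.

Lemma lap_srootC i j : lap (sroot i) j = lap (sroot j) i.
Proof. by rewrite -!form_sroot formC. Qed.

(** The action on the root lattice is a representation of the Coxeter group, so it
can tell group elements apart. *)
Lemma root_refl_coxeter a b x :
  coxeter_rel a b -> foldr (@root_refl) x a = foldr (@root_refl) x b.
Proof.
case=> [i l0|i|i j|i j l2] /=; [exact: root_refl_trivial|exact: root_reflK| |].
- case: (posnP l) => [l0|l0]; first by rewrite !root_refl_trivial.
  have [-> //|ij] := eqVneq i j; rewrite negb_or => /andP[/negPf h1 /negPf h2].
  have L : lap (sroot j) i = 0.
    rewrite lap_sroot (negPf ij) -(inj_eq (addIr Zp1) (i - Zp1)) subrK h1.
    by rewrite -(inj_eq (addIr (- Zp1)) (i + Zp1)) addrK h2.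
  by apply/ffunP => k; rewrite ![LHS]ffunE ![RHS]ffunE !ffunE !lap_root_refl L lap_srootC L; ring.
- move=> adj; have l0 : (0 < l)%N by lia.
  have ij : i != j.
    by case/orP: adj => /eqP ->; rewrite ?addZp1_neq ?subZp1_neq.
  have L : lap (sroot j) i = - 1.
    have pm : (j + Zp1 == j - Zp1) = false.
      rewrite -(inj_eq (addIr Zp1)) subrK -addrA -subr_eq0 addrAC subrr add0r.
      by rewrite -val_eqE /= !(modn_small (_ : 1 < _)%N) ?modn_small //; lia.
    rewrite lap_sroot (negPf ij) -(inj_eq (addIr Zp1) (i - Zp1)) subrK.
    rewrite -(inj_eq (addIr (- Zp1)) (i + Zp1)) addrK.
    by case/orP: adj => /eqP ->; rewrite ?eqxx ?pm 1?eq_sym ?pm.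
  have L' : lap (sroot i) j = - 1 by rewrite lap_srootC.
  apply/ffunP => k; rewrite !ffunE !lap_root_refl L L' !lap_sroot_diag //; ring.
Qed.

Lemma root_refl_weyl a b x : weyl_eq a b -> foldr (@root_refl) x a = foldr (@root_refl) x b.
Proof.
move=> ab; elim: ab x => {a b} [u v a b ab x|//|a b _ IH x|a b c _ IH1 _ IH2 x].
- by rewrite !foldr_cat (root_refl_coxeter _ ab).
- by rewrite IH.
- by rewrite IH1.
Qed.

Lemma root_refl_word_notin (u : seq I) x i : i \notin u -> foldr (@root_refl) x u i = x i.
Proof.
elim: u => //= j u IH; rewrite inE negb_or => /andP[ij /IH].
by rewrite ffunE (negPf ij) mul0r subr0.
Qed.

(** The reflection in x fixes theta, so it is represented by a word in J. Such a
word changes only the coordinates in J, whereas the reflection maps x to - x. *)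
Lemma standard_root_support (F : fieldType) (J : {set I}) (th : {ffun I -> F}) x i :
  standard J th -> nonneg x -> form x x = 2 -> pair th x = 0 -> i \notin J -> x i = 0.
Proof.
move=> [st _] x0 x2 thx iJ.
have l0 : (0 < l)%N.
  rewrite lt0n; apply/eqP => l0; have [j [_]] := root_descent x0 x2.
  rewrite (@lap_const _ (x j)) // => k; congr (x _); apply/val_inj.
  by move: k j; rewrite l0 => k j; rewrite !ord1.
have [w [wx /(_ F th thx)]] := root_word l0 x0 x2.
case/st => u uJ /(root_refl_weyl x); rewrite wx => /ffunP/(_ i).
rewrite root_refl_word_notin; last by apply: contra iJ => /uJ.
by rewrite ffunE => /eqP; rewrite eq_sym -subr_eq0 opprK -mulr2n mulrn_eq0 => /eqP.
Qed.

(** For ell >= 2 the word s_j fixes theta, whence theta_j = - theta_j. *)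
Lemma standard_zero (F : numFieldType) (J : {set I}) (th : {ffun I -> F}) j :
  standard J th -> j \in J -> th j = 0.
Proof.
move=> [st st0] jJ; case: (posnP l) => [l0|l0]; first by apply/eqP; rewrite -st0.
have /st /ffunP /(_ j) : in_parabolic J [:: j].
  by exists [:: j]; [move=> k; rewrite inE => /eqP -> | exact: Weyl_refl].
rewrite /= reflE // lap_sroot_diag // => /eqP.
by rewrite -subr_eq0 addrC addrA addNr sub0r oppr_eq0 mulf_eq0 => /orP[/eqP //|]; rewrite intr_eq0.
Qed.

Lemma sum_refl (F : fieldType) (th : {ffun I -> F}) j : \sum_i refl j th i = \sum_i th i.
Proof.
have E (t : {ffun I -> F}) : \sum_i t i = pair t (delta l).
  by apply: eq_bigr => i _; rewrite ffunE mulr1.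
rewrite !E pair_refl; congr pair; apply/ffunP => i.
by rewrite ffunE -[delta l]/(delta l *+ 1) lap_delta mulr0 subr0.
Qed.

(** The sum of the simple roots along k consecutive vertices, starting at a and
possibly winding several times around the cycle. *)
Definition arc (a : I) (k : nat) : {ffun I -> int} :=
  \sum_(t < k) sroot (a + Zp1 *+ t).

Lemma arcE a k i : arc a k i = \sum_(t < k) (i == a + Zp1 *+ t)%:R.
Proof. by rewrite sum_ffunE; apply: eq_bigr => t _; rewrite ffunE. Qed.

Lemma arc_nonneg a k : nonneg (arc a k).
Proof. by move=> i; rewrite arcE; apply: sumr_ge0 => t _; rewrite ler0n. Qed.

Lemma pair_arc (F : fieldType) (th : {ffun I -> F}) a k :
  pair th (arc a k) = \sum_(t < k) th (a + Zp1 *+ t).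
Proof.
rewrite /arc; elim: k => [|k IH]; last by rewrite !big_ord_recr /= pairD IH pair_sroot.
by rewrite !big_ord0 /pair big1 // => i _; rewrite ffunE mulr0.
Qed.

Lemma form_arc_l a k y :
  form (arc a k) y = (y a - y (a - Zp1)) - (y (a + Zp1 *+ k) - y (a + Zp1 *+ k - Zp1)).
Proof.
elim: k => [|k IH].
  by rewrite /arc big_ord0 /form mulr0n addr0 subrr big1 // => i _; rewrite ffunE mul0r.
rewrite /arc big_ord_recr /= formDl -/(arc a k) IH formC form_sroot /lap.
rewrite [Zp1 *+ k.+1]mulrSr (addrA a) (addrK Zp1); ring.
Qed.

(** The sum telescopes, since shifting the arc by one step drops its first vertex
and adds the one after its last. *)
Lemma arc_diff a k i : arc a k i - arc a k (i - Zp1) = (i == a)%:R - (i == a + Zp1 *+ k)%:R.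
Proof.
elim: k => [|k IH]; first by rewrite !arcE !big_ord0 mulr0n (addr0 a) !subrr.
have -> : arc a k.+1 = arc a k + sroot (a + Zp1 *+ k) by rewrite /arc big_ord_recr.
rewrite 2![(_ + _ : {ffun _ -> _}) _]ffunE [sroot _ i]ffunE [sroot _ (_ - _)]ffunE.
rewrite -(inj_eq (addIr Zp1) (i - Zp1)) subrK -(addrA a) -mulrSr.
rewrite opprD addrACA IH; ring.
Qed.

Lemma Zp1_mulrn_eq0 k : (Zp1 *+ k == 0 :> I) = (l.+1 %| k)%N.
Proof.
rewrite Zp_mulrn -val_eqE /=; case: (l) => [|m]; first by rewrite !modn1 dvd1n.
by rewrite (modn_small (_ : 1 < m.+2)%N) // mul1n.
Qed.

(** An arc that does not close up is a real root plus a multiple of delta. *)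
Lemma form_arc a k : ~~ (l.+1 %| k)%N -> form (arc a k) (arc a k) = 2.
Proof.
rewrite -Zp1_mulrn_eq0 => /negPf nz.
have N : (a + Zp1 *+ k == a) = false by rewrite -[X in _ == X]addr0 (inj_eq (addrI a)).
by rewrite form_arc_l !arc_diff !eqxx (eq_sym a) N.
Qed.

(** Each turn around the cycle visits every vertex once. *)
Lemma sum_cycle (V : nmodType) (th : I -> V) a q :
  \sum_(t < q * l.+1) th (a + Zp1 *+ t) = (\sum_i th i) *+ q.
Proof.
elim: q => [|q IH]; first by rewrite big_ord0.
rewrite mulSnr mulrSr big_split_ord /= {}IH; congr (_ + _).
rewrite -(sum_shift th a); apply: eq_bigr => t _; rewrite mulrnDr mulrnA.
have -> : Zp1 *+ q *+ l.+1 = 0 :> I.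
  by apply/eqP; rewrite -mulrnA Zp1_mulrn_eq0 dvdn_mull.
by rewrite add0r addrC Zp1_mulrn_ord.
Qed.

(** The arc cannot close up, because theta would then sum to a nonzero multiple of
its total; so it is a real root orthogonal to theta. *)
Lemma zero_arc_support (F : numFieldType) (J : {set I}) (th : {ffun I -> F}) a k (t : 'I_k) :
  standard J th -> \sum_i th i != 0 -> \sum_(t < k) th (a + Zp1 *+ t) = 0 ->
  a + Zp1 *+ t \in J.
Proof.
move=> st th0 thk.
(* a closed arc has theta-sum q times the total, with q > 0 *)
have kl : ~~ (l.+1 %| k)%N.
  apply/negP => /dvdnP[q kE]; move: thk; rewrite kE sum_cycle => /eqP.
  rewrite mulrn_eq0 (negPf th0) orbF => /eqP q0.
  by case: t => t; rewrite kE q0.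
apply/negPn/negP => /(standard_root_support st (@arc_nonneg a k) (form_arc a kl)).
rewrite pair_arc => /(_ thk); rewrite arcE (bigD1 t) //= eqxx => /eqP.
by rewrite gt_eqF // ltr_pwDl // sumr_ge0 // => u _; rewrite ler0n.
Qed.

End Lattice.

(** * Partitions and beads *)

Implicit Types (l : nat) (la mu nu : int_partition) (r s : nat) (b : box).
Local Notation part la r := (nth 0%N la r).

Lemma row_mono la r s : (r <= s)%N -> (part la s <= part la r)%N.
Proof.
have /andP[srt _] := partsP la; case: (ltnP s (size la)) => ss; last by rewrite (nth_default _ ss).
have geqT : transitive geq by move=> x y z /= h1 h2; apply: leq_trans h2 h1.
by move=> rs; apply: (sorted_leq_nth geqT leqnn 0%N srt); rewrite ?inE // (leq_ltn_trans rs).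
Qed.

Lemma row_gt0 la r : (0 < part la r)%N = (r < size la)%N.
Proof.
have /andP[_ n0] := partsP la; case: (ltnP r (size la)) => rs; last by rewrite nth_default.
by rewrite lt0n; apply: contra n0 => /eqP <-; apply: mem_nth.
Qed.

Lemma partition_ext la mu : (forall r, part la r = part mu r) -> la = mu.
Proof.
have le_size (ka ka' : int_partition) : (forall r, part ka r = part ka' r) ->
    (size ka <= size ka')%N.
  by move=> E; rewrite leqNgt -row_gt0 E nth_default.
move=> E; have sE : size la = size mu by apply/eqP; rewrite eqn_leq !le_size.
case: la mu E sE => [s1 p1] [s2 p2] /= E sE.
have e : s1 = s2 by apply: (@eq_from_nth _ 0%N).
by case: _ / e p2 E sE => p2 _ _; congr IntPartition; apply: bool_irrelevance.
Qed.

(** Cut the sequence at its first zero. *)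
Lemma partition_of (f : nat -> nat) K : {homo f : r s / (r <= s)%N >-> (s <= r)%N} ->
  f K = 0%N -> exists la, forall r, part la r = f r.
Proof.
move=> fm fK; have ex : exists k, f k == 0%N by exists K; apply/eqP.
case: (ex_minnP ex) => k /eqP fk kmin.
have P : sorted geq (mkseq f k) && (0%N \notin mkseq f k).
  apply/andP; split.
    apply/(sortedP 0%N) => i; rewrite size_mkseq => ik; rewrite !nth_mkseq ?(ltnW ik) //.
    exact: fm.
  by apply/mapP => -[t]; rewrite mem_iota add0n => /= tk /esym/eqP/kmin; rewrite leqNgt tk.
exists (IntPartition P) => r /=; case: (ltnP r k) => rk; first by rewrite nth_mkseq.
rewrite nth_default ?size_mkseq //; apply/esym/eqP.
by rewrite -leqn0 -fk fm.
Qed.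

Lemma mem_boxes la b : (b \in boxes la) = (b.2 < part la b.1)%N.
Proof.
case: b => r c /=; apply/allpairsPdep/idP => /= [[r' [c' [_ +]]]|rc].
  by rewrite mem_iota => /= h [-> ->].
exists r, c; rewrite !mem_iota !add0n /= -row_gt0 (leq_ltn_trans _ rc) //.
Qed.

Lemma boxes_uniq la : uniq (boxes la).
Proof.
apply: allpairs_uniq_dep => [|r _|]; rewrite ?iota_uniq //.
by move=> [r c] [r' c'] _ _ /= [-> ->].
Qed.

Definition content (b : box) : int := b.2%:Z - b.1%:Z.

(** The beads of the Maya diagram: the bead of row r is the content of the last
box of this row, and empty rows contribute the negative sea. *)
Definition bead la r : int := (part la r)%:Z - r%:Z - 1.
Definition isbead la (p : int) : Prop := exists r, bead la r = p.

Lemma bead_lt la r s : (r < s)%N -> bead la s < bead la r.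
Proof. move=> rs; have := row_mono la (ltnW rs); rewrite /bead; lia. Qed.

Lemma bead_inj la : injective (bead la).
Proof.
move=> r s E; case: (ltngtP r s) => // /(bead_lt la); rewrite E ltxx //.
Qed.

(** The beads decrease with the row, so the set of beads determines the sequence. *)
Lemma isbead_ext la mu : (forall p, isbead la p <-> isbead mu p) -> la = mu.
Proof.
move=> E; apply: partition_ext => r; have [n] := ubnP r.
elim: n r => // n IH r /ltnSE rn.
have IH' s : (s < r)%N -> bead la s = bead mu s.
  by move=> sr; rewrite /bead IH // (leq_trans sr).
suff: bead la r = bead mu r by rewrite /bead; lia.
have [s sE] : isbead mu (bead la r) by apply/E; exists r.
have [t tE] : isbead la (bead mu r) by apply/E; exists r.
case: (ltngtP s r) => sr.
- by have := bead_lt la sr; rewrite (IH' s sr) sE ltxx.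
- have := bead_lt mu sr; rewrite sE -tE => lt1.
  case: (ltngtP t r) => tr.
  + by have := bead_lt mu tr; rewrite -(IH' t tr) tE ltxx.
  + by have := bead_lt la tr; rewrite ltNge (ltW lt1).
  + by move: lt1; rewrite tr ltxx.
- by rewrite -sE sr.
Qed.

Definition rem_row la r := (part la r.+1 < part la r)%N.
Definition add_row la r := (r == 0%N) || (part la r < part la r.-1)%N.

Lemma removable_row la b :
  removable la b -> rem_row la b.1 /\ b.2 = (part la b.1).-1.
Proof.
case: b => r c; rewrite /removable !mem_boxes /rem_row /=; lia.
Qed.

(** Stated for rows: decreasing one part by 1 removes the last box of that row. *)
Lemma remove_box_row la mu r (P : pred box) : rem_row la r -> P (r, (part la r).-1) ->
  (forall s, part mu s = part la s - (s == r))%N -> remove_box P la mu.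
Proof.
rewrite /rem_row => rr Pr E; exists (r, (part la r).-1); split => //.
  by rewrite /removable !mem_boxes /=; lia.
move=> [s c]; rewrite mem_filter !mem_boxes /= E xpair_eqE; case: (s =P r) => [->|] /=; last lia.
by case: eqP; lia.
Qed.

Lemma remove_box_perm (P : pred box) la mu : remove_box P la mu ->
  exists b, [/\ removable la b, P b & perm_eq (boxes la) (b :: boxes mu)].
Proof.
case=> b [rb Pb E]; exists b; split => //.
have bla : b \in boxes la by case/and3P: rb.
apply: uniq_perm; rewrite ?boxes_uniq //= ?boxes_uniq ?andbT ?E ?mem_filter ?eqxx //.
by move=> c; rewrite inE E mem_filter; case: eqP => [->|].
Qed.

Lemma remove_rowP la r : rem_row la r ->
  exists mu, forall s, (part mu s = part la s - (s == r))%N.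
Proof.
move=> rr; apply: (@partition_of _ (maxn r.+1 (size la))) => [s t st|]; last first.
  by rewrite nth_default ?leq_maxr.
have := row_mono la st; move: rr; rewrite /rem_row.
case: (s =P r) st => [->|_]; case: (t =P r) => [->|tr] //; try lia.
by move=> rt rr _; have := row_mono la (_ : r.+1 <= t)%N; lia.
Qed.

Lemma add_rowP la r : add_row la r ->
  exists mu, [/\ forall s, (part mu s = part la s + (s == r))%N, rem_row mu r,
    forall s, (part la s = part mu s - (s == r))%N & bead mu r = bead la r + 1].
Proof.
move=> ar; pose f s := (part la s + (s == r))%N.
have fm : {homo f : s t / (s <= t)%N >-> (t <= s)%N}.
  move=> s t st; have := row_mono la st; move: ar; rewrite /f /add_row.
  case: (s =P r) st => [->|sr]; case: (t =P r) => [->|tr] //; try lia.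
  by move=> st /orP[|rr le]; [lia | have := row_mono la (_ : s <= r.-1)%N; lia].
have fK : f (maxn r.+1 (size la)) = 0%N.
  by rewrite /f nth_default ?leq_maxr //; case: eqP => // h; lia.
have [mu E] := partition_of fm fK; rewrite /f in E.
exists mu; split => [//||s|].
- rewrite /rem_row !E eqxx; have := row_mono la (leqnSn r); case: eqP; lia.
- by rewrite E; lia.
- by rewrite /bead E eqxx; lia.
Qed.

(** * Residues, addable and removable boxes *)

(** The residue of a content. *)
Definition res l (c : int) : 'I_l.+1 := Zp1 *~ c.

Lemma resD l c c' : res l (c + c') = res l c + res l c'.
Proof. exact: mulrzDr. Qed.

Lemma resB l c c' : res l (c - c') = res l c - res l c'.
Proof. exact: mulrzBr. Qed.

Lemma res1 l : res l 1 = Zp1.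
Proof. by rewrite /res mulr1z. Qed.

Lemma res_nat l n : res l n%:Z = inZp n.
Proof.
rewrite /res -pmulrn Zp_mulrn; apply/val_inj => /=.
by case: l => [|m]; rewrite ?modn1 // (modn_small (_ : 1 < m.+2)%N) // mul1n.
Qed.

Lemma res_natE l n : res l n%:Z = Zp1 *+ n.
Proof. by rewrite /res -pmulrn. Qed.

Lemma res_eq0 l c : (res l c == 0) = (l.+1 %| c)%Z.
Proof.
rewrite /res; case: c => n; first by rewrite -pmulrn Zp1_mulrn_eq0.
by rewrite NegzE mulrNz oppr_eq0 -pmulrn Zp1_mulrn_eq0.
Qed.

Lemma res_eq l c c' : (res l c == res l c') = (l.+1 %| c - c')%Z.
Proof. by rewrite -subr_eq0 -resB res_eq0. Qed.

Lemma residueE l b : residue l b = res l (content b).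
Proof. by rewrite /content resB !res_nat. Qed.

(** Count the boxes by rows; K may exceed the number of rows, the extra rows being
empty. *)
Lemma ResE l la K i : (size la <= K)%N ->
  Res l la i = \sum_(r < K) \sum_(s < part la r) (res l (s%:Z - r%:Z) == i)%:R.
Proof.
move=> /subnKC <-; rewrite ffunE -sum1_count big_mkcond /boxes big_allpairs_dep /=.
rewrite big_split_ord /= [X in _ = _ + X]big1 ?addr0; last first.
  by move=> r _; rewrite nth_default ?leq_addr // big_ord0.
have -> : iota 0 (size la) = index_iota 0 (size la) by rewrite /index_iota subn0.
rewrite big_mkord -natz natr_sum; apply: eq_bigr => r _.
have -> : iota 0 (part la r) = index_iota 0 (part la r) by rewrite /index_iota subn0.
rewrite big_mkord natr_sum; apply: eq_bigr => s _.
by rewrite residueE /content /=; case: eqP.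
Qed.

(** Along a row the contributions of consecutive boxes cancel, and only the two
ends of the row remain: its bead, and the bead it would have if it were empty. *)
Lemma Res_diff l la K i : (size la <= K)%N ->
  Res l la i - Res l la (i + Zp1) =
  \sum_(r < K) ((res l (bead la r) == i)%:R - (res l (- r%:Z - 1) == i)%:R).
Proof.
move=> laK; rewrite !(@ResE _ _ K) // -sumrB; apply: eq_bigr => r _.
rewrite -sumrB /bead; elim: (part la r) => [|n IH].
  by rewrite big_ord0 sub0r subrr.
rewrite big_ord_recr /= IH; set a := (_ == i); set c := (_ == i).
have -> : (res l (n%:Z - r%:Z) == i + Zp1) = a.
  by rewrite /a -[in RHS](inj_eq (addIr Zp1)) -(res1 l) -resD subrK.
have -> : (res l (n.+1%:Z - r%:Z - 1) == i) = (res l (n%:Z - r%:Z) == i).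
  by congr (res l _ == _); lia.
ring.
Qed.

Definition add_count l la (j : 'I_l.+1) K : nat :=
  \sum_(r < K) (add_row la r && (res l (bead la r + 1) == j)).
Definition rem_count l la (j : 'I_l.+1) K : nat :=
  \sum_(r < K) (rem_row la r && (res l (bead la r) == j)).

(** Subtract two instances of the previous formula; the beads of the empty rows
telescope, and the boundary term supplies row K on the addable side. *)
Lemma coroot_val_Res_raw l la K j : (size la <= K)%N ->
  coroot_val (Res l la) j = \sum_(r < K.+1) (res l (bead la r + 1) == j)%:R
    - \sum_(r < K) (res l (bead la r) == j)%:R.
Proof.
move=> laK; rewrite /coroot_val /lap.
have e1 := Res_diff (j - Zp1) laK; have e2 := Res_diff j laK.
rewrite subrK in e1.
transitivity ((j == 0)%:R + (Res l la (j - Zp1) - Res l la j) - (Res l la j - Res l la (j + Zp1))).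
  by ring.
rewrite e1 e2 => {e1 e2}.
have S c : (res l c == j - Zp1) = (res l (c + 1) == j).
  by rewrite resD res1 -(inj_eq (addIr Zp1) (res l c)) subrK.
under eq_bigr => i _ do rewrite !S [- _ - 1 + 1]subrK.
rewrite big_ord_recr /= !sumrB.
have -> : bead la K + 1 = - K%:Z by rewrite /bead nth_default //; lia.
have T : \sum_(r < K) (res l (- r%:Z) == j)%:R - \sum_(r < K) (res l (- r%:Z - 1) == j)%:R
     = ((j == (0 : 'I_l.+1)%R)%:R - (res l (- K%:Z) == j)%:R)%R :> int.
  rewrite -sumrB; elim: (K) => [|n IH].
    by rewrite big_ord0 oppr0 [res l 0]mulr0z eq_sym subrr.
  have e : - n.+1%:Z = - n%:Z - 1 by lia.
  rewrite big_ord_recr IH e /=.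
  ring.
have arith (d A B C D k : int) : A - B = d - k -> d + (C - A) - (D - B) = C + k - D.
  by lia.
exact: arith T.
Qed.

(** A row that cannot be extended is as long as the row above it, which then cannot
be shortened; the contributions of these two rows cancel. *)
Lemma coroot_val_Res l la K j : (size la <= K)%N ->
  coroot_val (Res l la) j = (add_count la j K.+1)%:Z - (rem_count la j K)%:Z.
Proof.
move=> laK; rewrite (coroot_val_Res_raw _ laK) /add_count /rem_count.
rewrite -![Posz _]natz !natr_sum !big_ord_recl /= -!addrA -!sumrB.
congr (_ + _); apply: eq_bigr => r _; rewrite /bump /= add1n.
rewrite /add_row /rem_row /=; case: ltnP => //= h; rewrite subrr.
rewrite (_ : bead la r.+1 + 1 = bead la r) ?subrr //.
have := row_mono la (leqnSn r); rewrite /bead; lia.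
Qed.

Lemma add_countP l la (j : 'I_l.+1) K : (0 < add_count la j K)%N ->
  exists r, add_row la r /\ res l (bead la r + 1) = j.
Proof.
rewrite lt0n sum_nat_eq0 => /forallPn[r]; rewrite implyTb eqb0 negbK => /andP[ar /eqP rj].
by exists r.
Qed.

Lemma rem_countP l la (j : 'I_l.+1) K : (0 < rem_count la j K)%N ->
  exists r, rem_row la r /\ res l (bead la r) = j.
Proof.
rewrite lt0n sum_nat_eq0 => /forallPn[r]; rewrite implyTb eqb0 negbK => /andP[ar /eqP rj].
by exists r.
Qed.

Lemma rem_row_size la r : rem_row la r -> (r < size la)%N.
Proof. rewrite -row_gt0 /rem_row; lia. Qed.

Lemma rem_count_gt0 l la (j : 'I_l.+1) K r : (size la <= K)%N -> rem_row la r ->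
  res l (bead la r) = j -> (0 < rem_count la j K)%N.
Proof.
move=> laK rr rj; have rK := leq_trans (rem_row_size rr) laK.
by rewrite /rem_count (bigD1 (Ordinal rK)) //= rr rj eqxx.
Qed.

Lemma addable_of_coroot_val l la (j : 'I_l.+1) : 0 < coroot_val (Res l la) j ->
  exists r, add_row la r /\ res l (bead la r + 1) = j.
Proof.
rewrite (coroot_val_Res _ (leqnn _)) => h; apply: (@add_countP _ _ _ (size la).+1); lia.
Qed.

Lemma removable_of_coroot_val l la (j : 'I_l.+1) : coroot_val (Res l la) j < 0 ->
  exists r, rem_row la r /\ res l (bead la r) = j.
Proof.
rewrite (coroot_val_Res _ (leqnn _)) => h; apply: (@rem_countP _ _ _ (size la)); lia.
Qed.

(** If nothing were addable, the coroot would take a negative value. *)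
Lemma addable_of_removable l la (j : 'I_l.+1) r : rem_row la r -> res l (bead la r) = j ->
  0 <= coroot_val (Res l la) j -> exists r, add_row la r /\ res l (bead la r + 1) = j.
Proof.
move=> rr rj; rewrite (coroot_val_Res _ (leqnn _)).
have := rem_count_gt0 (leqnn _) rr rj => c h; apply: (@add_countP _ _ _ (size la).+1); lia.
Qed.

Lemma add_rowE la r : add_row la r <-> ~ isbead la (bead la r + 1).
Proof.
split=> [ar [s sE]|nb].
  have sr : (s < r)%N.
    rewrite ltnNge; apply/negP; rewrite leq_eqVlt => /predU1P[sr|/(bead_lt la)]; last by lia.
    by move: sE; rewrite sr; lia.
  have := row_mono la (_ : s <= r.-1)%N; move: ar sE; rewrite /add_row /bead; lia.
rewrite /add_row; case: r nb => //= r nb; rewrite ltnNge; apply/negP => le.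
apply: nb; exists r; have := row_mono la (leqnSn r); rewrite /bead; lia.
Qed.

Lemma rem_rowE la r : rem_row la r <-> ~ isbead la (bead la r - 1).
Proof.
split=> [rr [s sE]|nb].
  have sr : (r < s)%N.
    rewrite ltnNge; apply/negP; rewrite leq_eqVlt => /predU1P[sr|/(bead_lt la)]; last by lia.
    by move: sE; rewrite sr; lia.
  have := row_mono la sr; move: rr sE; rewrite /rem_row /bead; lia.
rewrite /rem_row ltnNge; apply/negP => le.
apply: nb; exists r.+1; have := row_mono la (leqnSn r); rewrite /bead; lia.
Qed.

(** On the ell-abacus all beads are pushed down as far as possible. *)
Definition flush l la := forall p, isbead la p -> isbead la (p - l.+1%:Z).

Lemma flush_down l la p k : flush l la -> isbead la p -> isbead la (p - k%:Z * l.+1%:Z).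
Proof.
move=> fl bp; elim: k => [|k /fl]; first by rewrite mul0r subr0.
by rewrite (_ : _ - _ = p - k.+1%:Z * l.+1%:Z) //; lia.
Qed.

(** The two boxes have congruent contents. Sliding the upper of the two beads down
its runner of the abacus lands next to the other bead, on a place that is empty
because the box is removable (or addable). *)
Lemma flush_not_both l la r s : flush l la -> add_row la r -> rem_row la s ->
  res l (bead la r + 1) <> res l (bead la s).
Proof.
move=> fl /add_rowE ar /rem_rowE rs /eqP; rewrite res_eq => /dvdzP[q].
case: q => q E.
  apply: rs; have := @flush_down _ _ (bead la r) q fl (ex_intro _ r erefl).
  by rewrite (_ : _ - _ = bead la s - 1) //; lia.
apply: ar; have := @flush_down _ _ (bead la s) q.+1 fl (ex_intro _ s erefl).
by rewrite (_ : _ - _ = bead la r + 1) //; lia.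
Qed.

(** * Removing rim hooks *)

Lemma reachable_trans (T : Type) (R : T -> T -> Prop) x y z :
  clos_refl_trans_1n T R x y -> clos_refl_trans_1n T R y z -> clos_refl_trans_1n T R x z.
Proof. by elim=> // u v w uv _ IH /IH; apply: rt1n_trans. Qed.

Lemma Res_perm l la mu (s : seq box) i : perm_eq (boxes la) (s ++ boxes mu) ->
  Res l la i = Res l mu i + (count (fun b => residue l b == i) s)%:Z.
Proof. by move=> /permP E; rewrite !ffunE E count_cat addnC PoszD. Qed.

Lemma Res_remove_box l (P : pred box) la mu : remove_box P la mu ->
  exists b, [/\ P b, removable la b & Res l la = Res l mu + sroot (residue l b)].
Proof.
move=> /remove_box_perm[b [rb Pb E]]; exists b; split => //; apply/ffunP => i.
by rewrite (@Res_perm l la mu [:: b]) // [RHS]ffunE [sroot _ _]ffunE /= addn0 eq_sym; case: eqP.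
Qed.

Lemma subpartition_perm mu la : subpartition mu la ->
  perm_eq (boxes la) ([seq b <- boxes la | b \notin boxes mu] ++ boxes mu).
Proof.
move=> sub; have mu_la : {subset boxes mu <= boxes la}.
  by elim: sub => [x c //|x y z [b [_ _ E]]] _ IH c /IH; rewrite E mem_filter => /andP[].
apply: uniq_perm; rewrite ?cat_uniq ?filter_uniq ?boxes_uniq //= ?andbT.
  by apply/hasPn => c cmu; rewrite mem_filter negb_and negbK cmu.
move=> c; rewrite mem_cat mem_filter.
by have := mu_la c; case: (c \in boxes mu); case: (c \in boxes la) => //= /(_ isT).
Qed.

(** As many distinct residues as there are residues: each occurs once. *)
Lemma uniq_full_count l (t : seq 'I_l.+1) i : uniq t -> size t = l.+1 -> count_mem i t = 1%N.
Proof.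
move=> ut st; rewrite count_uniq_mem //.
have sub : {subset t <= enum 'I_l.+1} by move=> x _; rewrite mem_enum.
by have [|_ ->] := uniq_min_size ut sub; rewrite ?size_enum_ord ?st ?mem_enum.
Qed.

(** The ell removed boxes have ell distinct residues, hence every residue once. *)
Lemma Res_remove_ell l la mu : remove_ell l la mu -> Res l la = Res l mu + delta l.
Proof.
case=> /subpartition_perm E sz un; apply/ffunP => i.
rewrite (Res_perm i E) [RHS]ffunE [delta l i]ffunE.
have := uniq_full_count i un; rewrite size_map sz => /(_ erefl); rewrite count_map => H.
by congr (_ + Posz _); rewrite -[RHS]H; apply: eq_count.
Qed.

Lemma size_remove_ell l la mu : remove_ell l la mu ->
  size (boxes la) = (size (boxes mu) + l.+1)%N.
Proof. by case=> /subpartition_perm/perm_size -> sz _; rewrite size_cat sz addnC. Qed.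

Lemma clos_remove_ell l la mu : clos_refl_trans_1n _ (remove_ell l) la mu ->
  exists k, Res l la = Res l mu + delta l *+ k /\
    size (boxes la) = (k * l.+1 + size (boxes mu))%N.
Proof.
elim=> [x|x y z /[dup] xy /size_remove_ell sxy _ [k [E sE]]].
  by exists 0%N; rewrite mulr0n addr0.
exists k.+1; rewrite (Res_remove_ell xy) E mulrSr addrA; split=> //.
by rewrite sxy sE; lia.
Qed.

(** Each step decreases the number of boxes. *)
Lemma core_exists l la : exists nu, is_Core_ell l la nu.
Proof.
have [n] := ubnP (size (boxes la)); elim: n la => // n IH la /ltnSE sz.
have [[mu rm]|nc] := pselect (exists mu, remove_ell l la mu); last first.
  by exists la; split; [exact: rt1n_refl | exact: nc].
have [|nu [st cn]] := IH mu.
  by have := size_remove_ell rm; lia.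
by exists nu; split => //; apply: rt1n_trans rm st.
Qed.

(** The case of a rim hook with a single box. *)
Lemma move_bead_one la p : isbead la p -> ~ isbead la (p - 1) -> exists mu b,
  [/\ subpartition mu la, perm_eq (boxes la) (b :: boxes mu), content b = p
    & forall q, isbead mu q <-> q = p - 1 \/ (isbead la q /\ q <> p)].
Proof.
move=> [r <-] /rem_rowE rr; have [mu muE] := remove_rowP rr.
have rb := remove_box_row (P := predT) rr isT muE.
exists mu; have [b [/removable_row[rr' b2] _ pE]] := remove_box_perm rb.
have bE : bead mu r = bead la r - 1.
  by move: rr; rewrite /bead muE eqxx /rem_row; lia.
have bE' s : s <> r -> bead mu s = bead la s by rewrite /bead muE => /eqP/negPf ->; lia.
have br : b.1 = r.
  have : b \notin boxes mu.
    by have := boxes_uniq la; rewrite (perm_uniq pE) /= => /andP[].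
  have : b \in boxes la by rewrite (perm_mem pE) inE eqxx.
  rewrite !mem_boxes muE; case: eqP => //; lia.
exists b; split => //.
- exact: rt1n_trans rb (rt1n_refl _ _ _).
- by move: rr'; rewrite /content b2 br /bead /rem_row; lia.
- move=> q; split=> [[s <-]|[->|[[s <-] ne]]].
  + have [->|sr] := pselect (s = r); [by left | right].
    by rewrite bE' //; split; [exists s | move=> /bead_inj].
  + by exists r.
  + by exists s; rewrite bE' // => sr; apply: ne; rewrite sr.
Qed.

(** Moving a bead down L places removes a rim hook: L boxes whose contents are
L consecutive integers. It is built box by box, by induction on L. If the place
p - 1 is occupied, its bead moves first and makes room; otherwise the bead at p
first moves to p - 1. *)
Lemma move_bead la p L : (0 < L)%N -> isbead la p -> ~ isbead la (p - L%:Z) ->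
  exists mu (s : seq box), [/\ subpartition mu la, perm_eq (boxes la) (s ++ boxes mu),
    perm_eq (map content s) [seq p - t%:Z | t <- iota 0 L]
    & forall q, isbead mu q <-> q = p - L%:Z \/ (isbead la q /\ q <> p)].
Proof.
elim: L la p => // L IH la p _ bp nb.
case: (posnP L) => [L0|Lpos].
  rewrite L0 in nb *; have [mu [b [sub pE cb bd]]] := move_bead_one bp nb.
  by exists mu, [:: b]; split=> //=; rewrite cb subr0.
have pL : p - 1 - L%:Z = p - L.+1%:Z by lia.
have [b1|b1] := pselect (isbead la (p - 1)).
  have [|mu1 [s1 [sub1 pE1 c1 bd1]]] := IH la (p - 1) Lpos b1; first by rewrite pL.
  have [||mu [b [sub pE cb bd]]] := @move_bead_one mu1 p.
  - by apply/bd1; right; split=> //; lia.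
  - by move=> /bd1 []; [lia | case].
  exists mu, (s1 ++ [:: b]); split.
  - exact: reachable_trans sub1 sub.
  - by rewrite -catA (permPl pE1) perm_cat2l.
  - rewrite map_cat /= cb perm_catC /= subr0 perm_cons (permPl c1).
    rewrite (iotaDl 1 0) -map_comp; apply/permP => P; rewrite !count_map.
    by apply: eq_count => t /=; congr P; lia.
  - move=> q; rewrite bd bd1 pL; split.
      by move=> [->|[[->|[h1 h2]] h3]]; [right; split=> //; lia | left | right].
    case=> [->|[h1 h2]]; first by right; split; [left | lia].
    by have [->|h] := pselect (q = p - 1); [left | right; split=> //; right].
have [mu1 [b [sub1 pE1 cb bd1]]] := move_bead_one bp b1.
have [||mu [s [sub pE c bd]]] := IH mu1 (p - 1) Lpos.
- by apply/bd1; left.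
- by rewrite pL => /bd1 []; [lia | case].
exists mu, (b :: s); split.
- exact: reachable_trans sub1 sub.
- by rewrite (permPl pE1) /= perm_cons.
- rewrite /= cb subr0 perm_cons (permPl c) (iotaDl 1 0) -map_comp.
  by apply/permP => P; rewrite !count_map; apply: eq_count => t /=; congr P; lia.
- move=> q; rewrite bd bd1 pL; split; first by move=> [->|[[->|h1] h3]]; [left | | right].
  case=> [->|[h1 h2]]; [by left | right; split; [by right|]].
  by move=> qp; apply: b1; rewrite -qp.
Qed.

(** A bead with an empty place ell below it would give a rim hook of ell boxes with
consecutive contents, so with distinct residues. *)
Lemma core_flush l la : ell_core l la -> flush l la.
Proof.
move=> co p bp; have [//|nb] := pselect (isbead la (p - l.+1%:Z)).
case: co; have [mu [s [sub pE cE _]]] := move_bead (ltn0Sn l) bp nb.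
have sE : perm_eq s [seq b <- boxes la | b \notin boxes mu].
  have := subpartition_perm sub; rewrite (permPl pE) perm_cat2r //.
exists mu; split => //.
  by rewrite -(perm_size sE) -(size_map content) (perm_size cE) size_map size_iota.
rewrite -(perm_uniq (perm_map _ sE)).
have -> : map (residue l) s = map (res l) (map content s).
  by rewrite -map_comp; apply: eq_map => b; rewrite residueE.
rewrite (perm_uniq (perm_map _ cE)) -map_comp map_inj_in_uniq ?iota_uniq //.
move=> t u; rewrite !mem_iota !add0n /= => tl ul /eqP.
rewrite res_eq (_ : _ - _ = u%:Z - t%:Z); last by lia.
by rewrite -eqz_mod_dvd !modz_nat !modn_small // => /eqP[].
Qed.

(** * Cores: uniqueness and weight zero *)

(** On each runner of the abacus two flush configurations are nested. If p were a
bead of la only, the beads of mu on the runner of p would form a proper subset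
of those of la, against the equality of the counts. *)
Lemma flush_sub l la mu K p : flush l la -> flush l mu ->
  (size la <= K)%N -> (size mu <= K)%N ->
  (forall i : 'I_l.+1, \sum_(r < K) (res l (bead la r) == i)%:R =
     \sum_(r < K) (res l (bead mu r) == i)%:R :> int) ->
  isbead la p -> isbead mu p.
Proof.
move=> fla fmu laK muK cnt bp; have [//|nb] := pselect (isbead mu p).
(* the beads of rows below K on the runner of p *)
pose runner (ka : int_partition) :=
  [seq bead ka r | r <- iota 0 K & res l (bead ka r) == res l p].
have size_runner (ka : int_partition) :
    (size (runner ka))%:Z = \sum_(r < K) (res l (bead ka r) == res l p)%:R.
  rewrite size_map size_filter -sum1_count big_mkcond -natz natr_sum /=.
  have -> : iota 0 K = index_iota 0 K by rewrite /index_iota subn0.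
  by rewrite big_mkord; apply: eq_bigr => r _; case: eqP.
have sz : size (runner la) = size (runner mu).
  by have := size_runner la; rewrite cnt -size_runner => -[].
have un ka : uniq (runner ka).
  by rewrite map_inj_uniq ?filter_uniq ?iota_uniq //; apply: bead_inj.
suff: (size (p :: runner mu) <= size (runner la))%N by rewrite sz /= ltnn.
apply: uniq_leq_size.
  by rewrite /= un andbT; apply/mapP => -[r _ pE]; apply: nb; exists r.
have low (ka : int_partition) r : (size ka <= K)%N -> (r < K)%N = (- K%:Z <= bead ka r).
  move=> kK; rewrite /bead; case: (ltnP r K) => rK; first by apply/esym; lia.
  by rewrite nth_default ?(leq_trans kK) //; apply/esym; lia.
have in_runner q : isbead la q -> - K%:Z <= q -> res l q = res l p -> q \in runner la.
  move=> [r <-] qK qp; apply/mapP; exists r => //.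
  by rewrite mem_filter mem_iota /= add0n (low la) // qK qp eqxx.
move=> q; rewrite inE => /predU1P[->|/mapP[r]].
  apply: in_runner => //; have [r rE] := bp.
  rewrite -rE -low // ltnNge; apply/negP => Kr.
  by apply: nb; exists r; rewrite -rE /bead !nth_default // (leq_trans _ Kr).
rewrite mem_filter mem_iota add0n => /= /andP[/eqP qp rK] qE.
apply: in_runner; rewrite ?qE -?low //.
move: qp => /eqP; rewrite res_eq => /dvdzP[c]; case: c => c E.
  case: nb; have := flush_down c fmu (ex_intro _ r erefl).
  by rewrite (_ : _ - _ = p) //; lia.
have := flush_down c.+1 fla bp.
by rewrite (_ : _ - _ = bead mu r) //; lia.
Qed.

(** The differences of consecutive residue counts are, up to a constant, the
numbers of beads on the runners. *)
Lemma flush_unique l la mu : flush l la -> flush l mu ->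
  (forall i, Res l la i - Res l la (i + Zp1) = Res l mu i - Res l mu (i + Zp1)) ->
  la = mu.
Proof.
move=> fla fmu E; pose K := maxn (size la) (size mu).
have laK : (size la <= K)%N by rewrite leq_maxl.
have muK : (size mu <= K)%N by rewrite leq_maxr.
have cnt i : \sum_(r < K) (res l (bead la r) == i)%:R =
     \sum_(r < K) (res l (bead mu r) == i)%:R :> int.
  have := E i; rewrite (Res_diff _ laK) (Res_diff _ muK) !sumrB.
  by move=> /addIr.
by apply: isbead_ext => p; split; apply: (@flush_sub l _ _ K).
Qed.

Lemma weight2_empty l la : size la = 0%N -> weight2 (Res l la) = 0.
Proof.
move=> s0; have Z i : Res l la i = 0 by rewrite (@ResE _ _ 0) ?s0 // big_ord0.
by rewrite /weight2 Z /form big1 // => i _; rewrite Z mul0r.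
Qed.

(** Removing all removable j-boxes at once; when no j-box is addable this is the
action of the simple reflection s_j on partitions. *)
Lemma remove_all l la (j : 'I_l.+1) : exists mu, forall r,
  (part mu r = part la r - (rem_row la r && (res l (bead la r) == j)))%N.
Proof.
apply: (@partition_of _ (size la)) => [s t|]; last by rewrite nth_default.
rewrite leq_eqVlt => /predU1P[-> //|st].
have := row_mono la st; have := row_mono la (leqnSn s); rewrite /rem_row.
by case: (_ == j); case: (_ == j); rewrite ?andbT ?andbF; lia.
Qed.

Section RemoveAll.
Variables (l : nat) (la mu : int_partition) (j : 'I_l.+1).
Hypothesis muE : forall r,
  (part mu r = part la r - (rem_row la r && (res l (bead la r) == j)))%N.

Lemma remove_all_size : (size mu <= size la)%N.
Proof. by rewrite leqNgt -row_gt0 muE nth_default. Qed.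

Lemma remove_all_Res i :
  Res l mu i = Res l la i - (i == j)%:R * (rem_count la j (size la))%:Z.
Proof.
apply/eqP; rewrite eq_sym subr_eq; apply/eqP.
rewrite (ResE _ (leqnn _)) (ResE _ remove_all_size) -natz natr_sum mulr_sumr.
rewrite -big_split; apply: eq_bigr => r _ /=; rewrite muE.
case: andP => [[rr /eqP rj]|_]; last by rewrite mulr0 addr0 subn0.
have -> : part la r = (part la r).-1.+1 by move: rr; rewrite /rem_row; lia.
rewrite big_ord_recr /= subn1 mulr1 -rj eq_sym; congr (_ + (_ == res l _)%:R).
by move: rr; rewrite /bead /rem_row; lia.
Qed.

Lemma remove_all_bead r :
  bead mu r = bead la r - (rem_row la r && (res l (bead la r) == j))%:R.
Proof.
rewrite /bead muE; have: rem_row la r -> (0 < part la r)%N by rewrite /rem_row; lia.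
by case: (rem_row la r) => [/(_ isT)|_] /=; [case: (_ == j) => /= |]; lia.
Qed.

Lemma remove_all_moved p : isbead la p -> res l p = j -> ~ isbead la (p - 1) ->
  isbead mu (p - 1).
Proof. by move=> [r <-] rj /rem_rowE rr; exists r; rewrite remove_all_bead rr rj eqxx. Qed.

Lemma remove_all_kept p : isbead la p -> ~ (res l p = j /\ ~ isbead la (p - 1)) ->
  isbead mu p.
Proof.
move=> [r <-] nc; exists r; rewrite remove_all_bead.
case: andP => [[/rem_rowE rr /eqP rj]|_]; last by rewrite subr0.
by case: nc.
Qed.

(** Removing all j-boxes moves beads from the runner of j to the preceding runner.
Every bead moves in the same way as the bead ell places below it, unless the
place left of the lower bead is occupied, and then it is occupied in the new
configuration too. *)
Lemma remove_all_flush : (0 < l)%N -> flush l la -> flush l mu.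
Proof.
move=> l0 fl q [r <-]; rewrite remove_all_bead.
set p := bead la r; have bp : isbead la p by exists r.
have resl c : res l (c - l.+1%:Z) = res l c.
  by apply/eqP; rewrite res_eq addrAC subrr sub0r dvdzE abszN.
case: andP => [[/rem_rowE nb /eqP pj]|nc].
  rewrite (_ : _ - _ - _ = p - l.+1%:Z - 1); last by rewrite addrAC.
  have [b1|b1] := pselect (isbead la (p - l.+1%:Z - 1)).
    apply: remove_all_kept b1 _ => -[+ _].
    rewrite resB resl pj res1 => /eqP; apply/negP; exact: subZp1_neq.
  by apply: remove_all_moved; rewrite ?resl //; apply: fl.
rewrite subr0; apply: remove_all_kept => [|[]]; first exact: fl.
rewrite resl => pj b1; apply: nc; split; last exact/eqP.
apply/rem_rowE => /fl b2; apply: b1.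
by rewrite addrAC.
Qed.

Lemma remove_all_lt r : rem_row la r -> res l (bead la r) = j ->
  (size (boxes mu) < size (boxes la))%N.
Proof.
move=> rr rj; apply: (@uniq_leq_size _ ((r, (part la r).-1) :: boxes mu)).
  by rewrite /= boxes_uniq mem_boxes /= muE rr rj eqxx andbT; lia.
move=> c; rewrite inE !mem_boxes => /predU1P[->|]; first by move: rr; rewrite /rem_row /=; lia.
by rewrite muE; lia.
Qed.

End RemoveAll.

(** Induction on the size: a nonempty flush partition has a removable j-box for
some j and then no addable one, so removing all its j-boxes realizes s_j, which
preserves the weight. *)
Lemma flush_weight2 l la : flush l la -> weight2 (Res l la) = 0.
Proof.
have [n] := ubnP (size (boxes la)); elim: n la => // n IH la /ltnSE sz fl.
have [s0|s0] := posnP (size la); first exact: weight2_empty.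
pose r := (size la).-1.
have rr : rem_row la r by rewrite /rem_row nth_default ?row_gt0 /r; lia.
pose j := res l (bead la r).
have l0 : (0 < l)%N.
  rewrite lt0n; apply/eqP => l0.
  have ar : add_row la 0 by [].
  apply: (flush_not_both fl ar rr); apply: val_inj.
  by case: (res _ _) (res _ _) => [x xl] [y yl] /=; lia.
have [mu muE] := remove_all la j.
have flmu := remove_all_flush muE l0 fl.
rewrite -(IH mu (leq_trans (remove_all_lt muE rr erefl) sz) flmu).
rewrite -(weight2_dot_refl j (Res l la) l0); congr weight2; apply/ffunP => i.
rewrite (remove_all_Res muE) ffunE (coroot_val_Res _ (leqnn _)).
have -> : add_count la j (size la).+1 = 0%N; last by rewrite sub0r mulrN.
apply/eqP; rewrite -leqn0 leqNgt; apply/negP => /add_countP[s [ar sj]].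
exact: flush_not_both fl ar rr sj.
Qed.

Lemma core_unique l nu nu' k k' : ell_core l nu -> ell_core l nu' ->
  Res l nu + delta l *+ k = Res l nu' + delta l *+ k' -> nu = nu'.
Proof.
move=> /core_flush f /core_flush f' /ffunP E; apply: flush_unique f f' _ => i.
have := E i; have := E (i + Zp1); rewrite !ffunE !ffunMnE !ffunE; lia.
Qed.

Lemma sum_cycles_row l (a : int) n i :
  \sum_(t < n * l.+1) (res l (t%:Z + a) == i)%:R = n%:Z.
Proof.
transitivity (\sum_(t < n * l.+1) (res l a + Zp1 *+ t == i)%:R : int).
  by apply: eq_bigr => t _; rewrite resD addrC res_natE.
rewrite (@sum_cycle _ _ (fun x => (x == i)%:R)).
have -> : \sum_x (x == i)%:R = 1 :> int; last exact: natz.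
by rewrite (bigD1 i) //= eqxx big1 ?addr0 // => x /negPf ->.
Qed.

(** Lengthen the first rows by multiples of ell, by ell more in each row than in the
next one. This adds a multiple of delta and makes each of these rows
extendable. An empty row with the right residue then receives one box. *)
Lemma residue_class_add l la (j : 'I_l.+1) : exists mu (k : int),
  forall i, Res l mu i = Res l la i + (i == j)%:R + k.
Proof.
(* the first empty row whose next box has residue j *)
pose t := nat_of_ord (res l (- (size la)%:Z) - j).
have tl : (t < l.+1)%N by apply: ltn_ord.
pose r0 := (size la + t)%N; pose N := (size la + l.+1)%N.
have r0N : (r0 < N)%N by rewrite ltn_add2l.
have r0j : res l (- r0%:Z) = j.
  by rewrite /r0 PoszD opprD resB res_natE /t Zp1_mulrn_ord subKr.
pose f r := if (r < N)%N then (part la r + (N - r) * l.+1 + (r == r0))%N else 0%N.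
have fm : {homo f : r s / (r <= s)%N >-> (s <= r)%N}.
  move=> r s rs; rewrite /f; case: (ltnP s N) => sN //; rewrite (leq_ltn_trans rs sN).
  move: rs; rewrite leq_eqVlt => /predU1P[-> //|rs].
  have le1 := row_mono la (ltnW rs).
  have le2 : ((N - s) * l.+1 + l.+1 <= (N - r) * l.+1)%N.
    by rewrite -mulSnr leq_mul2r; apply/orP; right; lia.
  by case: (s == r0); case: (r == r0); lia.
have fN : f N = 0%N by rewrite /f ltnn.
have [mu muE] := partition_of fm fN.
exists mu; exists (\sum_(r < N) (N - r)%N%:Z) => i.
have muN : (size mu <= N)%N by rewrite leqNgt -row_gt0 muE fN.
rewrite (ResE _ muN) (@ResE l la N) ?leq_addr //.
have -> : (i == j)%:R = \sum_(r < N) (r == r0 :> nat)%:R * (i == j)%:R :> int.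
  rewrite (bigD1 (Ordinal r0N)) //= eqxx mul1r big1 ?addr0 // => r.
  by rewrite -val_eqE /= => /negPf ->; rewrite mul0r.
rewrite -!big_split; apply: eq_bigr => r _ /=; rewrite muE /f ltn_ord.
have cyc n : \sum_(s < n + (N - r) * l.+1) (res l (s%:Z - r%:Z) == i)%:R =
    \sum_(s < n) (res l (s%:Z - r%:Z) == i)%:R + (N - r)%:Z.
  rewrite big_split_ord /=; congr (_ + _).
  rewrite -(sum_cycles_row (n%:Z - r%:Z) (N - r) i); apply: eq_bigr => s _.
  by congr (res l _ == _)%:R; lia.
case: eqP => [rr0|_] /=; last by rewrite addn0 cyc mul0r addr0.
rewrite addnAC cyc addn1 big_ord_recr /= mul1r; congr (_ + _ + _).
have -> : part la r = 0%N by rewrite nth_default // rr0 leq_addr.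
by rewrite sub0r rr0 r0j eq_sym.
Qed.

(** Add the required boxes one by one. *)
Lemma residue_class_exists l (d : {ffun 'I_l.+1 -> int}) : exists la (k : int),
  forall i, Res l la i = d i + k.
Proof.
have pos : forall n (e : {ffun 'I_l.+1 -> int}), nonneg e -> (\sum_i e i = n%:Z) ->
    exists la (k : int), forall i, Res l la i = e i + k.
  elim=> [|n IH] e e0 sumE.
    have [|//|la laE] := @partition_of (fun _ => 0%N) 0; first by [].
    exists la, 0 => i; have s0 : size la = 0%N.
      by apply/eqP; rewrite -leqn0 leqNgt -row_gt0 laE.
    rewrite (@ResE _ _ 0) ?s0 // big_ord0 addr0.
    by have /psumr_eq0P -> := sumE.
  have [j ej] : exists j, 0 < e j.
    have [j ej|none] := pickP (fun j => 0 < e j); first by exists j.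
    have: \sum_i e i <= 0; last by rewrite sumE.
    by apply: sumr_le0 => i _; rewrite leNgt none.
  have [||la [k laE]] := IH (e - sroot j).
  - by move=> i; rewrite !ffunE; have := e0 i; case: eqP => [->|_] /=; lia.
  - under eq_bigr do rewrite !ffunE.
    rewrite sumrB sumE (bigD1 j) //= eqxx big1 ?addr0; first by lia.
    by move=> i /negPf ->.
  have [mu [k' muE]] := residue_class_add la j.
  by exists mu, (k + k') => i; rewrite muE laE !ffunE; ring.
(* shifting by a multiple of delta makes d nonnegative *)
pose m := \sum_i `|d i|; pose e : {ffun 'I_l.+1 -> int} := [ffun i => d i + m].
have e0 : nonneg e.
  move=> i; rewrite ffunE /m (bigD1 i) //=.
  have : 0 <= \sum_(k | k != i) `|d k| by apply: sumr_ge0.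
  by move: (\sum_(_ | _) _) => x; lia.
have sum0 : 0 <= \sum_i e i by apply: sumr_ge0 => i _; apply: e0.
have [la [k laE]] := pos `|(\sum_i e i)%R|%N e e0 (esym (gez0_abs sum0)).
exists la, (k + m) => i; rewrite laE ffunE; ring.
Qed.

(** * Dominance and the growth of partitions *)

(** The weight of Res(la) is the number of strips removed on the way to the core. *)
Lemma weight2_Res_ge0 l la : 0 <= weight2 (Res l la).
Proof.
have [nu [/clos_remove_ell[k [-> _]] /core_flush fl]] := core_exists l la.
by rewrite weight2_delta (flush_weight2 fl) add0r mulrn_wge0 // ler0n.
Qed.

(** The class of d modulo delta contains Res(nu) for an ell-core nu; as Res(nu) has
weight 0, the multiple of delta is the weight of d. *)
Lemma core_decomposition l (d : {ffun 'I_l.+1 -> int}) : 0 <= weight2 d ->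
  exists nu n, ell_core l nu /\ d = Res l nu + delta l *+ n.
Proof.
move=> wd; have [la [k laE]] := residue_class_exists d.
have [nu [/clos_remove_ell[m [ResE' _]] co]] := core_exists l la.
have dE i : d i = Res l nu i + m%:Z - k.
  have := laE i; rewrite ResE' ffunE ffunMnE [delta l i]ffunE.
  by move: (Res l nu i) (d i) => x y; lia.
case: (lerP k m%:Z) => km.
  exists nu, `|(m%:Z - k)%R|%N; split=> //; apply/ffunP => i.
  rewrite dE [RHS]ffunE ffunMnE [delta l i]ffunE -addrA; congr (_ + _).
  by move: km; lia.
have E : Res l nu = d + delta l *+ `|(k - m%:Z)%R|%N.
  apply/ffunP => i; rewrite [RHS]ffunE ffunMnE dE [delta l i]ffunE.
  by move: (Res l nu i) km => x km; lia.
have := flush_weight2 (core_flush co); rewrite E weight2_delta; move: wd km.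
by move: (weight2 d) => w; rewrite -mulr_natr natz; lia.
Qed.

Lemma removable_box la r : rem_row la r -> removable la (r, (part la r).-1).
Proof. rewrite /rem_row /removable !mem_boxes /=; lia. Qed.

Lemma residue_removable l la b : removable la b ->
  rem_row la b.1 /\ residue l b = res l (bead la b.1).
Proof.
move=> /removable_row[rr b2]; split=> //; rewrite residueE; congr res.
by move: rr; rewrite /content b2 /bead /rem_row; lia.
Qed.

Lemma J_core_dominant l (J : {set 'I_l.+1}) la j :
  J_core J la -> j \in J -> 0 <= coroot_val (Res l la) j.
Proof.
move=> co jJ; rewrite leNgt; apply/negP => /removable_of_coroot_val[r [rr rj]].
have rb := removable_box rr; have /negP := co (r, (part la r).-1).
by rewrite rb /J_box; have [_ ->] := residue_removable l rb; rewrite rj jJ.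
Qed.

(** With a removable j-box and a nonnegative coroot value there would also be an
addable j-box. *)
Lemma dominant_core_J_core l (J : {set 'I_l.+1}) nu : ell_core l nu ->
  (forall j, j \in J -> 0 <= coroot_val (Res l nu) j) -> J_core J nu.
Proof.
move=> /core_flush fl dom b; apply/negP => /andP[/(residue_removable l)[rr rb] bJ].
have [r [ar rE]] := addable_of_removable rr (esym rb) (dom _ bJ).
by apply: flush_not_both fl ar rr _; rewrite rE rb.
Qed.

(** A nonempty partition has a removable box. *)
Lemma dominant_core_empty l nu : ell_core l nu ->
  (forall j, 0 <= coroot_val (Res l nu) j) -> Res l nu = 0.
Proof.
move=> co dom; apply/ffunP => i; rewrite (@ResE _ _ (size nu)) // big1 ?ffunE // => r _.
suff: size nu = 0%N by case: r => r /= + s0; rewrite s0.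
apply/eqP; rewrite -leqn0 leqNgt; apply/negP => s0.
have rr : rem_row nu (size nu).-1 by rewrite /rem_row nth_default ?row_gt0; lia.
have := @dominant_core_J_core l [set: 'I_l.+1] nu co (fun j _ => dom j)
  ((size nu).-1, (part nu (size nu).-1).-1).
by rewrite (removable_box rr) /J_box inE.
Qed.

Lemma Res_remove_J l (J : {set 'I_l.+1}) la ka :
  clos_refl_trans_1n _ (remove_box (J_box J)) la ka ->
  forall i, Res l ka i <= Res l la i /\ (i \notin J -> Res l la i = Res l ka i).
Proof.
elim=> [x i //|x y z /(Res_remove_box l)[b [bJ _ ->]] _ IH i].
have [le eq] := IH i.
have -> : (Res l y + sroot (residue l b)) i = Res l y i + (i == residue l b)%:R.
  by rewrite ffunE [sroot _ _]ffunE.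
case: eqP le eq => [->|_] le eq /=; last by rewrite addr0.
by split; [lia | rewrite -/(J_box J b) bJ].
Qed.

Lemma add_J_box l (J : {set 'I_l.+1}) la j : j \in J -> 0 < coroot_val (Res l la) j ->
  exists mu, remove_box (J_box J) mu la /\ Res l mu = Res l la + sroot j.
Proof.
move=> jJ /addable_of_coroot_val[r [ar rj]]; have [mu [_ rr muE bE]] := add_rowP ar.
have Jb : residue l (r, (part mu r).-1) = j.
  by have [_ ->] := residue_removable l (removable_box rr); rewrite bE.
have rm : remove_box (pred1 (r, (part mu r).-1)) mu la.
  by apply: remove_box_row muE => //=.
have [b [/eqP -> _ E]] := Res_remove_box l rm.
exists mu; rewrite -[j in RHS]Jb; split=> //; apply: remove_box_row muE => //.
by rewrite /J_box Jb.
Qed.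

(** On the vectors supported on a proper subset of the vertices the form is positive
definite. *)
Lemma support_descent l (J : {set 'I_l.+1}) (g : {ffun 'I_l.+1 -> int}) : J != [set: 'I_l.+1] ->
  nonneg g -> (forall i, i \notin J -> g i = 0) -> g <> 0 ->
  exists j, [/\ j \in J, 0 < g j & 0 < lap g j].
Proof.
move=> JT g0 gJ gn0.
have [j /and3P[]|none] := pickP (fun j => [&& j \in J, 0 < g j & 0 < lap g j]); first by exists j.
have /subsetPn[i0 _ i0J] : ~~ ([set: 'I_l.+1] \subset J) by rewrite finset.subTset.
case: gn0; apply/ffunP => i; rewrite ffunE.
have le0 : form g g <= 0.
  apply: sumr_le0 => k _; have := none k; have := g0 k.
  have [kJ|/gJ ->] := boolP (k \in J); last by rewrite mul0r.
  rewrite le_eqVlt => /predU1P[<-|gk]; first by rewrite mul0r.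
  by rewrite gk /= => /negbT; rewrite -leNgt pmulr_rle0.
by rewrite (form_le0 le0) -(form_le0 le0 i0) gJ.
Qed.

(** Induction on the height of g. Choose j with g_j > 0 and (g, alpha_j) > 0; since
Res(ka) + g is dominant at j, the coroot value of Res(ka) at j is positive, so
ka has an addable j-box. *)
Lemma grow_to l (J : {set 'I_l.+1}) ka (g : {ffun 'I_l.+1 -> int}) : J != [set: 'I_l.+1] ->
  nonneg g -> (forall i, i \notin J -> g i = 0) ->
  (forall j, j \in J -> 0 <= coroot_val (Res l ka + g) j) ->
  exists la, clos_refl_trans_1n _ (remove_box (J_box J)) la ka /\
    Res l la = Res l ka + g.
Proof.
move=> JT; have [n] := ubnP `|(\sum_i g i)%R|%N.
elim: n ka g => // n IH ka g /ltnSE le g0 gJ dom.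
have [->|/eqP gn0] := eqVneq g 0; first by exists ka; rewrite addr0; split=> //; constructor.
have [j [jJ gj lapj]] := support_descent JT g0 gJ gn0.
have pos : 0 < coroot_val (Res l ka) j.
  by have := dom j jJ; rewrite /coroot_val lapD; move: (lap _ _) (lap _ _) lapj => x y; lia.
have [mu [rm muE]] := add_J_box jJ pos.
have E : Res l ka + g = Res l mu + (g - sroot j) by rewrite muE -addrA (addrC (sroot j)) subrK.
have [|i|i iJ|i iJ|la [st laE]] := IH mu (g - sroot j).
- have e : \sum_i (g - sroot j) i = \sum_i g i - 1.
    under eq_bigr do rewrite !ffunE.
    rewrite sumrB; congr (_ - _); rewrite (bigD1 j) //= eqxx big1 ?addr0 // => i /negPf -> //.
  have := sumr_ge0 (index_enum 'I_l.+1) (P := xpredT) (fun i _ => g0 i).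
  have : 0 < \sum_i g i by rewrite (bigD1 j) //= ltr_pwDl // sumr_ge0.
  by rewrite e; move: (\sum_i g i) le => x; lia.
- by rewrite !ffunE; have := g0 i; case: eqP => [->|_] /=; lia.
- rewrite !ffunE (gJ _ iJ); case: eqP => [ij|//]; by rewrite ij jJ in iJ.
- by rewrite -E dom.
exists la; rewrite laE E; split => //.
by apply: reachable_trans st _; apply: rt1n_trans rm (rt1n_refl _ _ _).
Qed.

(** The ell-core of la has the residues of nu modulo delta, so it is nu. *)
Lemma is_Core_ell_of_Res l la nu k k' : ell_core l nu ->
  Res l la + delta l *+ k' = Res l nu + delta l *+ k ->
  [/\ (k' <= k)%N, is_Core_ell l la nu
   & size (boxes la) = ((k - k') * l.+1 + size (boxes nu))%N].
Proof.
move=> co E; have [nu' [st co']] := core_exists l la.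
have [m [Em sm]] := clos_remove_ell st.
have nu'E : nu' = nu.
  have e : Res l nu' + delta l *+ (m + k') = Res l nu + delta l *+ k.
    by rewrite mulrnDr addrA -Em.
  exact: core_unique co' co e.
rewrite nu'E in st sm Em.
have mk : (m + k')%N = k.
  move/ffunP: E => /(_ 0); rewrite Em !ffunE !ffunMnE !ffunE -addrA => /addrI.
  by rewrite !natz; lia.
by split; [rewrite -mk leq_addl | | rewrite -mk addnK].
Qed.

(** * Families of subspaces and reflection functors *)

Section Families.
Variables (F : fieldType) (l N : nat).
Notation I := 'I_l.+1.
Implicit Types (V W : option I -> 'M[F]_N) (M : arrow l -> 'M[F]_N) (th : {ffun I -> F}).

(** From here on a representation is a family V of row spaces in one ambient space,
indexed by the vertices, together with an endomorphism of the ambient space for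
each arrow. Dimensions are ranks, so no type depends on a vertex, and the spaces
V v need not be independent. *)
Definition stable V M := forall a, (V (src a) *m M a <= V (tgt a))%MS.

(** The left-hand side of the defining relation at the vertex k. *)
Definition moment M k : 'M[F]_N :=
  M (ArrY k) *m M (ArrX k) - M (ArrX (k - Zp1)) *m M (ArrY (k - Zp1))
  + (k == 0)%:R *: (M Arry *m M Arrx).

Definition relation th V M :=
  forall k, V (Some k) *m moment M k = th k *: V (Some k).

Definition simple_family V M :=
  stable V M /\ forall W, stable W M -> (forall v, (W v <= V v)%MS) ->
    (exists v, W v != 0) -> forall v, (V v <= W v)%MS.

Lemma stable_up V M k : stable V M -> (V (Some k) *m M (ArrY k) <= V (Some (k + Zp1)%R))%MS.
Proof. by move=> /(_ (ArrY k)). Qed.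

Lemma stable_down V M k :
  stable V M -> (V (Some k) *m M (ArrX (k - Zp1)%R) <= V (Some (k - Zp1)%R))%MS.
Proof. by move=> /(_ (ArrX (k - Zp1)%R)) /=; rewrite subrK. Qed.

Lemma stable_in V M k : stable V M -> (V (Some (k + Zp1)%R) *m M (ArrX k) <= V (Some k))%MS.
Proof. by move=> /(_ (ArrX k)). Qed.

Lemma stable_in' V M k :
  stable V M -> (V (Some (k - Zp1)%R) *m M (ArrY (k - Zp1)%R) <= V (Some k))%MS.
Proof. by move=> /(_ (ArrY (k - Zp1))) /=; rewrite subrK. Qed.

(** A relation that holds on a subspace holds on everything inside it. *)
Lemma scaled_sub m n (A : 'M[F]_(m, N)) (B : 'M[F]_(n, N)) c (X : 'M[F]_N) :
  (A <= B)%MS -> B *m X = c *: B -> A *m X = c *: A.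
Proof. by move=> /submxP[D ->] E; rewrite -mulmxA E scalemxAr. Qed.

End Families.

(** There is a simple framed representation of dimension vector d, in the ambient
encoding; d has integer values so that reflections can be written directly. *)
Definition has_simple (F : fieldType) l (th : {ffun 'I_l.+1 -> F}) (d : {ffun 'I_l.+1 -> int}) :=
  exists N (V : option 'I_l.+1 -> 'M[F]_N) (M : arrow l -> 'M[F]_N),
    [/\ relation th V M, simple_family V M, \rank (V None) = 1%N
      & forall k, (\rank (V (Some k)))%:Z = d k].


Section Reflection.
Variables (F : fieldType) (l N T : nat) (th : {ffun 'I_l.+1 -> F}) (j : 'I_l.+1).
Notation I := 'I_l.+1.
Variables (V : option I -> 'M[F]_N) (M : arrow l -> 'M[F]_N).
(* three independent copies of the ambient space in a bigger one, with projections *)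
Variables (E1 E2 E3 : 'M[F]_(N, T)) (P1 P2 P3 : 'M[F]_(T, N)).
Hypothesis EP : (E1 *m P1 = 1%:M) * (E1 *m P2 = 0) * (E1 *m P3 = 0) *
  (E2 *m P1 = 0) * (E2 *m P2 = 1%:M) * (E2 *m P3 = 0) *
  (E3 *m P1 = 0) * (E3 *m P2 = 0) * (E3 *m P3 = 1%:M).
Hypotheses (l0 : (0 < l)%N) (rel : relation th V M) (sV : simple_family V M)
  (rank_inf : \rank (V None) = 1%N).

Lemma emb_projK m (X : 'M[F]_(m, N)) :
  (X *m E1 *m P1 = X) * (X *m E1 *m P2 = 0) * (X *m E1 *m P3 = 0) *
  (X *m E2 *m P1 = 0) * (X *m E2 *m P2 = X) * (X *m E2 *m P3 = 0) *
  (X *m E3 *m P1 = 0) * (X *m E3 *m P2 = 0) * (X *m E3 *m P3 = X).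
Proof. by rewrite -!mulmxA !EP !mulmx0 !mulmx1. Qed.

Let eps : F := (j == 0)%:R.
Let jm := j - Zp1.
Let jp := j + Zp1.

Lemma eps_idem : eps * eps = eps.
Proof. by rewrite /eps; case: eqP; rewrite ?mulr1 ?mulr0. Qed.

Lemma jm_neq : (jm == j) = false. Proof. exact/negbTE/subZp1_neq. Qed.
Lemma jp_neq : (jp == j) = false. Proof. exact/negbTE/addZp1_neq. Qed.

Lemma next_eq i : (i + Zp1 == j) = (i == jm).
Proof. by rewrite -(inj_eq (addIr Zp1) i) subrK. Qed.

(** The arrows that leave j, as one map into the sum of the three neighbouring
spaces. *)
Definition to_nbrs : 'M[F]_(N, T) :=
  M (ArrY j) *m E1 + M (ArrX jm) *m E2 + eps *: (M Arry *m E3).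
(** The arrows that enter j, with the signs of the relation. *)
Definition from_nbrs : 'M[F]_(T, N) :=
  P1 *m M (ArrX j) - P2 *m M (ArrY jm) + eps *: (P3 *m M Arrx).

Lemma to_from_nbrs : to_nbrs *m from_nbrs = moment M j.
Proof.
rewrite /to_nbrs /from_nbrs /moment !(mulmxDl, mulmxDr, mulmxN) -!scalemxAl -!scalemxAr !mulmxA.
rewrite !emb_projK !mul0mx !scaler0 !oppr0 !addr0 !add0r scalerA eps_idem.
by [].
Qed.

Lemma to_nbrs_proj : (to_nbrs *m P1 = M (ArrY j)) * (to_nbrs *m P2 = M (ArrX jm)) *
  (to_nbrs *m P3 = eps *: M Arry).
Proof.
by rewrite /to_nbrs !mulmxDl -!scalemxAl !emb_projK !scaler0 !addr0 !add0r.
Qed.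

Lemma emb_from_nbrs : (E1 *m from_nbrs = M (ArrX j)) * (E2 *m from_nbrs = - M (ArrY jm)) *
  (E3 *m from_nbrs = eps *: M Arrx).
Proof.
rewrite /from_nbrs !mulmxDr !mulmxN -!scalemxAr !mulmxA !EP !mul1mx !mul0mx.
by rewrite !scaler0 !oppr0 !addr0 !add0r.
Qed.

Definition nbrs (W : option I -> 'M[F]_N) : 'M[F]_T :=
  (W (Some jp) *m E1 + (W (Some jm) *m E2 + eps *: (W None *m E3)))%MS.

Lemma nbrs_sub m (W : option I -> 'M[F]_N) (X : 'M[F]_(T, m)) k (Y : 'M[F]_(k, m)) :
  (W (Some jp) *m E1 *m X <= Y)%MS -> (W (Some jm) *m E2 *m X <= Y)%MS ->
  (eps *: (W None *m E3 *m X) <= Y)%MS -> (nbrs W *m X <= Y)%MS.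
Proof.
move=> h1 h2 h3; rewrite /nbrs !addsmxMr addsmx_sub h1 /= addsmxMr addsmx_sub h2 /=.
by rewrite -scalemxAl.
Qed.

Lemma nbrs_ge W : [/\ (W (Some jp) *m E1 <= nbrs W)%MS,
  (W (Some jm) *m E2 <= nbrs W)%MS & (eps *: (W None *m E3) <= nbrs W)%MS].
Proof.
by rewrite /nbrs; split; rewrite ?addsmxSl // (submx_trans _ (addsmxSr _ _)) ?addsmxSl ?addsmxSr.
Qed.

Lemma sub_to_nbrs W : stable W M -> (W (Some j) *m to_nbrs <= nbrs W)%MS.
Proof.
move=> st; have [n1 n2 n3] := nbrs_ge W; rewrite /to_nbrs !mulmxDr -scalemxAr !mulmxA.
apply: addmx_sub; first apply: addmx_sub.
- by apply: submx_trans n1; apply: submxMr; apply: stable_up.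
- by apply: submx_trans n2; apply: submxMr; apply: stable_down.
- apply: submx_trans n3; rewrite /eps; case: eqP => [->|_].
    by rewrite !scale1r; apply: submxMr; apply: (st Arry).
  by rewrite !scale0r sub0mx.
Qed.

Lemma sub_from_nbrs W : stable W M -> (nbrs W *m from_nbrs <= W (Some j))%MS.
Proof.
move=> st; apply: nbrs_sub; rewrite -?mulmxA !emb_from_nbrs.
- exact: stable_in.
- by rewrite mulmxN eqmx_opp; apply: stable_in'.
- rewrite /eps; case: eqP => [->|_]; last by rewrite !scale0r sub0mx.
  by rewrite !scale1r; apply: (st Arrx).
Qed.

Lemma nbrs_mono W W' : (forall v, (W v <= W' v)%MS) -> (nbrs W <= nbrs W')%MS.
Proof.
move=> le; have [n1 n2 n3] := nbrs_ge W'.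
rewrite -[nbrs W]mulmx1; apply: nbrs_sub; rewrite mulmx1.
- by apply: submx_trans n1; apply: submxMr.
- by apply: submx_trans n2; apply: submxMr.
- apply: submx_trans n3; rewrite !scalemxAl submxMr // /eps.
  by case: eqP => _; rewrite ?scale1r ?scale0r ?sub0mx.
Qed.

Lemma nbrs_proj W : [/\ (nbrs W *m P1 <= W (Some jp))%MS, (nbrs W *m P2 <= W (Some jm))%MS
  & (nbrs W *m P3 <= eps *: W None)%MS].
Proof.
by split; apply: nbrs_sub; rewrite !emb_projK ?scaler0 ?sub0mx.
Qed.

(** The third copy only carries something when j is the framed vertex 0. *)
Lemma nbrs_split m (X : 'M[F]_(m, T)) W : (X <= nbrs W)%MS ->
  X = X *m P1 *m E1 + X *m P2 *m E2 + eps *: (X *m P3 *m E3).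
Proof.
(* K kills the three pieces of the neighbourhood *)
move=> XW; pose K := 1%:M - P1 *m E1 - P2 *m E2 - eps *: (P3 *m E3).
have WK : (nbrs W *m K <= (0 : 'M_T))%MS.
  apply: nbrs_sub; rewrite /K !mulmxBr mulmx1 -scalemxAr !mulmxA !emb_projK !mul0mx.
  - by rewrite scaler0 !subr0 subrr ?scaler0 ?sub0mx.
  - by rewrite scaler0 !subr0 subrr ?scaler0 ?sub0mx.
  - by rewrite !subr0 scalerBr scalerA eps_idem subrr ?scaler0 ?sub0mx.
have : (X *m K <= (0 : 'M_T))%MS by apply: submx_trans (submxMr _ XW) WK.
rewrite submx0 /K !mulmxBr mulmx1 -scalemxAr !mulmxA.
by rewrite -!addrA -!opprD subr_eq0 addrA => /eqP.
Qed.

Lemma rank_nbrs W : \rank (nbrs W) =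
  (\rank (W (Some jp)) + \rank (W (Some jm)) + (j == 0%R) * \rank (W None))%N.
Proof.
have free1 m (X : 'M[F]_(m, N)) : \rank (X *m E1) = \rank X.
  by apply/eqP; rewrite eqn_leq mxrankM_maxl -{1}[X](emb_projK X).1.1.1.1.1.1.1.1 mxrankM_maxl.
have free2 m (X : 'M[F]_(m, N)) : \rank (X *m E2) = \rank X.
  by apply/eqP; rewrite eqn_leq mxrankM_maxl -{1}[X](emb_projK X).1.1.1.1.2 mxrankM_maxl.
have free3 m (X : 'M[F]_(m, N)) : \rank (X *m E3) = \rank X.
  by apply/eqP; rewrite eqn_leq mxrankM_maxl -{1}[X](emb_projK X).2 mxrankM_maxl.
have dis m (A : 'M[F]_(m, N)) n (B : 'M[F]_(n, T)) (E : 'M_(N, T)) (P : 'M_(T, N)) :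
    E *m P = 1%:M -> B *m P = 0 -> (A *m E :&: B)%MS = 0.
  move=> EP1 BP; apply/eqP; rewrite -submx0; set C := (_ :&: _)%MS.
  have /submxP[D CD] : (C <= A *m E)%MS by apply: capmxSl.
  have /submxP[D' CD'] : (C <= B)%MS by apply: capmxSr.
  have : C *m P = 0 by rewrite CD' -mulmxA BP mulmx0.
  by rewrite {1}CD -!mulmxA EP1 mulmx1 => DA; rewrite CD mulmxA DA mul0mx.
have h2 : (W (Some jm) *m E2 :&: eps *: (W None *m E3))%MS = 0.
  by apply: (dis _ _ _ _ _ P2); rewrite ?EP // -scalemxAl emb_projK scaler0.
have h1 : (W (Some jp) *m E1 :&: (W (Some jm) *m E2 + eps *: (W None *m E3)))%MS = 0.
  apply: (dis _ _ _ _ _ P1); rewrite ?EP //; apply/eqP; rewrite -submx0.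
  by rewrite addsmxMr addsmx_sub -scalemxAl !emb_projK scaler0 sub0mx.
rewrite /nbrs !mxrank_disjoint_sum // free1 free2 addnA; congr (_ + _)%N.
by rewrite /eps; case: eqP => _; rewrite ?scale1r ?scale0r ?free3 ?mul1n ?mxrank0.
Qed.

(** By the relation at j, going out and coming back is multiplication by theta_j. *)
Lemma nbrs_from_nbrs : th j != 0 -> (nbrs V *m from_nbrs :=: V (Some j))%MS.
Proof.
move=> thj; apply/eqmxP; rewrite sub_from_nbrs //=; last by case: sV.
have -> : V (Some j) = (th j)^-1 *: (V (Some j) *m to_nbrs *m from_nbrs).
  by rewrite -mulmxA to_from_nbrs rel scalerA mulVf // scale1r.
by rewrite scalemx_sub // submxMr // sub_to_nbrs; case: sV.
Qed.

(** The new incoming map, (from_nbrs then to_nbrs) minus theta_j. Its image lies in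
the kernel of from_nbrs, which is the new space at j. *)
Definition refl_from_nbrs : 'M[F]_T := from_nbrs *m to_nbrs - (th j)%:M.

Lemma emb_refl_from_nbrs : (E1 *m refl_from_nbrs = M (ArrX j) *m to_nbrs - th j *: E1) *
  (E2 *m refl_from_nbrs = - (M (ArrY jm) *m to_nbrs) - th j *: E2) *
  (E3 *m refl_from_nbrs = eps *: (M Arrx *m to_nbrs) - th j *: E3).
Proof.
by rewrite /refl_from_nbrs !mulmxBr !mulmxA !emb_from_nbrs -!scalemxAl mulNmx !mul_mx_scalar.
Qed.

Lemma refl_from_nbrs_from m (X : 'M[F]_(m, T)) : (X <= nbrs V)%MS ->
  X *m refl_from_nbrs *m from_nbrs = 0.
Proof.
move=> XV; have XVj : (X *m from_nbrs <= V (Some j))%MS.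
  by apply: submx_trans (submxMr _ XV) _; apply: sub_from_nbrs; case: sV.
rewrite /refl_from_nbrs mulmxBr mulmxBl mul_mx_scalar -scalemxAl !mulmxA.
rewrite -[_ *m to_nbrs *m from_nbrs]mulmxA to_from_nbrs.
by rewrite (scaled_sub XVj (rel j)) subrr.
Qed.

Lemma refl_from_nbrs_sub m (X : 'M[F]_(m, T)) : (X <= nbrs V)%MS ->
  (X *m refl_from_nbrs <= nbrs V)%MS.
Proof.
move=> XV; have [stV _] := sV; rewrite /refl_from_nbrs mulmxBr mul_mx_scalar addmx_sub //.
  rewrite mulmxA; apply: submx_trans (submxMr _ (submxMr _ XV)) _.
  by apply: submx_trans (submxMr _ (sub_from_nbrs stV)) _; apply: sub_to_nbrs.
by rewrite eqmx_opp scalemx_sub.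
Qed.

Lemma refl_from_nbrs_cap m (X : 'M[F]_(m, T)) : (X <= nbrs V)%MS ->
  (X *m refl_from_nbrs <= nbrs V :&: kermx from_nbrs)%MS.
Proof.
move=> XV; rewrite sub_capmx refl_from_nbrs_sub //=.
by apply/sub_kermxP; apply: refl_from_nbrs_from.
Qed.

(** The other vertices keep their spaces, placed in the first copy. *)
Definition reflV (v : option I) : 'M[F]_T :=
  if v == Some j then (nbrs V :&: kermx from_nbrs)%MS else <<V v *m E1>>%MS.

Definition reflM (a : arrow l) : 'M[F]_T :=
  match a with
  | ArrX i => if i == j then P1 *m E1 *m refl_from_nbrs
              else if i == jm then P2 *m E1 else P1 *m M a *m E1
  | ArrY i => if i == j then P1 *m E1
              else if i == jm then - (P1 *m E2 *m refl_from_nbrs) else P1 *m M a *m E1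
  | Arrx => if j == 0 then P1 *m E3 *m refl_from_nbrs else P1 *m M a *m E1
  | Arry => if j == 0 then P3 *m E1 else P1 *m M a *m E1
  end.

Lemma some_eq (i k : I) : (Some i == Some k) = (i == k). Proof. by []. Qed.

Lemma reflV_neq v : v != Some j -> reflV v = <<V v *m E1>>%MS.
Proof. by rewrite /reflV => /negPf ->. Qed.

Lemma cap_nbrs : (nbrs V :&: kermx from_nbrs <= nbrs V)%MS. Proof. exact: capmxSl. Qed.

Lemma refl_stable : stable reflV reflM.
Proof.
have [stV _] := sV; have [n1 n2 n3] := nbrs_ge V; have [p1 p2 p3] := nbrs_proj V.
have plain a : src a != Some j -> tgt a != Some j ->
    (reflV (src a) *m (P1 *m M a *m E1) <= reflV (tgt a))%MS.
  move=> sa ta; rewrite !reflV_neq //.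
  rewrite (eqmxMr _ (genmxE _)) genmxE !mulmxA emb_projK; apply: submxMr; exact: stV.
case=> [i|i||] /=.
- case: eqP => [ij|/eqP ij].
    rewrite ij -/jp reflV_neq ?some_eq ?jp_neq // /reflV eqxx.
    by rewrite (eqmxMr _ (genmxE _)) !mulmxA emb_projK; apply: refl_from_nbrs_cap.
  case: eqP => [ijm|/eqP ijm].
    rewrite ijm /jm subrK -/jm [reflV (Some jm)]reflV_neq ?some_eq ?jm_neq // genmxE mulmxA.
    rewrite /reflV eqxx; apply: submxMr; apply: submx_trans p2.
    by apply: submxMr; apply: cap_nbrs.
  by apply: (plain (ArrX i)); rewrite /= some_eq ?next_eq.
- case: eqP => [ij|/eqP ij].
    rewrite ij -/jp [reflV (Some jp)]reflV_neq ?some_eq ?jp_neq // genmxE mulmxA.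
    rewrite /reflV eqxx; apply: submxMr; apply: submx_trans p1.
    by apply: submxMr; apply: cap_nbrs.
  case: eqP => [ijm|/eqP ijm].
    rewrite ijm /jm subrK -/jm reflV_neq ?some_eq ?jm_neq // /reflV eqxx.
    rewrite mulmxN eqmx_opp (eqmxMr _ (genmxE _)) !mulmxA emb_projK; exact: refl_from_nbrs_cap.
  by apply: (plain (ArrY i)); rewrite /= some_eq ?next_eq.
- case: eqP => [j0|/eqP j0]; last by apply: (plain Arrx); rewrite //= some_eq eq_sym.
  rewrite -j0 reflV_neq // /reflV eqxx (eqmxMr _ (genmxE _)) !mulmxA emb_projK.
  apply: refl_from_nbrs_cap.
  by move: n3; rewrite /eps j0 eqxx scale1r.
- case: eqP => [j0|/eqP j0]; last by apply: (plain Arry); rewrite //= some_eq eq_sym.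
  rewrite -j0 [reflV None]reflV_neq // genmxE mulmxA /reflV eqxx; apply: submxMr.
  apply: submx_trans (submxMr _ cap_nbrs) _.
  by move: p3; rewrite /eps j0 eqxx scale1r.
Qed.

Lemma moment_reflM :
  moment reflM j = (P1 *m E1 + P2 *m E2 + eps *: (P3 *m E3)) *m refl_from_nbrs.
Proof.
rewrite /moment /reflM eqxx -/jm eqxx jm_neq /= !mulmxDl mulmxN opprK -scalemxAl.
congr (_ + _ + _); rewrite ?mulmxA ?emb_projK //.
by rewrite /eps; case: (j == 0); rewrite ?scale0r // !mulmxA emb_projK.
Qed.

(** At j the new outgoing maps are the coordinates of the kernel of from_nbrs, so
going out and coming back is multiplication by - theta_j. At a neighbour the
term through j changes by theta_j, once for each arrow that joins it to j. *)
Lemma refl_relation : relation (refl j th) reflV reflM.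
Proof.
have [p1 p2 p3] := nbrs_proj V.
move=> k; have [->|kj] := eqVneq k j.
  rewrite /reflV eqxx; set C := (_ :&: _)%MS.
  have -> : refl j th j = - th j by rewrite reflE // lap_sroot_diag //; ring.
  have Cinc : C *m from_nbrs = 0 by apply/sub_kermxP; apply: capmxSr.
  have -> : - th j *: C = C *m refl_from_nbrs.
    by rewrite /refl_from_nbrs mulmxBr mulmxA Cinc mul0mx sub0r mul_mx_scalar scaleNr.
  have CP3 : C *m P3 = eps *: (C *m P3).
    have : (C *m P3 <= eps *: V None)%MS by apply: submx_trans (submxMr _ cap_nbrs) p3.
    by rewrite /eps; case: eqP => _; rewrite ?scale1r // !scale0r submx0 => /eqP.
  have split3 := nbrs_split cap_nbrs; rewrite -/C in split3.
  rewrite moment_reflM mulmxA [in RHS]split3 !mulmxDr -scalemxAr !mulmxA.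
  by [].
rewrite reflV_neq ?some_eq //.
suff E : E1 *m moment reflM k =
    moment M k *m E1 + (th j * ((k + Zp1 == j)%:R + (k - Zp1 == j)%:R)) *: E1.
  apply: (scaled_sub (B := V (Some k) *m E1)); rewrite ?genmxE // -mulmxA E mulmxDr mulmxA rel.
  rewrite -scalemxAr -scalemxAl -scalerDl; congr (_ *: _).
  rewrite reflE // lap_sroot (negPf kj) mul0rn; case: (_ == j); case: (_ == j) => /=; ring.
have t1 : E1 *m (reflM (ArrY k) *m reflM (ArrX k)) =
    M (ArrY k) *m M (ArrX k) *m E1 + (th j * (k + Zp1 == j)%:R) *: E1.
  rewrite /reflM (negPf kj) next_eq; case: eqP => [->|_].
    rewrite mulNmx mulmxN !mulmxA EP mul1mx emb_refl_from_nbrs -opprD !mulNmx opprK mulr1.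
    by rewrite !mulmxDl -!scalemxAl EP mul1mx -[_ *m to_nbrs *m P2]mulmxA to_nbrs_proj.
  by rewrite !mulmxA EP mul1mx emb_projK mulr0 scale0r addr0.
have t2 : E1 *m (reflM (ArrX (k - Zp1)) *m reflM (ArrY (k - Zp1))) =
    M (ArrX (k - Zp1)) *m M (ArrY (k - Zp1)) *m E1 - (th j * (k - Zp1 == j)%:R) *: E1.
  have kjm : (k - Zp1 == jm) = false by rewrite (inj_eq (addIr _)) (negPf kj).
  rewrite /reflM kjm; case: eqP => [->|_].
    rewrite !mulmxA EP mul1mx emb_refl_from_nbrs mulr1 !mulmxBl -!scalemxAl EP mul1mx.
    by rewrite -[_ *m to_nbrs *m P1]mulmxA to_nbrs_proj.
  by rewrite !mulmxA EP mul1mx emb_projK mulr0 scale0r subr0.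
have t3 : (k == 0)%:R *: (E1 *m (reflM Arry *m reflM Arrx)) =
    (k == 0)%:R *: (M Arry *m M Arrx *m E1).
  have [k0|_] := eqVneq k 0; last by rewrite !scale0r.
  have j0 : (j == 0) = false by rewrite -k0 eq_sym (negPf kj).
  by rewrite /reflM j0 !mulmxA EP mul1mx emb_projK.
rewrite /moment mulmxDr mulmxBr -scalemxAr t1 t2 t3 mulmxDl mulmxBl -scalemxAl mulrDr scalerDl.
by rewrite opprB -!addrA; congr (_ + _); rewrite addrA addrC -addrA.
Qed.

(** The neighbour reached by an arrow that leaves j is a coordinate of to_nbrs. The
same coordinate gives the reflected arrow. *)
Lemma arrow_out_of a : src a = Some j -> exists P : 'M[F]_(T, N),
  [/\ M a = to_nbrs *m P, reflM a = P *m E1 & forall W, (nbrs W *m P <= W (tgt a))%MS].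
Proof.
case: a => [i|i||] //= [] E.
- have {E}-> : i = jm by apply/eqP; rewrite -next_eq E.
  by exists P2; rewrite to_nbrs_proj jm_neq eqxx; split=> // W; case: (nbrs_proj W).
- by rewrite E; exists P1; rewrite to_nbrs_proj eqxx; split=> // W; case: (nbrs_proj W).
- exists P3; rewrite to_nbrs_proj -E eqxx /eps -E eqxx scale1r; split=> // W.
  by case: (nbrs_proj W); rewrite /eps -E eqxx scale1r.
Qed.

Lemma arrow_into a : tgt a = Some j -> exists E : 'M[F]_(N, T),
  [/\ M a = E *m from_nbrs, reflM a = P1 *m E *m refl_from_nbrs
    & forall W, (W (src a) *m E <= nbrs W)%MS].
Proof.
case: a => [i|i||] //= [] E.
- by rewrite E; exists E1; rewrite emb_from_nbrs eqxx; split=> // W; case: (nbrs_ge W).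
- have {E}-> : i = jm by apply/eqP; rewrite -next_eq E.
  exists (- E2); rewrite jm_neq eqxx mulNmx emb_from_nbrs opprK mulmxN mulNmx; split=> // W.
  by rewrite mulmxN eqmx_opp; case: (nbrs_ge W).
- exists E3; rewrite emb_from_nbrs -E eqxx /eps -E eqxx scale1r; split=> // W.
  by case: (nbrs_ge W); rewrite /eps -E eqxx scale1r.
Qed.

Lemma plain_arrow a : src a != Some j -> tgt a != Some j -> reflM a = P1 *m M a *m E1.
Proof.
case: a => [i|i||] //=; rewrite ?some_eq ?next_eq.
- by move=> /negPf h2 /negPf h1; rewrite h1 h2.
- by move=> /negPf h1 /negPf h2; rewrite h1 h2.
- by move=> _; rewrite eq_sym => /negPf ->.
- by rewrite eq_sym => /negPf ->.
Qed.

Lemma src_tgt a : src a = Some j -> tgt a != Some j.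
Proof.
case: a => [i|i||] //= [] E; rewrite some_eq.
  by apply/eqP => ij; move: E => /eqP; rewrite ij jp_neq.
by rewrite E jp_neq.
Qed.

(** For theta_j = 0 a simple representation has to_nbrs injective at j and from_nbrs
onto, since the kernel and the image give subrepresentations; as their
composite vanishes, twice the dimension at j is at most that of the
neighbourhood. *)
Lemma simple_coroot_val (d : {ffun I -> int}) : th j = 0 ->
  (forall k, (\rank (V (Some k)))%:Z = d k) -> 0 <= coroot_val d j.
Proof.
move=> thj dE; have [stV minV] := sV.
have V0 : V None != 0 by rewrite -mxrank_eq0 rank_inf.
(* the image of from_nbrs is a subrepresentation that is nonzero at infinity *)
have surj : (V (Some j) <= nbrs V *m from_nbrs)%MS.
  pose W v := if v == Some j then <<nbrs V *m from_nbrs>>%MS else V v.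
  have WV v : (W v <= V v)%MS.
    by rewrite /W; case: eqP => [->|_]; rewrite ?genmxE ?sub_from_nbrs.
  have stW : stable W M.
    move=> a; have [ta|/eqP ta] := tgt a =P Some j.
      have [E [-> _ EW]] := arrow_into ta; rewrite ta /W eqxx genmxE mulmxA submxMr //.
      have : (V (src a) *m E <= nbrs V)%MS by [].
      by apply: submx_trans; apply: submxMr; apply: WV.
    by rewrite {2}/W (negPf ta); apply: submx_trans (submxMr _ (WV _)) (stV a).
  have := minV W stW WV (ex_intro _ None _) (Some j).
  by rewrite /W eqxx genmxE; apply.
(* the kernel of to_nbrs is a subrepresentation that vanishes at infinity *)
have inj : (V (Some j) :&: kermx to_nbrs)%MS = 0.
  apply/eqP/negPn/negP => Kn0.
  pose W v : 'M[F]_N := if v == Some j then (V (Some j) :&: kermx to_nbrs)%MS else 0.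
  have WV v : (W v <= V v)%MS.
    by rewrite /W; case: eqP => [->|_]; rewrite ?capmxSl ?sub0mx.
  have stW : stable W M.
    move=> a; rewrite {1}/W; case: eqP => [sa|_]; last by rewrite mul0mx sub0mx.
    have [P [-> _ _]] := arrow_out_of sa; rewrite mulmxA.
    by have /sub_kermxP -> := capmxSr (V (Some j)) (kermx to_nbrs); rewrite mul0mx sub0mx.
  have := minV W stW WV (ex_intro _ (Some j) _) None; rewrite /W eqxx /= submx0.
  by move=> /(_ Kn0); apply/negP.
have r1 := mxrank_mul_ker (nbrs V) from_nbrs.
have r2 := mxrank_mul_ker (V (Some j)) to_nbrs; rewrite inj mxrank0 addn0 in r2.
have le1 : (\rank (V (Some j)) <= \rank (nbrs V *m from_nbrs))%N by apply: mxrankS.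
have le2 : (\rank (V (Some j) *m to_nbrs) <= \rank (nbrs V :&: kermx from_nbrs)%MS)%N.
  apply: mxrankS; rewrite sub_capmx sub_to_nbrs //=; apply/sub_kermxP.
  by rewrite -mulmxA to_from_nbrs rel thj scale0r.
have := rank_nbrs V; rewrite rank_inf muln1 -r1 => rn.
have : (\rank (V (Some j)) + \rank (V (Some j)) <=
    \rank (V (Some jp)) + \rank (V (Some jm)) + (j == 0%R))%N.
  by rewrite -rn leq_add // -r2.
by rewrite /coroot_val /lap -!dE -/jp -/jm; case: (j == 0) => /=; lia.
Qed.

Hypothesis thj : th j != 0.

(** A subrepresentation W' of the reflected representation gives back a
subrepresentation W of the original one: keep the spaces away from j and take
for W at j the image of its neighbourhood. Simplicity of the original gives
W' = everything away from j, and then also at j, because every vector of the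
new space at j comes from the neighbourhood. *)
Lemma refl_simple : simple_family reflV reflM.
Proof.
split; first exact: refl_stable.
move=> W' stW' leW' [v0 W'v0]; have [stV minV] := sV.
(* W0 is W' away from j, W is the subrepresentation of the original *)
pose W0 v : 'M[F]_N := if v == Some j then 0 else <<W' v *m P1>>%MS.
pose W v : 'M[F]_N := if v == Some j then <<nbrs W0 *m from_nbrs>>%MS else W0 v.
have nbrW : nbrs W = nbrs W0.
  by rewrite /nbrs /W !some_eq jp_neq jm_neq.
have W0V v : (W0 v <= V v)%MS.
  rewrite /W0; case: eqP => [_|/eqP vj]; rewrite ?sub0mx // genmxE.
  have := leW' v; rewrite reflV_neq // genmxE => /(submxMr P1).
  by rewrite emb_projK.
have W'P1 v : v != Some j -> (W' v *m P1 *m E1 = W' v).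
  move=> vj; have := leW' v; rewrite reflV_neq // genmxE => /submxP[D ->].
  by rewrite mulmxA emb_projK.
have W0_in v : v != Some j -> (W0 v :=: W' v *m P1)%MS.
  by move=> /negPf vj; rewrite /W0 vj; apply: genmxE.
have WV v : (W v <= V v)%MS.
  rewrite /W; case: eqP => [->|//]; rewrite genmxE.
  by apply: submx_trans (submxMr _ (nbrs_mono W0V)) (sub_from_nbrs stV).
have W'j P a : src a = Some j -> reflM a = P *m E1 ->
    (W' (Some j) *m P <= W0 (tgt a))%MS.
  move=> sa aE; rewrite W0_in ?src_tgt //.
  by have := submxMr P1 (stW' a); rewrite sa aE mulmxA emb_projK.
have incW' : (nbrs W0 *m refl_from_nbrs <= W' (Some j))%MS.
  have part a E : tgt a = Some j -> reflM a = P1 *m E *m refl_from_nbrs ->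
      (W0 (src a) *m E *m refl_from_nbrs <= W' (Some j))%MS.
    move=> ta aE; have sa : src a != Some j.
      by apply/eqP => sa; have := src_tgt sa; rewrite ta eqxx.
    have := stW' a; rewrite ta aE !mulmxA; apply: submx_trans.
    by rewrite (eqmxMr _ (eqmxMr _ (W0_in _ sa))).
  apply: nbrs_sub.
  - by apply: (part (ArrX j)) => //=; rewrite eqxx.
  - rewrite -[E2]opprK mulmxN mulNmx eqmx_opp; apply: (part (ArrY jm)).
      by rewrite /= subrK.
    by rewrite /= jm_neq eqxx mulmxN mulNmx.
  - rewrite /eps; have [j0|_] := eqVneq j 0; last by rewrite scale0r sub0mx.
    by rewrite scale1r; apply: (part Arrx); rewrite /= j0 ?eqxx.
have stW : stable W M.
  move=> a; have [ta|/eqP ta] := tgt a =P Some j.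
    have [E [-> _ EW]] := arrow_into ta; rewrite ta {2}/W eqxx genmxE mulmxA submxMr //.
    by rewrite -nbrW.
  have [sa|/eqP sa] := src a =P Some j.
    have [P [aE a'E PW]] := arrow_out_of sa.
    rewrite sa /W eqxx (negPf ta) aE (eqmxMr _ (genmxE _)).
    have -> : nbrs W0 *m from_nbrs *m (to_nbrs *m P) =
        nbrs W0 *m refl_from_nbrs *m P + th j *: (nbrs W0 *m P).
      by rewrite /refl_from_nbrs mulmxBr mulmxBl mul_mx_scalar -scalemxAl !mulmxA subrK.
    apply: addmx_sub; last by rewrite scalemx_sub.
    by apply: submx_trans (submxMr _ incW') (W'j P a sa a'E).
  rewrite /W (negPf sa) (negPf ta) (W0_in _ ta) (eqmxMr _ (W0_in _ sa)).
  by have := submxMr P1 (stW' a); rewrite plain_arrow // !mulmxA emb_projK.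
have [v Wv] : exists v, W v != 0.
  have [//|none] := pselect (exists v, W v != 0).
  have Wz v : W v = 0 by apply/eqP/negPn/negP => h; apply: none; exists v.
  have W'z v : v != Some j -> W' v = 0.
    move=> vj; have := Wz v; rewrite /W (negPf vj) => W0z.
    rewrite -W'P1 //; have : (W' v *m P1 <= W0 v)%MS by rewrite W0_in.
    by rewrite W0z submx0 => /eqP ->; rewrite mul0mx.
  have z a P : src a = Some j -> reflM a = P *m E1 -> W' (Some j) *m P = 0.
    move=> sa aE; have := W'j P a sa aE; have := Wz (tgt a).
    by rewrite /W (negPf (src_tgt sa)) => ->; rewrite submx0 => /eqP.
  case/negP: W'v0; have [v0j|v0j] := eqVneq v0 (Some j); last by rewrite W'z.
  rewrite v0j; have := leW' (Some j); rewrite {1}/reflV eqxx => le.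
  rewrite (nbrs_split (submx_trans le cap_nbrs)).
  rewrite (z (ArrY j) P1) ?(z (ArrX jm) P2) /= ?eqxx ?jm_neq ?subrK //.
  rewrite !mul0mx !add0r /eps; have [j0|_] := eqVneq j 0; last by rewrite scale0r.
  by rewrite (z Arry P3) ?mul0mx ?scaler0 //= j0 ?eqxx.
have VW := minV W stW WV (ex_intro _ v Wv).
move=> u; have [->|uj] := eqVneq u (Some j); last first.
  rewrite reflV_neq // genmxE -(W'P1 u) //; apply: submxMr.
  by have := VW u; rewrite /W (negPf uj) W0_in.
rewrite {1}/reflV eqxx; set C := (_ :&: _)%MS.
have Cinc : C *m from_nbrs = 0 by apply/sub_kermxP; apply: capmxSr.
have -> : C = (- (th j)^-1) *: (C *m refl_from_nbrs).
  rewrite /refl_from_nbrs mulmxBr mulmxA Cinc mul0mx sub0r mul_mx_scalar scaleNr scalerN opprK.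
  by rewrite scalerA mulVf // scale1r.
apply: scalemx_sub; apply: submx_trans incW'; apply: submxMr.
by rewrite -nbrW; apply: submx_trans cap_nbrs (nbrs_mono VW).
Qed.

(** The new space at j is the kernel of a map of the neighbourhood onto the old
space. *)
Lemma refl_rank (d : {ffun I -> int}) k :
  (forall k, (\rank (V (Some k)))%:Z = d k) ->
  (\rank (reflV (Some k)))%:Z = dot_refl j d k.
Proof.
move=> dE; rewrite ffunE /reflV some_eq; have [->|kj] := eqVneq k j; last first.
  rewrite mul0r addr0 -dE genmxE; congr Posz; apply/eqP.
  by rewrite eqn_leq mxrankM_maxl -{1}[V _](emb_projK (V _)).1.1.1.1.1.1.1.1 mxrankM_maxl.
have := mxrank_mul_ker (nbrs V) from_nbrs.
rewrite nbrs_from_nbrs // rank_nbrs rank_inf muln1 mul1r /coroot_val /lap -!dE -/jp -/jm.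
by case: (j == 0) => /=; lia.
Qed.

Lemma refl_rank_inf : \rank (reflV None) = 1%N.
Proof.
rewrite reflV_neq // genmxE -[RHS]rank_inf; apply/eqP.
by rewrite eqn_leq mxrankM_maxl -{1}[V _](emb_projK (V _)).1.1.1.1.1.1.1.1 mxrankM_maxl.
Qed.

End Reflection.

Lemma three_copies (F : fieldType) N :
  let E1 := row_mx 1%:M 0 : 'M[F]_(N, N + (N + N)) in
  let E2 := row_mx 0 (row_mx 1%:M 0) : 'M[F]_(N, N + (N + N)) in
  let E3 := row_mx 0 (row_mx 0 1%:M) : 'M[F]_(N, N + (N + N)) in
  let P1 := col_mx 1%:M 0 : 'M[F]_(N + (N + N), N) in
  let P2 := col_mx 0 (col_mx 1%:M 0) : 'M[F]_(N + (N + N), N) in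
  let P3 := col_mx 0 (col_mx 0 1%:M) : 'M[F]_(N + (N + N), N) in
  ((E1 *m P1 = 1%:M) * (E1 *m P2 = 0) * (E1 *m P3 = 0) *
  (E2 *m P1 = 0) * (E2 *m P2 = 1%:M) * (E2 *m P3 = 0) *
  (E3 *m P1 = 0) * (E3 *m P2 = 0) * (E3 *m P3 = 1%:M))%type.
Proof.
by move=> /=; do 8?split; rewrite !(mul_row_col, mulmx1, mul0mx, mulmx0, addr0, add0r).
Qed.

Lemma has_simple_refl (F : fieldType) l (th : {ffun 'I_l.+1 -> F}) d j : (0 < l)%N ->
  th j != 0 -> has_simple th d -> has_simple (refl j th) (dot_refl j d).
Proof.
move=> l0 thj [N [V [M [rel sV r1 dE]]]]; have /= EP := three_copies F N.
exists (N + (N + N))%N; eexists; eexists; split.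
- exact: (refl_relation j EP l0 rel).
- exact: (refl_simple EP l0 rel sV thj).
- exact: (refl_rank_inf j M EP r1).
- by move=> k; apply: (refl_rank EP l0 rel sV r1 thj k dE).
Qed.

Lemma has_simple_coroot_val (F : fieldType) l (th : {ffun 'I_l.+1 -> F}) d j : (0 < l)%N ->
  th j = 0 -> has_simple th d -> 0 <= coroot_val d j.
Proof.
move=> l0 thj [N [V [M [rel sV r1 dE]]]].
exact: (simple_coroot_val (three_copies F N) l0 rel sV r1 thj dE).
Qed.

Lemma has_simple_nonneg (F : fieldType) l (th : {ffun 'I_l.+1 -> F}) d :
  has_simple th d -> nonneg d.
Proof. by move=> [N [V [M [_ _ _ dE]]]] k; rewrite -dE. Qed.

Lemma form_l0 l (x y : {ffun 'I_l.+1 -> int}) : l = 0%N -> form x y = 0.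
Proof.
move=> l0; rewrite /form big1 // => i _; rewrite (@lap_const _ y (y 0)) ?mulr0 // => k.
by congr (y _); apply/val_inj; move: k; rewrite l0 => k; rewrite (ord1 k).
Qed.

Lemma sum_dot_refl l j (d : {ffun 'I_l.+1 -> int}) :
  \sum_i dot_refl j d i = \sum_i d i + coroot_val d j.
Proof.
under eq_bigr do rewrite ffunE.
rewrite big_split /=; congr (_ + _); rewrite -[RHS](sum_delta (fun=> coroot_val d j) j).
by apply: eq_bigr => i _; rewrite mulrC.
Qed.

Lemma sum_nonneg l (d : {ffun 'I_l.+1 -> int}) : nonneg d -> 0 <= \sum_i d i.
Proof. by move=> d0; apply: sumr_ge0 => i _; apply: d0. Qed.

(** Reflect down at vertices with negative coroot value, where theta cannot vanish,
until the vector is dominant; there the weight is a sum of nonnegative terms. *)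
Lemma has_simple_weight2 (F : fieldType) l (th : {ffun 'I_l.+1 -> F}) d :
  has_simple th d -> 0 <= weight2 d.
Proof.
have [n] := ubnP `|(\sum_i d i)%R|%N; elim: n th d => // n IH th d /ltnSE le sd.
have d0 := has_simple_nonneg sd.
have [l0|l0] := posnP l.
  by rewrite /weight2 form_l0 // subr0 mulrn_wge0.
have [j dj|dom] := pickP (fun j => coroot_val d j < 0); last first.
  rewrite weight2_coroot_val addr_ge0 // sumr_ge0 // => j _; rewrite mulr_ge0 // leNgt.
  by rewrite dom.
have thj : th j != 0.
  by apply/eqP => /(has_simple_coroot_val l0)/(_ sd); rewrite leNgt dj.
have sd' := has_simple_refl l0 thj sd.
rewrite -(weight2_dot_refl j) //; apply: IH (sd').
have := sum_nonneg (has_simple_nonneg sd'); have := sum_nonneg d0.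
by rewrite sum_dot_refl; move: (\sum_i d i) le dj => s; lia.
Qed.

(** * Calogero-Moser matrices: simple representations of dimension n delta *)

Lemma prev_val l (k : 'I_l.+1) : (k - Zp1 : 'I_l.+1) = (if k == 0 then l else k.-1) :> nat.
Proof.
have key (i : 'I_l.+1) : i + Zp1 = k -> k - Zp1 = i by move=> <-; rewrite addrK.
have [->|k0] := eqVneq k 0.
  suff -> : 0 - Zp1 = ord_max :> 'I_l.+1 by [].
  apply/eqP; rewrite subr_eq; apply/eqP; rewrite -[ord_max]Zp1_mulrn_ord /= -mulrSr.
  by apply/esym/eqP; rewrite Zp1_mulrn_eq0.
have kl : (k.-1 < l.+1)%N by have := ltn_ord k; lia.
suff E : Ordinal kl + Zp1 = k by rewrite (key _ E).
rewrite -[Ordinal kl]Zp1_mulrn_ord -[RHS]Zp1_mulrn_ord /= -mulrSr prednK //.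
by rewrite lt0n; apply: contra k0 => /eqP h; apply/eqP/val_inj.
Qed.

Section CalogeroMoser.
Variables (F : numFieldType) (l n : nat) (th : {ffun 'I_l.+1 -> F}).
Hypothesis th0 : \sum_i th i != 0.
Notation I := 'I_l.+1.

Let c := \sum_i th i.
Let x (a : 'I_n) : F := a.+1%:R.
Let S m := \sum_(i : I | (i < m)%N) th i.
Let gap (a b : 'I_n) := x b ^+ l.+1 - x a ^+ l.+1.

(** All arrows of type X act by the same diagonal matrix, whose entries 1, ..., n
have distinct ell-th powers. *)
Definition CMX : 'M[F]_n := diag_mx (\row_a x a).
(** For these X the relations determine the off-diagonal entries of Y and its
diagonal up to a common shift. *)
Definition CMY (k : I) : 'M[F]_n := \matrix_(a, b)
  if a == b then (S k.+1 - c) / x a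
  else - c * x a ^+ k * x b ^+ (l - k) / gap a b.

Lemma CM_point_neq0 a : x a != 0. Proof. by rewrite pnatr_eq0. Qed.

Lemma CM_gap_neq0 (a b : 'I_n) : a != b -> gap a b != 0.
Proof.
move=> ab; rewrite subr_eq0 -!natrX eqr_nat eqn_exp2r // eqSS.
by rewrite eq_sym.
Qed.

Lemma CM_partial_full : S l.+1 = c.
Proof. by apply: eq_bigl => i; rewrite ltn_ord. Qed.

Lemma CM_partial_rec (k : I) : S k.+1 = S k + th k.
Proof.
rewrite /S (bigD1 k) //= addrC; congr (_ + _); apply: eq_bigl => i.
by rewrite ltnS -val_eqE /= [RHS]ltn_neqAle andbC.
Qed.

Lemma CM_relation (k : I) :
  CMY k *m CMX - CMX *m CMY (k - Zp1) + (k == 0)%:R *: const_mx c = (th k)%:M.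
Proof.
apply/matrixP => a b; rewrite mul_mx_diag mul_diag_mx !mxE prev_val CM_partial_rec.
have xa := CM_point_neq0 a; have xb := CM_point_neq0 b.
have [->|ab] := eqVneq a b.
  have [->|k0] := eqVneq k 0.
    by rewrite CM_partial_full subrr mul0r mulr0 subr0 /S big_pred0 // divfK // add0r mul1r subrK.
  have kpos : (0 < k)%N.
    by rewrite lt0n; apply: contra k0 => /eqP h; apply/eqP/val_inj.
  by rewrite prednK // divfK // [x b * _]mulrC divfK // mul0r addr0 mulr1n; ring.
have g := CM_gap_neq0 ab; rewrite mulr0n.
have [->|k0] := eqVneq k 0.
  rewrite /= !subnn subn0 !expr0 mulr1 mul1r; move: g; rewrite /gap !exprS => g.
  by move: (x a) (x b) (c) g => u v w g; field.
have kpos : (0 < k)%N.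
  by rewrite lt0n; apply: contra k0 => /eqP h; apply/eqP/val_inj.
(* away from vertex 0 the two terms cancel *)
have e1 : x a ^+ k = x a * x a ^+ k.-1 by rewrite -exprS prednK.
have e2 : x b ^+ (l - k.-1) = x b * x b ^+ (l - k).
  by rewrite -exprS; congr (_ ^+ _); have := ltn_ord k; lia.
rewrite e1 e2 mul0r addr0.
by move: (x a) (x b) (gap a b) (c) g (_ ^+ _) (_ ^+ _) => u v w e g p q; field.
Qed.

Definition CMpow t : 'M[F]_n := diag_mx (\row_a x a ^+ t).

Lemma CMpow_unit t : CMpow t \in unitmx.
Proof.
rewrite unitmxE det_diag unitfE prodf_seq_neq0; apply/allP => a _ /=.
by rewrite mxE expf_neq0 // CM_point_neq0.
Qed.

(** The full turn X^ell has distinct eigenvalues. *)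
Lemma CM_Vandermonde : Vandermonde n (\row_a x a ^+ l.+1) \in unitmx.
Proof.
rewrite unitmxE det_Vandermonde unitfE prodf_seq_neq0; apply/allP => a _ /=.
rewrite prodf_seq_neq0; apply/allP => b _ /=; apply/implyP => ab; rewrite !mxE.
by apply: CM_gap_neq0; rewrite neq_ltn ab.
Qed.

(** A family that is stable under X can be transported any number of steps along
the cycle. *)
Lemma CM_iter (p : I -> nat) (A : forall k, 'M[F]_(p k, n)) :
  (forall k, (A (k + Zp1)%R *m CMX <= A k)%MS) ->
  forall k t, (A (k + Zp1 *+ t)%R *m CMpow t <= A k)%MS.
Proof.
move=> st k; elim=> [|t IH].
  have -> : CMpow 0 = 1%:M.
    by apply/matrixP => a b; rewrite !mxE expr0.
  by rewrite mulmx1 mulr0n addr0.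
rewrite mulrSr addrA.
have -> : CMpow t.+1 = CMX *m CMpow t.
  rewrite /CMpow /CMX mulmx_diag; congr diag_mx; apply/rowP => a.
  by rewrite !mxE exprS.
by rewrite mulmxA; apply: submx_trans (submxMr _ (st _)) IH.
Qed.

Lemma CM_cycle (p : I -> nat) (A : forall k, 'M[F]_(p k, n)) :
  (forall k, (A (k + Zp1)%R *m CMX <= A k)%MS) ->
  forall t, (A 0 *m CMpow (l.+1 * t) <= A 0)%MS.
Proof.
move=> /CM_iter st t; have := st 0 (l.+1 * t)%N.
suff -> : 0 + Zp1 *+ (l.+1 * t) = 0 :> I by [].
by rewrite add0r; apply/eqP; rewrite Zp1_mulrn_eq0 dvdn_mulr.
Qed.

Lemma CM_reach (k : I) : exists t, k = 0 + Zp1 *+ t /\ exists u, 0 = k + Zp1 *+ u :> I.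
Proof.
exists k; rewrite add0r Zp1_mulrn_ord; split=> //; exists (l.+1 - k)%N.
rewrite -{1}[k]Zp1_mulrn_ord -mulrnDr subnKC; last exact: ltnW.
by apply/esym/eqP; rewrite Zp1_mulrn_eq0.
Qed.

(** The constant vector is cyclic for the full turn X^ell, by the Vandermonde
determinant, and X is invertible. *)
Lemma CM_full (p : I -> nat) (A : forall k, 'M[F]_(p k, n)) :
  (forall k, (A (k + Zp1)%R *m CMX <= A k)%MS) ->
  ((const_mx c : 'rV_n) <= A 0)%MS -> forall k, row_full (A k).
Proof.
move=> st cA; have st' := CM_cycle st.
have full0 : row_full (A 0).
  rewrite -sub1mx; have := CM_Vandermonde; set Va := Vandermonde _ _ => Vu.
  suff VA : (Va <= A 0)%MS.
    by rewrite -(mulVmx Vu); apply: submx_trans VA; apply: submxMl.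
  apply/row_subP => t; apply: (submx_trans _ (st' t)).
  have -> : row t Va = c^-1 *: ((const_mx c : 'rV_n) *m CMpow (l.+1 * t)).
    apply/rowP => a; rewrite mul_mx_diag !mxE mulrA mulVf // mul1r exprM //.
  by rewrite scalemx_sub // submxMr.
move=> k; have [t [_ [u u0]]] := CM_reach k.
have := CM_iter st k u; rewrite -u0 => le.
rewrite -sub1mx; apply: submx_trans le; rewrite -(mulVmx (CMpow_unit u)) submxMr //.
exact: submx_full.
Qed.

(** Dually, no nonzero subspace that is stable under X^ell lies in the kernel of the
constant functional. *)
Lemma CM_zero (p : I -> nat) (A : forall k, 'M[F]_(p k, n)) :
  (forall k, (A (k + Zp1)%R *m CMX <= A k)%MS) ->
  A 0 *m (const_mx 1 : 'cV_n) = 0 -> forall k, A k = 0.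
Proof.
move=> st A1; have st' := CM_cycle st.
have zero0 : A 0 = 0.
  have := CM_Vandermonde; set Va := Vandermonde _ _ => Vu.
  have VuT : Va^T \in unitmx by rewrite unitmx_tr.
  rewrite -[A 0](mulmxK VuT); suff -> : A 0 *m Va^T = 0 by rewrite mul0mx.
  apply/matrixP => r t; rewrite [RHS]mxE.
  have : A 0 *m CMpow (l.+1 * t) *m (const_mx 1 : 'cV_n) = 0.
    by have /submxP[D ->] := st' t; rewrite -mulmxA A1 mulmx0.
  move=> /matrixP/(_ r 0); rewrite mul_mx_diag !mxE => h; rewrite -[RHS]h.
  by apply: eq_bigr => a _; rewrite !mxE mulr1 exprM.
move=> k; have [t [tk _]] := CM_reach k.
have := CM_iter st 0 t; rewrite -tk zero0 => /submx0null h.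
by rewrite -[A k](mulmxK (CMpow_unit t)) h mul0mx.
Qed.

End CalogeroMoser.

Section CalogeroMoserFamily.
Variables (F : numFieldType) (l n : nat) (th : {ffun 'I_l.+1 -> F}).
Hypothesis th0 : \sum_i th i != 0.
Notation I := 'I_l.+1.

Definition CMV (v : option I) : 'M[F]_(1 + n) :=
  if v is Some _ then block_mx 0 0 0 1%:M else block_mx 1%:M 0 0 0.

Definition CMM (a : arrow l) : 'M[F]_(1 + n) :=
  match a with
  | ArrX _ => block_mx 0 0 0 (CMX F n)
  | ArrY k => block_mx 0 0 0 (CMY n th k)
  | Arrx => block_mx 0 (const_mx (\sum_i th i)) 0 0
  | Arry => block_mx 0 0 (const_mx 1) 0
  end.

Local Notation low := (col_mx 0 1%:M : 'M[F]_(1 + n, n)).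
Local Notation top := (col_mx 1%:M 0 : 'M[F]_(1 + n, 1)).

Lemma CMV_in k : CMV (Some k) = low *m row_mx 0 1%:M.
Proof. by rewrite mul_col_row !(mul0mx, mul1mx, mulmx0). Qed.

Lemma CM_family_relation : relation th CMV CMM.
Proof.
move=> k; rewrite /moment /= !mulmx_block !(mul0mx, mulmx0, add0r, addr0).
rewrite opp_block_mx add_block_mx scale_block_mx add_block_mx.
rewrite mulmx_block !(mul0mx, mulmx0, mul1mx, scaler0, oppr0, add0r, addr0).
have -> : (const_mx 1 : 'cV_n) *m (const_mx (\sum_i th i) : 'rV_n) =
    const_mx (\sum_i th i) :> 'M[F]_n.
  by apply/matrixP => a b; rewrite !mxE big_ord1 !mxE mul1r.
by rewrite CM_relation // scale_block_mx !scaler0 scalemx1.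
Qed.

Lemma CM_family_stable : stable CMV CMM.
Proof.
have in_low (A : 'M[F]_(1, n)) (B : 'M[F]_n) :
    (block_mx 0 A 0 B <= (block_mx 0 0 0 1%:M : 'M[F]_(1 + n)))%MS.
  apply/submxP; exists (block_mx 0 A 0 B).
  by rewrite mulmx_block !(mul0mx, mulmx0, mulmx1, addr0, add0r).
have in_top (A : 'M[F]_1) (B : 'M[F]_(n, 1)) :
    (block_mx A 0 B 0 <= (block_mx 1%:M 0 0 0 : 'M[F]_(1 + n)))%MS.
  apply/submxP; exists (block_mx A 0 B 0).
  by rewrite mulmx_block !(mul0mx, mulmx0, mulmx1, addr0, add0r).
case=> [i|k||] /=; rewrite mulmx_block !(mul0mx, mulmx0, mul1mx, addr0, add0r).
- exact: in_low.
- exact: in_low.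
- exact: in_low.
- exact: in_top.
Qed.

Lemma CM_rank_inf : \rank (CMV None) = 1%N.
Proof. by rewrite /CMV rank_diag_block_mx mxrank1 mxrank0. Qed.

Lemma CM_rank k : \rank (CMV (Some k)) = n.
Proof. by rewrite /CMV rank_diag_block_mx mxrank1 mxrank0. Qed.

(** A subrepresentation that contains the line at infinity contains the constant
vector; one that does not lies in the kernel of the constant functional. *)
Lemma CM_simple : simple_family CMV CMM.
Proof.
split; first exact: CM_family_stable.
move=> W stW WV [v0 Wv0].
pose A (k : I) := W (Some k) *m low.
have lowK : row_mx 0 1%:M *m low = 1%:M.
  by rewrite mul_row_col mul0mx mul1mx add0r.
have WE k : W (Some k) = A k *m row_mx 0 1%:M.
  rewrite /A; have /submxP[D ->] := WV (Some k); rewrite CMV_in !mulmxA.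
  by rewrite -[_ *m row_mx _ _ *m col_mx _ _]mulmxA lowK mulmx1.
have stA k : (A (k + Zp1)%R *m CMX F n <= A k)%MS.
  have := submxMr low (stW (ArrX k)); rewrite /= -/(A k) WE -!mulmxA; apply: submx_trans.
  rewrite mul_block_col mul_row_col !(mul0mx, mulmx0, mul1mx, mulmx1, addr0, add0r).
  exact: submx_refl.
have [Winf|Winf] := eqVneq (W None) 0.
  have A0 : A 0 *m (const_mx 1 : 'cV_n) = 0.
    have := submxMr top (stW Arry); rewrite /= Winf mul0mx WE => /submx0null.
    by rewrite -!mulmxA mul_block_col mul_row_col !(mul0mx, mulmx0, mul1mx, mulmx1, addr0, add0r).
  have Az := CM_zero stA A0.
  by case/eqP: Wv0; case: v0 => [k|//]; rewrite WE Az mul0mx.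
have VW : (CMV None <= W None)%MS.
  rewrite -(mxrank_leqif_sup (WV None)).2 CM_rank_inf eqn_leq.
  rewrite lt0n mxrank_eq0 Winf andbT.
  by have := mxrankS (WV None); rewrite CM_rank_inf.
have xA : ((const_mx (\sum_i th i)%R : 'rV_n) <= A 0)%MS.
  have -> : const_mx (\sum_i th i) = row_mx 1%:M 0 *m (CMV None *m CMM Arrx *m low).
    rewrite /= mulmx_block mul_block_col mul_row_col.
    by rewrite !(mul0mx, mulmx0, mul1mx, mulmx1, addr0, add0r).
  apply: submx_trans (submxMl _ _) _; apply: submxMr.
  exact: submx_trans (submxMr _ VW) (stW Arrx).
have full := CM_full th0 stA xA.
case=> [k|//]; rewrite CMV_in WE; apply: submxMr; exact: submx_full.
Qed.

Lemma CM_has_simple : has_simple th (delta l *+ n).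
Proof.
exists (1 + n)%N, CMV, CMM; split.
- exact: CM_family_relation.
- exact: CM_simple.
- exact: CM_rank_inf.
- by move=> k; rewrite CM_rank ffunMnE ffunE natz.
Qed.

End CalogeroMoserFamily.

(** * Existence of simple framed representations *)

(** Minus the pairing of the root x with alpha_oo + d. *)
Definition dot_pair l (d x : {ffun 'I_l.+1 -> int}) : int := \sum_i x i * coroot_val d i.

Lemma dot_pairE l (d x : {ffun 'I_l.+1 -> int}) : dot_pair d x = x 0 - form x d.
Proof.
rewrite /dot_pair /form -(sum_delta x 0) -sumrB; apply: eq_bigr => i _.
by rewrite /coroot_val mulrBr.
Qed.

Lemma dot_reflE l j (d : {ffun 'I_l.+1 -> int}) :
  dot_refl j d = d + [ffun k => coroot_val d j * sroot j k].
Proof. by apply/ffunP => i; rewrite !ffunE mulrC. Qed.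

Lemma dot_pair_refl l j (d x : {ffun 'I_l.+1 -> int}) :
  dot_pair (dot_refl j d) x = dot_pair d (root_refl j x).
Proof.
rewrite !dot_pairE dot_reflE root_reflE formDr formDl formZr formZl form_sroot.
rewrite (formC (sroot j)) form_sroot [in RHS]ffunE [X in _ + X - _]ffunE ffunE /coroot_val eq_sym.
ring.
Qed.

Lemma dot_reflK l j (d : {ffun 'I_l.+1 -> int}) : (0 < l)%N ->
  dot_refl j (dot_refl j d) = d.
Proof.
move=> l0; rewrite [dot_refl j d in X in X = _]dot_reflE; apply/ffunP => i.
rewrite ffunE /coroot_val lapD lapZ lap_sroot_diag // !ffunE /coroot_val; ring.
Qed.

(** Unlike dominance on J, this condition makes sense for every theta in the orbit,
and it is inherited under reflection at a vertex where theta does not vanish. *)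
Definition root_dominant (F : fieldType) l (th : {ffun 'I_l.+1 -> F}) d :=
  forall x, nonneg x -> form x x = 2 -> pair th x = 0 -> 0 <= dot_pair d x.

(** Reflect down at vertices with negative coroot value. Root dominance forces
theta_j <> 0 there, so s_j permutes the positive roots orthogonal to theta and
the condition is inherited. The height decreases, because vectors of
nonnegative weight are nonnegative. A dominant vector has an empty core, so it
is a multiple of delta. *)
Lemma has_simple_of_root_dominant (F : numFieldType) l (th : {ffun 'I_l.+1 -> F}) d :
  \sum_i th i != 0 -> 0 <= weight2 d -> root_dominant th d -> has_simple th d.
Proof.
have [n] := ubnP `|(\sum_i d i)%R|%N.
elim: n th d => // n IH th d /ltnSE le th0 wd dom.
have [nu [m [co dE]]] := core_decomposition wd.
have [j dj|dom'] := pickP (fun j => coroot_val d j < 0); last first.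
  have Rn : Res l nu = 0.
    apply: (dominant_core_empty co) => j; have := dom' j.
    by rewrite dE /coroot_val lapD lap_delta addr0 leNgt => ->.
  by rewrite dE Rn add0r; apply: CM_has_simple.
(* x is the residue vector of a partition plus a multiple of delta *)
have nn (x : {ffun 'I_l.+1 -> int}) : 0 <= weight2 x -> nonneg x.
  by move=> /core_decomposition[ka [k [_ ->]]] i; rewrite !ffunE ffunMnE !ffunE; lia.
have l0 : (0 < l)%N.
  rewrite lt0n; apply/eqP => l0; have := dj.
  have -> : coroot_val d j = 1.
    rewrite /coroot_val (@lap_const _ d (d j)) ?subr0.
      by rewrite (_ : j = 0) //; apply/val_inj; move: (j); rewrite l0 => k; rewrite (ord1 k).
    by move=> k; congr (d _); apply/val_inj; move: k (j); rewrite l0 => k k'; rewrite !ord1.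
  by [].
have thj : th j != 0.
  apply/eqP => thj; have := dom (sroot j) _ _ _.
  rewrite /dot_pair; under eq_bigr do rewrite ffunE mulrC.
  rewrite sum_delta pair_sroot form_sroot lap_sroot_diag // leNgt dj => H.
  suff : false by []; apply: H => // i; rewrite ffunE; case: (_ == _) => //.
have wd' : 0 <= weight2 (dot_refl j d) by rewrite weight2_dot_refl.
rewrite -[th](reflK th j) -[d](dot_reflK j) //; apply: has_simple_refl => //.
  by rewrite refl_diag // oppr_eq0.
apply: IH => //.
- have := sum_nonneg (nn _ wd'); have := sum_nonneg (nn _ wd).
  by rewrite sum_dot_refl; move: (\sum_i d i) le dj => s; lia.
- by rewrite sum_refl.
- move=> x x0 x2 thx; rewrite dot_pair_refl; apply: dom; rewrite ?form_root_refl -?pair_refl //.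
  apply: root_refl_nonneg => // xj; move: thx; rewrite xj pair_sroot => e.
  by case/eqP: thj; rewrite -[th](reflK th j) refl_fix.
Qed.

(** * Strings: unframed representations live on J *)

(** The characteristic polynomial has finitely many roots, and the numbers a + q z
are distinct in characteristic 0. *)
Lemma finite_spectrum (F : numFieldType) N (A : 'M[F]_N) a z : z != 0 ->
  ~ forall q : nat, eigenvalue A (a + z *+ q).
Proof.
move=> z0 H; have c0 : char_poly A != 0 by rewrite monic_neq0 // char_poly_monic.
have := @max_poly_roots _ _ [seq a + z *+ q | q <- iota 0 N.+1] c0.
rewrite size_char_poly size_map size_iota ltnn => h; suff: false by []; apply: h.
  by apply/allP => _ /mapP[q _ ->]; rewrite -eigenvalue_root_char.
rewrite map_inj_uniq ?iota_uniq // => q q' /addrI.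
exact: mulrIn.
Qed.

Lemma row_eigenvector (F : numClosedFieldType) N (V A : 'M[F]_N) : V != 0 ->
  (V *m A <= V)%MS -> exists (v : 'rV_N) a, [/\ v != 0, (v <= V)%MS & v *m A = a *: v].
Proof.
move=> V0 st; pose B := row_base V; pose C := B *m A *m pinvmx B.
have BA : B *m A = C *m B.
  rewrite /C mulmxKpV //; apply: submx_trans (submxMr _ _) _; last first.
    by rewrite eq_row_base; apply: st.
  by rewrite eq_row_base.
have r0 : (0 < \rank V)%N by rewrite lt0n mxrank_eq0.
have [a /eigenvalueP[w wC w0]] : exists a, eigenvalue C a.
  have /closed_rootP[a Ca] : size (char_poly C) != 1%N.
    by rewrite size_char_poly eqSS -lt0n.
  by exists a; rewrite eigenvalue_root_char.
exists (w *m B), a; split.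
- by rewrite mulmx_free_eq0 // row_base_free.
- by apply: submx_trans (submxMl _ _) _; rewrite eq_row_base.
- by rewrite -mulmxA BA mulmxA wC scalemxAl.
Qed.

Section Strings.
Variables (F : numClosedFieldType) (l N : nat) (th : {ffun 'I_l.+1 -> F}).
Notation I := 'I_l.+1.
Variables (V : option I -> 'M[F]_N) (M : arrow l -> 'M[F]_N).
Hypotheses (th0 : \sum_i th i != 0) (stV : stable V M) (rel : relation th V M)
  (Vinf : V None = 0).

(** The framing term passes through the zero space at infinity. *)
Lemma unframed_relation (k : I) (v : 'rV[F]_N) : (v <= V (Some k))%MS ->
  v *m M (ArrY k) *m M (ArrX k) =
  v *m M (ArrX (k - Zp1)) *m M (ArrY (k - Zp1)) + th k *: v.
Proof.
move=> vV; rewrite -(scaled_sub vV (rel k)) /moment mulmxDr mulmxBr -scalemxAr !mulmxA.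
suff -> : (k == 0)%:R *: (v *m M Arry *m M Arrx) = 0 by rewrite addr0 addrC subrK.
have [k0|_] := eqVneq k 0; last by rewrite scale0r.
have : (v *m M Arry <= V None)%MS.
  by apply: submx_trans (stV Arry); rewrite submxMr //= -k0.
by rewrite Vinf => /submx0null ->; rewrite mul0mx scaler0.
Qed.

Variables (i : I) (v : 'rV[F]_N) (a : F).
Hypotheses (v0 : v != 0) (vV : (v <= V (Some i))%MS)
  (va : v *m M (ArrY i) *m M (ArrX i) = a *: v).

Fixpoint up_string t : 'rV[F]_N :=
  if t is t'.+1 then up_string t' *m M (ArrY (i + Zp1 *+ t')) else v.
Fixpoint down_string t : 'rV[F]_N :=
  if t is t'.+1 then down_string t' *m M (ArrX (i - Zp1 *+ t' - Zp1)) else v.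

Lemma up_in t : (up_string t <= V (Some (i + Zp1 *+ t)%R))%MS.
Proof.
elim: t => [|t IH] /=; first by rewrite addr0.
rewrite mulrSr addrA; exact: submx_trans (submxMr _ IH) (stable_up _ stV).
Qed.

Lemma down_in t : (down_string t <= V (Some (i - Zp1 *+ t)%R))%MS.
Proof.
elim: t => [|t IH] /=; first by rewrite subr0.
rewrite mulrSr opprD addrA; exact: submx_trans (submxMr _ IH) (stable_down _ stV).
Qed.

(** The relation at the next vertex exchanges the two round trips at the cost of one
coordinate of theta. *)
Lemma up_eigen t : up_string t *m M (ArrY (i + Zp1 *+ t)) *m M (ArrX (i + Zp1 *+ t)) =
  (a + \sum_(s < t) th (i + Zp1 + Zp1 *+ s)) *: up_string t.
Proof.
elim: t => [|t IH]; first by rewrite mulr0n addr0 big_ord0 addr0.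
have e : i + Zp1 *+ t.+1 - Zp1 = i + Zp1 *+ t by rewrite mulrSr addrA addrK.
rewrite (unframed_relation (up_in t.+1)) e /= IH big_ord_recr /= -scalemxAl -scalerDl.
by rewrite -[i + Zp1 + _]addrA -mulrS addrA.
Qed.

Lemma down_eigen t :
  down_string t *m M (ArrX (i - Zp1 *+ t - Zp1)) *m M (ArrY (i - Zp1 *+ t - Zp1)) =
  (a - th i - \sum_(s < t) th (i - Zp1 - Zp1 *+ s)) *: down_string t.
Proof.
elim: t => [|t IH].
  by rewrite mulr0n (subr0 i) big_ord0 subr0 scalerBl /= -va (unframed_relation vV) addrK.
have e : i - Zp1 *+ t.+1 = i - Zp1 *+ t - Zp1 by rewrite mulrSr opprD addrA.
have e' : i - Zp1 - Zp1 *+ t = i - Zp1 *+ t.+1 by rewrite mulrS opprD addrA.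
have := unframed_relation (down_in t.+1); move/eqP; rewrite -subr_eq => /eqP <-.
rewrite {1 2}e /= IH big_ord_recr /= e' -scalemxAl -scalerBl opprD addrA //.
Qed.

(** After each full turn the eigenvalue of the same operator has grown by the sum
of theta. So the string reaches 0, and the last nonzero vector has round trip
eigenvalue 0. *)
Lemma vanish_up : exists p, a + \sum_(s < p) th (i + Zp1 + Zp1 *+ s) = 0.
Proof.
have [[p p0]|none] := pselect (exists p, up_string p = 0); last first.
  case: (finite_spectrum th0 (A := M (ArrY i) *m M (ArrX i)) (a := a)) => q.
  apply/eigenvalueP; exists (up_string (q * l.+1)); last first.
    by apply/eqP => h; apply: none; exists (q * l.+1)%N.
  have := up_eigen (q * l.+1); rewrite sum_cycle mulmxA.
  suff -> : Zp1 *+ (q * l.+1) = 0 :> I by rewrite addr0.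
  by apply/eqP; rewrite Zp1_mulrn_eq0 dvdn_mull.
have ex : exists p, up_string p == 0 by exists p; apply/eqP.
case: (ex_minnP ex) => -[|m] /eqP m0 min.
  by case/eqP: v0.
exists m; have := up_eigen m; rewrite -/(up_string m.+1) m0 mul0mx => /esym/eqP.
rewrite scaler_eq0 => /orP[/eqP //|/min]; by rewrite ltnn.
Qed.

(** The same argument along the arrows of type X, with the sum of theta
subtracted. *)
Lemma vanish_down : exists q, a - th i - \sum_(s < q) th (i - Zp1 - Zp1 *+ s) = 0.
Proof.
have [[p p0]|none] := pselect (exists p, down_string p = 0); last first.
  have thN : - \sum_i th i != 0 by rewrite oppr_eq0.
  case: (finite_spectrum thN (A := M (ArrX (i - Zp1)) *m M (ArrY (i - Zp1))) (a := a - th i)) => q.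
  apply/eigenvalueP; exists (down_string (q * l.+1)); last first.
    by apply/eqP => h; apply: none; exists (q * l.+1)%N.
  have := down_eigen (q * l.+1); rewrite mulmxA.
  have -> : \sum_(s < q * l.+1) th (i - Zp1 - Zp1 *+ s) = (\sum_i th i) *+ q.
    transitivity (\sum_(s < q * l.+1) (fun x => th (- x)) (Zp1 - i + Zp1 *+ s)).
      by apply: eq_bigr => s _; rewrite opprD opprB.
    rewrite (@sum_cycle _ _ (fun x => th (- x))); congr (_ *+ _).
    by rewrite [RHS](reindex_inj oppr_inj).
  suff -> : Zp1 *+ (q * l.+1) = 0 :> I by rewrite subr0 mulNrn.
  by apply/eqP; rewrite Zp1_mulrn_eq0 dvdn_mull.
have ex : exists p, down_string p == 0 by exists p; apply/eqP.
case: (ex_minnP ex) => -[|m] /eqP m0 min.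
  by case/eqP: v0.
exists m; have := down_eigen m; rewrite -/(down_string m.+1) m0 mul0mx => /esym/eqP.
rewrite scaler_eq0 => /orP[/eqP //|/min]; by rewrite ltnn.
Qed.

(** Subtract the two end conditions: the eigenvalue a cancels. *)
Lemma vanishing_arc : exists (b : I) k (t : 'I_k),
  i = b + Zp1 *+ t /\ \sum_(t < k) th (b + Zp1 *+ t) = 0.
Proof.
have [p pE] := vanish_up; have [q qE] := vanish_down.
have tq : (q < q.+1 + p)%N by rewrite ltn_addr.
exists (i - Zp1 *+ q), (q.+1 + p)%N, (Ordinal tq); rewrite /= subrK; split=> //.
rewrite big_split_ord /=.
have -> : \sum_(t < p) th (i - Zp1 *+ q + Zp1 *+ (q.+1 + t)) =
    \sum_(t < p) th (i + Zp1 + Zp1 *+ t).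
  apply: eq_bigr => t _; congr (th _).
  by rewrite addSn mulrS mulrnDr (addrA Zp1) (addrC Zp1) !addrA subrK.
have -> : \sum_(t < q.+1) th (i - Zp1 *+ q + Zp1 *+ t) =
    th i + \sum_(t < q) th (i - Zp1 - Zp1 *+ t).
  rewrite (reindex_inj rev_ord_inj) big_ord_recl /= subn1 /= subrK; congr (_ + _).
  apply: eq_bigr => t _; congr (th _); rewrite /bump /= add1n !subSS.
  rewrite -{1}(subnK (ltn_ord t)) mulrnDr opprD addrA addrAC subrK.
  by rewrite mulrS opprD addrA.
rewrite -[RHS](subr0 0) -[X in _ = X - _]pE -[X in _ = _ - X]qE; ring.
Qed.

End Strings.

Lemma unframed_support (F : numClosedFieldType) l N (J : {set 'I_l.+1})
    (th : {ffun 'I_l.+1 -> F}) (V : option 'I_l.+1 -> 'M[F]_N) M i :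
  standard J th -> \sum_i th i != 0 -> stable V M -> relation th V M -> V None = 0 ->
  V (Some i) != 0 -> i \in J.
Proof.
move=> st th0 stV rel Vinf Vi.
have YX : (V (Some i) *m (M (ArrY i) *m M (ArrX i)) <= V (Some i))%MS.
  by rewrite mulmxA; apply: submx_trans (submxMr _ (stable_up _ stV)) (stable_in _ stV).
have [v [a [v0 vV]]] := row_eigenvector Vi YX; rewrite mulmxA => va.
have [b [k [t [-> bk]]]] := vanishing_arc th0 stV rel Vinf v0 vV va.
exact: zero_arc_support st th0 bk.
Qed.

(** * From representations to families of subspaces and back *)

Section RepToFamily.
Variables (F : fieldType) (l : nat) (d : {ffun 'I_l.+1 -> nat}) (th : {ffun 'I_l.+1 -> F}).
Notation I := 'I_l.+1.
Variables (M : rep F d) (U : grsub F d).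
Hypothesis (rM : in_Rep th M).

Let N := (\sum_i d i).+1.
Local Notation E v := (pid_mx (hatd d v) : 'M[F]_(hatd d v, N)).
Local Notation P v := (pid_mx (hatd d v) : 'M[F]_(N, hatd d v)).

Lemma hatd_le v : (hatd d v <= N)%N.
Proof. by case: v => [i|//] /=; rewrite /N (bigD1 i) //= leqW // leq_addr. Qed.

Lemma emb_retr v : E v *m P v = 1%:M.
Proof. by rewrite mul_pid_mx minnn (minn_idPr (hatd_le v)) pid_mx_1. Qed.

Lemma emb_retrK m v (X : 'M[F]_(m, hatd d v)) : X *m E v *m P v = X.
Proof. by rewrite -mulmxA emb_retr mulmx1. Qed.

(** The dimensions at all the vertices are at most N, so every space is embedded as
the first coordinates of the same space. *)
Definition famM (a : arrow l) : 'M[F]_N := P (src a) *m M a *m E (tgt a).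
Definition famU (v : option I) : 'M[F]_N := <<U v *m E v>>%MS.

Lemma E_famM a : E (src a) *m famM a = M a *m E (tgt a).
Proof. by rewrite /famM !mulmxA emb_retr mul1mx. Qed.

(** The transport between the vertices 0 and k is the identity once k = 0. *)
Lemma conform_fam (k : I) (A : 'M[F]_(d 0)) : k = 0 ->
  E (Some k) *m (P (Some 0) *m A *m E (Some 0)) =
  conform_mx (0 : 'M[F]_(d k)) A *m E (Some k).
Proof. by move=> ->; rewrite conform_mx_id !mulmxA emb_retr mul1mx. Qed.

Lemma E_moment (k : I) : E (Some k) *m moment famM k = th k *: E (Some k).
Proof.
rewrite -[k](subrK Zp1); set i := k - Zp1.
rewrite /moment addrK mulmxDr mulmxBr -scalemxAr.
have t1 : E (Some (i + Zp1)) *m (famM (ArrY (i + Zp1)) *m famM (ArrX (i + Zp1))) =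
    (M (ArrY (i + Zp1)) *m M (ArrX (i + Zp1)) : 'M_(d (i + Zp1))) *m E (Some (i + Zp1)).
  by rewrite mulmxA (E_famM (ArrY _)) -mulmxA (E_famM (ArrX _)) mulmxA.
have t2 : E (Some (i + Zp1)) *m (famM (ArrX i) *m famM (ArrY i)) =
    (M (ArrX i) *m M (ArrY i) : 'M_(d (i + Zp1))) *m E (Some (i + Zp1)).
  by rewrite mulmxA (E_famM (ArrX _)) -mulmxA (E_famM (ArrY _)) mulmxA.
have t3 : (i + Zp1 == 0)%:R *: (E (Some (i + Zp1)) *m (famM Arry *m famM Arrx)) =
    ((i + Zp1 == 0)%:R *:
      conform_mx (0 : 'M_(d (i + Zp1))) (M Arry *m M Arrx : 'M_(d 0))) *m E (Some (i + Zp1)).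
  have [k0|_] := eqVneq (i + Zp1) 0; last by rewrite !scale0r mul0mx.
  rewrite !scale1r -(conform_fam _ k0); congr (_ *m _).
  by rewrite {1}/famM -!mulmxA (E_famM Arrx).
by rewrite t1 t2 t3 -mulmxBl -mulmxDl rM mul_scalar_mx.
Qed.

Lemma fam_relation : relation th famU famM.
Proof.
move=> k; apply: (scaled_sub (B := U (Some k) *m E (Some k))); first by rewrite genmxE.
by rewrite -mulmxA E_moment scalemxAr.
Qed.

Lemma fam_stable : subrep M U -> stable famU famM.
Proof.
move=> sU a; rewrite /famU (eqmxMr _ (genmxE _)) genmxE -mulmxA E_famM mulmxA.
exact: submxMr.
Qed.

Lemma fam_rank v : \rank (famU v) = \rank (U v).
Proof.
rewrite genmxE; apply/eqP.
by rewrite eqn_leq mxrankM_maxl -{1}[U v](emb_retrK (U v)) mxrankM_maxl.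
Qed.

Lemma fam_simple : simple_subrep M U -> simple_family famU famM.
Proof.
case=> sU _ minU; split; first exact: fam_stable.
move=> W stW WU [v0 Wv0].
pose W' : grsub F d := fun v => <<W v *m P v>>%MS.
have WPE v : W v *m P v *m E v = W v.
  by have := WU v; rewrite genmxE => /submxP[D ->]; rewrite mulmxA emb_retrK.
have sW' : subrep M W'.
  move=> a; rewrite /W' (eqmxMr _ (genmxE _)) genmxE.
  by have := submxMr (P (tgt a)) (stW a); rewrite /famM !mulmxA emb_retrK.
have W'U : gr_le W' U.
  by move=> v; rewrite /W' genmxE -[U v]emb_retrK submxMr //; have := WU v; rewrite genmxE.
have W'0 : gr_nonzero W'.
  exists v0; apply: contra Wv0 => /eqP z.
  have : (W v0 *m P v0 <= W' v0)%MS by rewrite genmxE.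
  by rewrite z => /submx0null h; rewrite -(WPE v0) h mul0mx.
move=> v; rewrite genmxE -[W v]WPE; apply: submxMr.
by have := minU W' sW' W'U W'0 v; rewrite /W' genmxE.
Qed.

End RepToFamily.

Lemma simple_subrep_has_simple (F : fieldType) l (d : {ffun 'I_l.+1 -> nat}) th
    (M : rep F d) (U : grsub F d) :
  in_Rep th M -> simple_subrep M U -> \rank (U None) = 1%N ->
  has_simple th [ffun i => (\rank (U (Some i)))%:Z].
Proof.
move=> rM sU r1; eexists; exists (famU U), (famM M); split.
- exact: fam_relation.
- exact: fam_simple.
- by rewrite fam_rank.
- by move=> k; rewrite fam_rank ffunE.
Qed.

Lemma unframed_subrep_support (F : numClosedFieldType) l (d : {ffun 'I_l.+1 -> nat})
    (J : {set 'I_l.+1}) th (M : rep F d) (U : grsub F d) i :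
  standard J th -> \sum_i th i != 0 -> in_Rep th M -> subrep M U -> U None = 0 ->
  i \notin J -> \rank (U (Some i)) = 0%N.
Proof.
move=> st th0 rM sU U0 iJ; rewrite -fam_rank; apply/eqP; rewrite mxrank_eq0.
apply/negPn/negP => h; case/negP: iJ.
apply: unframed_support st th0 (fam_stable sU) (fam_relation _ rM) _ h.
by rewrite /famU U0 mul0mx genmx0.
Qed.

Section FamilyToRep.
Variables (F : fieldType) (l : nat) (d : {ffun 'I_l.+1 -> nat}) (th : {ffun 'I_l.+1 -> F}).
Notation I := 'I_l.+1.
Variables (N : nat) (V : option I -> 'M[F]_N) (M : arrow l -> 'M[F]_N).
Hypotheses (rel : relation th V M) (sV : simple_family V M)
  (rV : forall v, \rank (V v) = hatd d v).

Definition family_basis v : 'M[F]_(hatd d v, N) := conform_mx 0 (row_base (V v)).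

Lemma basis_row_base v : row_free (family_basis v) /\ (family_basis v :=: V v)%MS.
Proof.
have H r (e : \rank (V v) = r) : row_free (conform_mx (0 : 'M_(r, N)) (row_base (V v))) /\
    (conform_mx (0 : 'M_(r, N)) (row_base (V v)) :=: V v)%MS.
  by case: _ / e; rewrite conform_mx_id row_base_free; split=> //; apply: eq_row_base.
exact: H (rV v).
Qed.

Lemma basis_free v : row_free (family_basis v). Proof. by case: (basis_row_base v). Qed.
Lemma basis_eq v : (family_basis v :=: V v)%MS. Proof. by case: (basis_row_base v). Qed.

(** The arrows written in bases of the spaces of the family. *)
Definition repM : rep F d := fun a => family_basis (src a) *m M a *m pinvmx (family_basis (tgt a)).

Lemma repM_basis a : repM a *m family_basis (tgt a) = family_basis (src a) *m M a.
Proof.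
rewrite /repM mulmxKpV // basis_eq (eqmxMr _ (basis_eq _)).
by case: sV => stV _; apply: stV.
Qed.

Lemma conform_basis (k : I) (A : 'M[F]_(d 0)) X : k = 0 ->
  A *m family_basis (Some 0) = family_basis (Some 0) *m X ->
  conform_mx (0 : 'M[F]_(d k)) A *m family_basis (Some k) = family_basis (Some k) *m X.
Proof. by move=> ->; rewrite conform_mx_id. Qed.

Lemma repM_in_Rep : in_Rep th repM.
Proof.
move=> i; apply: (row_free_inj (basis_free (Some (i + Zp1)))).
rewrite mulmxDl mulmxBl mul_scalar_mx.
have in_V : (family_basis (Some (i + Zp1)%R) <= V (Some (i + Zp1)%R))%MS by rewrite basis_eq.
rewrite -(scaled_sub in_V (rel (i + Zp1))).
rewrite /moment addrK mulmxDr mulmxBr -scalemxAr -scalemxAl; congr (_ - _ + _).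
- by rewrite -mulmxA (repM_basis (ArrX _)) mulmxA (repM_basis (ArrY _)) mulmxA.
- by rewrite -mulmxA (repM_basis (ArrY _)) mulmxA (repM_basis (ArrX _)) mulmxA.
- have [k0|_] := eqVneq (i + Zp1) 0; last by rewrite !scale0r.
  rewrite !scale1r; apply: conform_basis k0 _.
  have e1 := repM_basis Arrx; have e2 := repM_basis Arry; rewrite /= in e1 e2.
  by rewrite -mulmxA e1 [LHS]mulmxA e2 mulmxA.
Qed.

Lemma repM_simple : simple_rep repM.
Proof.
case: sV => stV minV; split.
- by move=> a; rewrite /gr_full submx1.
- by exists None; rewrite /gr_full -mxrank_eq0 mxrank1.
move=> W sW _ [v0 Wv0]; pose W' v := <<W v *m family_basis v>>%MS.
have stW' : stable W' M.
  move=> a; rewrite /W' (eqmxMr _ (genmxE _)) genmxE -mulmxA -repM_basis mulmxA.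
  by apply: submxMr; apply: sW.
have W'V v : (W' v <= V v)%MS by rewrite genmxE -basis_eq submxMl.
have W'0 : exists v, W' v != 0.
  exists v0; apply: contra Wv0 => /eqP z.
  have : (W v0 *m family_basis v0 <= W' v0)%MS by rewrite genmxE.
  rewrite z => /submx0null /eqP; rewrite mulmx_free_eq0 //; exact: basis_free.
move=> v; have := minV W' stW' W'V W'0 v; rewrite genmxE -basis_eq.
by rewrite -[X in (X <= _)%MS -> _]mul1mx submxMfree // basis_free.
Qed.

End FamilyToRep.

Lemma in_E_has_simple (F : fieldType) l (d : {ffun 'I_l.+1 -> nat}) (th : {ffun 'I_l.+1 -> F}) :
  in_E d th <-> has_simple th (intd d).
Proof.
split=> [[M rM sM]|[N [V [M [rel sV r1 dE]]]]].
  have := simple_subrep_has_simple rM sM; rewrite /gr_full mxrank1 => /(_ erefl).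
  suff -> : [ffun i => (\rank (1%:M : 'M[F]_(d i)))%:Z] = intd d by [].
  by apply/ffunP => i; rewrite !ffunE mxrank1.
have rV v : \rank (V v) = hatd d v.
  by case: v => [i|//]; have := dE i; rewrite ffunE => -[].
exists (repM d V M); [exact: repM_in_Rep | exact: repM_simple].
Qed.

(** * Semisimple representations *)

Section Semisimple.
Variables (F : fieldType) (l : nat) (d : {ffun 'I_l.+1 -> nat}) (M : rep F d).
Implicit Types U W A B C : grsub F d.

Lemma subrep_add A B : subrep M A -> subrep M B -> subrep M (fun v => (A v + B v)%MS).
Proof.
by move=> sA sB a; rewrite /= addsmxMr addsmxS.
Qed.

Lemma subrep_cap A B : subrep M A -> subrep M B -> subrep M (fun v => (A v :&: B v)%MS).
Proof.
move=> sA sB a; rewrite /= sub_capmx.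
by rewrite (submx_trans (submxMr _ (capmxSl _ _))) // (submx_trans (submxMr _ (capmxSr _ _))).
Qed.

(** Go through the simple summands and keep those that meet the sum built so far
trivially; each summand is either kept or already contained in that sum. *)
Lemma semisimple_complement W : semisimple_rep M -> subrep M W ->
  exists C, [/\ subrep M C, forall v, (W v :&: C v)%MS = 0
    & forall v, ((1%:M : 'M_(hatd d v)) <= W v + C v)%MS].
Proof.
case=> k [U [sU fullU]] sW.
have H : forall m, (m <= k)%N -> exists C, [/\ subrep M C,
    forall v, (W v :&: C v)%MS = 0
    & forall v (i : 'I_k), (i < m)%N -> (U i v <= W v + C v)%MS].
  elim=> [|m IH] mk.
    by exists (fun=> 0); split=> // [a|v]; rewrite ?mul0mx ?sub0mx ?capmx0.
  have [C [sC WC UC]] := IH (ltnW mk); pose i0 := Ordinal mk.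
  have [sU0 _ minU] := sU i0.
  (* the simple summand meets W + C in itself or in 0 *)
  pose K v := (U i0 v :&: (W v + C v))%MS.
  have sK : subrep M K by apply: subrep_cap => //; apply: subrep_add.
  have [Kn0|Kz] := pselect (gr_nonzero K).
    exists C; split=> // v i; rewrite ltnS leq_eqVlt => /predU1P[im|]; last exact: UC.
    have -> : i = i0 by apply: val_inj.
    have := minU K sK (fun v => capmxSl _ _) Kn0 v.
    by move=> /submx_trans; apply; apply: capmxSr.
  have K0 v : K v = 0 by apply/eqP/negPn/negP => h; apply: Kz; exists v.
  exists (fun v => (C v + U i0 v)%MS); split.
  - exact: subrep_add.
  - move=> v; apply/eqP; rewrite -mxrank_eq0.
    have r1 := mxrank_sum_cap (W v) (C v); rewrite WC mxrank0 addn0 in r1.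
    have r2 := mxrank_sum_cap (W v + C v)%MS (U i0 v).
    rewrite capmxC -/(K v) K0 mxrank0 addn0 in r2.
    have r3 := mxrank_sum_cap (W v) (C v + U i0 v)%MS.
    have r4 : (\rank (C v + U i0 v)%MS <= \rank (C v) + \rank (U i0 v))%N.
      by rewrite -mxrank_sum_cap leq_addr.
    by move: r3; rewrite addsmxA r2 r1; lia.
  - move=> v i; rewrite ltnS leq_eqVlt addsmxA => /predU1P[im|im].
      have -> : i = i0 by apply: val_inj.
      exact: addsmxSr.
    by apply: submx_trans (UC v i im) _; apply: addsmxSl.
have [C [sC WC UC]] := H k (leqnn k); exists C; split=> // v.
have [/eqmxP full _] := fullU v; rewrite -full.
by apply/sumsmx_subP => i _; apply: UC.
Qed.

(** A complement of W in M cuts out a complement of W in U, by the modular law. *)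
Lemma semisimple_indecomposable U :
  semisimple_rep M -> indecomposable_subrep M U -> simple_subrep M U.
Proof.
move=> ss [sU U0 ind]; split=> // W sW WU W0 v.
have [C [sC WC fullC]] := semisimple_complement ss sW.
pose C' v := (C v :&: U v)%MS.
have sC' : subrep M C' by apply: subrep_cap.
have sumU u : (W u + C' u :=: U u)%MS.
  apply: eqmx_trans (matrix_modl (C u) (WU u)) _; apply/eqmxP.
  by rewrite capmxSr sub_capmx submx_refl andbT (submx_trans (submx1 _)).
have ds : gr_dsum U W C'.
  move=> u; split; first exact/eqmxP/sumU.
  apply/eqP; rewrite -submx0 -(WC u) sub_capmx capmxSl /=.
  by apply: submx_trans (capmxSr _ _) _; apply: capmxSl.
have C'0 : C' v = 0.
  apply/eqP/negPn/negP => h; apply: ind ds _ => //; split=> //; by exists v.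
by have := sumU v; rewrite C'0 => /eqmx_sym/eqmx_trans/(_ (addsmx0 _ _)) <-.
Qed.

End Semisimple.

(** * Adding one-dimensional representations *)

(** From a spanning family of simple subrepresentations one extracts a direct one:
each new member either lies in the sum of the chosen ones or meets it in 0. *)
Lemma semisimple_of_span (F : fieldType) l (d : {ffun 'I_l.+1 -> nat}) (M : rep F d)
    (T : finType) (U : T -> grsub F d) :
  (forall t, simple_subrep M (U t)) ->
  (forall v, ((1%:M : 'M_(hatd d v)) <= \sum_t U t v)%MS) -> semisimple_rep M.
Proof.
move=> sU span.
have H (s : seq T) : exists k (U' : 'I_k -> grsub F d),
    [/\ forall i, simple_subrep M (U' i),
      forall v, (\sum_(i < k) U' i v :=: \sum_(t <- s) U t v)%MS
      & forall v, \rank (\sum_(i < k) U' i v)%MS = (\sum_(i < k) \rank (U' i v))%N].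
  elim: s => [|t s [k [U' [sU' eqU' rU']]]].
    exists 0%N, (fun=> (fun=> 0)); split=> [[]//|v|v]; first by rewrite big_ord0 big_nil.
    by rewrite !big_ord0 mxrank0.
  have [sUt Ut0 minU] := sU t.
  pose S v := (\sum_(i < k) U' i v)%MS.
  have sS : subrep M S.
    move=> a; rewrite /S sumsmxMr_gen; apply/sumsmx_subP => i _; rewrite genmxE.
    by have [si _ _] := sU' i; apply: submx_trans (si a) _; apply: (sumsmx_sup i).
  pose K v := (U t v :&: S v)%MS.
  have sK : subrep M K by apply: subrep_cap.
  have [Kn0|Kz] := pselect (gr_nonzero K).
    exists k, U'; split=> // v; rewrite big_cons.
    apply: eqmx_trans (adds_eqmx (eqmx_refl _) (eqU' v)).
    apply/eqmxP/andP; split; first exact: addsmxSr.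
    rewrite addsmx_sub submx_refl andbT; have := minU K sK (fun v => capmxSl _ _) Kn0 v.
    by move=> /submx_trans; apply; apply: capmxSr.
  have K0 v : (S v :&: U t v)%MS = 0.
    by rewrite capmxC; apply/eqP/negPn/negP => h; apply: Kz; exists v.
  pose U'' (i : 'I_k.+1) := if unlift ord_max i is Some i' then U' i' else U t.
  have eU'' v : (\sum_(i < k.+1) U'' i v)%MS = (S v + U t v)%MS.
    rewrite big_ord_recr /= /U'' unlift_none; congr (_ + _)%MS; apply: eq_bigr => i _.
    have -> : widen_ord (leqnSn k) i = lift ord_max i.
      by apply: val_inj; rewrite /= /bump leqNgt ltn_ord.
    by rewrite liftK.
  exists k.+1, U''; split.
  - by move=> i; rewrite /U''; case: unliftP.
  - move=> v; rewrite eU'' big_cons addsmxC; apply: adds_eqmx (eqU' v); exact: eqmx_refl.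
  - move=> v; rewrite eU'' mxrank_disjoint_sum // rU' big_ord_recr /= /U'' unlift_none.
    congr (_ + _)%N; apply: eq_bigr => i _.
    have -> : widen_ord (leqnSn k) i = lift ord_max i.
      by apply: val_inj; rewrite /= /bump leqNgt ltn_ord.
    by rewrite liftK.
have [k [U' [sU' eqU' rU']]] := H (index_enum T).
exists k, U'; split=> // v; split; last by rewrite mxdirectE /= rU'.
by apply/eqmxP; apply: eqmx_trans (eqU' v) _; apply/eqmxP; rewrite submx1 span.
Qed.

Section AddVertexSimples.
Variables (F : fieldType) (l : nat) (d d' : {ffun 'I_l.+1 -> nat}) (th : {ffun 'I_l.+1 -> F}).
Notation I := 'I_l.+1.
Variable (M : rep F d').
Hypotheses (rM : in_Rep th M) (sM : simple_rep M)
  (le_d : forall i, (d' i <= d i)%N) (th_d : forall i, d' i != d i -> th i = 0).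

Local Notation Q v := (pid_mx (hatd d' v) : 'M[F]_(hatd d' v, hatd d v)).
Local Notation P v := (pid_mx (hatd d' v) : 'M[F]_(hatd d v, hatd d' v)).

Lemma hatd_mono v : (hatd d' v <= hatd d v)%N.
Proof. by case: v => [i|] /=. Qed.

Lemma QP v : Q v *m P v = 1%:M.
Proof. by rewrite mul_pid_mx minnn (minn_idPr (hatd_mono v)) pid_mx_1. Qed.

Lemma QPr m v (X : 'M[F]_(m, hatd d' v)) : X *m Q v *m P v = X.
Proof. by rewrite -mulmxA QP mulmx1. Qed.

Lemma PQ v : P v *m Q v = pid_mx (hatd d' v).
Proof. by rewrite mul_pid_mx !minnn. Qed.

Lemma sandwich u v w (A : 'M[F]_(hatd d' u, hatd d' v)) (B : 'M[F]_(hatd d' v, hatd d' w)) :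
  P u *m A *m Q v *m (P v *m B *m Q w) = P u *m (A *m B) *m Q w.
Proof. by rewrite !mulmxA QPr. Qed.

(** M on the first d' coordinates, and 0 on the others. *)
Definition ext_rep : rep F d := fun a => P (src a) *m M a *m Q (tgt a).

Lemma conform_ext (k : I) (A : 'M[F]_(d' 0)) : k = 0 ->
  conform_mx (0 : 'M[F]_(d k)) (P (Some 0) *m A *m Q (Some 0)) =
  P (Some k) *m conform_mx (0 : 'M[F]_(d' k)) A *m Q (Some k).
Proof. by move=> ->; rewrite !conform_mx_id. Qed.

(** On the new coordinates both sides of the relation vanish, because there are new
coordinates only at vertices where theta is 0. *)
Lemma ext_rep_in_Rep : in_Rep th ext_rep.
Proof.
move=> i; set k := i + Zp1.
transitivity (P (Some k) *m (th k)%:M *m Q (Some k)); last first.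
  rewrite mul_mx_scalar -scalemxAl PQ /=.
  have [e|/th_d ->] := eqVneq (d' k) (d k); last by rewrite -scalemx1 !scale0r.
  by rewrite e pid_mx_1 scalemx1.
rewrite -rM mulmxDr mulmxBr mulmxDl mulmxBl; congr (_ - _ + _).
- exact: (sandwich (M (ArrY k)) (M (ArrX k))).
- exact: (sandwich (M (ArrX i)) (M (ArrY i))).
- rewrite -scalemxAr -scalemxAl; have [k0|_] := eqVneq k 0; last by rewrite !scale0r.
  rewrite !scale1r -conform_ext //; congr conform_mx.
  exact: (sandwich (M Arry) (M Arrx)).
Qed.

Definition ext_old : grsub F d := fun v => pid_mx (hatd d' v).

Lemma ext_old_idem v : ext_old v *m ext_old v = ext_old v.
Proof. by rewrite /ext_old mul_pid_mx !minnn (minn_idPr (hatd_mono v)). Qed.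

Lemma ext_old_simple : simple_subrep ext_rep ext_old.
Proof.
have sub_core m v (X : 'M[F]_(m, hatd d v)) : (X <= ext_old v)%MS -> X *m P v *m Q v = X.
  by move=> /submxP[D ->]; rewrite -mulmxA PQ -mulmxA ext_old_idem.
case: sM => _ _ minM; split.
- move=> a; rewrite /ext_rep mulmxA; apply: submx_trans (submxMl _ _) _.
  by rewrite -[Q (tgt a)]mul1mx -QP -mulmxA PQ submxMl.
- by exists None; rewrite /ext_old pid_mx_1 -mxrank_eq0 mxrank1.
move=> W sW WU [v0 Wv0].
pose W' : grsub F d' := fun v => <<W v *m P v>>%MS.
have sW' : subrep M W'.
  move=> a; rewrite /W' (eqmxMr _ (genmxE _)) genmxE.
  by have := submxMr (P (tgt a)) (sW a); rewrite /ext_rep !mulmxA QPr.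
have W'0 : gr_nonzero W'.
  exists v0; apply: contra Wv0 => /eqP z.
  have : (W v0 *m P v0 <= W' v0)%MS by rewrite genmxE.
  by rewrite z => /submx0null h; rewrite -(sub_core _ _ _ (WU v0)) h mul0mx.
move=> v; have := minM W' sW' (fun v => submx1 _) W'0 v; rewrite /gr_full /W' genmxE.
move=> /(submxMr (Q v)); rewrite mul1mx sub_core //; apply: submx_trans.
by rewrite /ext_old -PQ submxMl.
Qed.

(** The new coordinates. *)
Definition ext_index := {t : {j : I & 'I_(d j)} | (d' (tag t) <= tagged t)%N}.

(** The line of a new coordinate, written entrywise to avoid a transport along the
equality of vertices. *)
Definition ext_line (t : ext_index) : grsub F d := fun v =>
  match v return 'M[F]_(hatd d v) with
  | Some i => \matrix_(r, s) [&& i == tag (val t), r == tagged (val t) :> nat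
      & s == tagged (val t) :> nat]%:R
  | None => 0
  end.

Lemma ext_line_neq (t : ext_index) v : v != Some (tag (val t)) -> ext_line t v = 0.
Proof.
case: v => [i|//] ne; apply/matrixP => r s; rewrite !mxE.
by have /negPf -> : i != tag (val t) by apply: contra ne => /eqP ->.
Qed.

Lemma ext_line_tag (t : ext_index) :
  ext_line t (Some (tag (val t))) = delta_mx (tagged (val t)) (tagged (val t)).
Proof. by apply/matrixP => r s; rewrite !mxE eqxx. Qed.

Lemma ext_lineP (t : ext_index) v : ext_line t v *m P v = 0.
Proof.
have [->|ne] := eqVneq v (Some (tag (val t))); last by rewrite ext_line_neq ?mul0mx.
rewrite ext_line_tag; apply/matrixP => r s; rewrite !mxE big1 // => u _; rewrite !mxE.
have td := valP t; have [->|] := eqVneq u (tagged (val t)); last by rewrite andbF mul0r.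
by rewrite /= [(_ < d' _)%N]ltnNge td andbF mulr0.
Qed.

Lemma ext_line_simple t : simple_subrep ext_rep (ext_line t).
Proof.
have t0 : ext_line t (Some (tag (val t))) != 0.
  by rewrite ext_line_tag -mxrank_eq0 mxrank_delta.
split.
- by move=> a; rewrite /ext_rep !mulmxA ext_lineP !mul0mx sub0mx.
- by exists (Some (tag (val t))).
move=> W _ WU [v0 Wv0] v.
have [->|ne] := eqVneq v (Some (tag (val t))); last by rewrite ext_line_neq // sub0mx.
have v0E : v0 = Some (tag (val t)).
  apply/eqP/negPn/negP => ne; have := WU v0; rewrite ext_line_neq // submx0.
  exact/negP.
rewrite -(mxrank_leqif_sup (WU _)).2 ext_line_tag mxrank_delta -v0E eqn_leq.
rewrite lt0n mxrank_eq0 Wv0 andbT.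
by have := mxrankS (WU v0); rewrite v0E ext_line_tag mxrank_delta.
Qed.

Lemma ext_rep_span v :
  ((1%:M : 'M_(hatd d v)) <=
    \sum_(t : option ext_index) (if t is Some s then ext_line s else ext_old) v)%MS.
Proof.
apply/row_subP => r; have [rd|rd] := ltnP r (hatd d' v).
  apply: (sumsmx_sup None) => //; apply: submx_trans (row_sub r (ext_old v)).
  have -> : row r (ext_old v) = row r 1%:M; last exact: submx_refl.
  by apply/rowP => s; rewrite !mxE rd andbT.
case: v r rd => [i|] r /= rd; last by case: r rd => r /= r1; lia.
pose t : ext_index := exist _ (existT (fun j => 'I_(d j)) i r) rd.
apply: (sumsmx_sup (Some t)) => //; apply: submx_trans (row_sub r _).
have -> : row r (ext_line t (Some i)) = row r 1%:M; last exact: submx_refl.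
by apply/rowP => s; rewrite !mxE /= !eqxx /= -val_eqE /= eq_sym.
Qed.

Lemma ext_rep_semisimple : semisimple_rep ext_rep.
Proof.
apply: (@semisimple_of_span _ _ _ _ (option ext_index : finType)
  (fun t => if t is Some s then ext_line s else ext_old)); last first.
  move=> v; apply: submx_trans (ext_rep_span v) _; apply/sumsmx_subP => t _.
  by apply: (sumsmx_sup t); case: t.
by case=> [t|]; [exact: ext_line_simple | exact: ext_old_simple].
Qed.

(** A nonzero direct summand of a simple is everything. *)
Lemma simple_indecomposable (dd : {ffun 'I_l.+1 -> nat}) (MM : rep F dd) U :
  simple_subrep MM U -> indecomposable_subrep MM U.
Proof.
case=> sU U0 minU; split=> // A B sA sB dAB [A0 [v Bv]].
have AU : gr_le A U.
  by move=> u; have [/eqmxP <- _] := dAB u; apply: addsmxSl.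
have UA := minU A sA AU A0.
have [/eqmxP sAB capAB] := dAB v; case/negP: Bv; rewrite -submx0 -capAB sub_capmx submx_refl andbT.
by apply: submx_trans (UA v); rewrite -sAB addsmxSr.
Qed.

Lemma ext_rep_dimreg : is_dimreg ext_rep (intd d').
Proof.
exists ext_old, (fun v => copid_mx (hatd d' v)); split.
- exact/simple_indecomposable/ext_old_simple.
- move=> a; rewrite /ext_rep !mulmxA /copid_mx mulmxBl mul1mx mul_pid_mx.
  rewrite !minnn (minn_idPr (hatd_mono _)) subrr !mul0mx sub0mx //.
- by rewrite /copid_mx pid_mx_1 subrr.
- move=> v; split.
    by rewrite submx1 /= -[X in (X <= _)%MS](addrNK (ext_old v)) addrC addmx_sub_adds.
  apply/eqP; rewrite -submx0; set C := (_ :&: _)%MS.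
  have /submxP[D1 e1] : (C <= ext_old v)%MS by apply: capmxSl.
  have /submxP[D2 e2] : (C <= copid_mx (hatd d' v))%MS by apply: capmxSr.
  have -> : C = C *m ext_old v by rewrite e1 -mulmxA ext_old_idem.
  rewrite e2 -mulmxA /copid_mx mulmxBl mul1mx -/(ext_old v) ext_old_idem subrr mulmx0.
  exact: submx_refl.
- by apply/ffunP => i; rewrite !ffunE rank_pid_mx //=; apply: le_d.
Qed.

End AddVertexSimples.

(** * Classification of the leaves *)

Section Classification.
Variables (F : numClosedFieldType) (l : nat) (J : {set 'I_l.+1}) (th : {ffun 'I_l.+1 -> F}).
Hypotheses (st : standard J th) (th0 : \sum_i th i != 0).
Notation I := 'I_l.+1.
Implicit Types (d e : {ffun I -> int}) (ka : int_partition).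

(** Otherwise theta would be 0. *)
Lemma J_proper : J != [set: I].
Proof.
apply/eqP => JT; case/negP: th0; apply/eqP; apply: big1 => i _.
by apply: standard_zero st _; rewrite JT inE.
Qed.

Lemma J_l_gt0 j : j \in J -> (0 < l)%N.
Proof.
move=> jJ; rewrite lt0n; apply/eqP => l0; case/negP: th0; apply/eqP; apply: big1 => i _.
suff -> : i = j by apply: standard_zero st jJ.
by apply: val_inj; move: i j {jJ}; rewrite l0 => i j; rewrite !ord1.
Qed.

Lemma coroot_val_delta d n j : coroot_val (d + delta l *+ n) j = coroot_val d j.
Proof. by rewrite /coroot_val lapD lap_delta addr0. Qed.

(** Nonnegative weight gives the core; dominance at the vertices of J, where theta
vanishes, makes it a J-core. *)
Lemma has_simple_class d : has_simple th d ->
  exists nu n, [/\ ell_core l nu, J_core J nu & d = Res l nu + delta l *+ n].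
Proof.
move=> sd; have [nu [n [co dE]]] := core_decomposition (has_simple_weight2 sd).
exists nu, n; split=> //; apply: dominant_core_J_core => // j jJ.
rewrite -(coroot_val_delta _ n) -dE; apply: has_simple_coroot_val sd; first exact: J_l_gt0 jJ.
exact: standard_zero st jJ.
Qed.

(** A positive root orthogonal to theta is a combination of the simple roots of J,
so dominance on J gives dominance for all these roots. *)
Lemma has_simple_of_J_core ka n : J_core J ka -> has_simple th (Res l ka + delta l *+ n).
Proof.
move=> co; apply: has_simple_of_root_dominant => //.
  by rewrite weight2_delta addr_ge0 ?weight2_Res_ge0 // mulrn_wge0 // ler0n.
move=> x x0 x2 thx; apply: sumr_ge0 => i _.
have [iJ|iJ] := boolP (i \in J); last first.
  by rewrite (standard_root_support st x0 x2 thx iJ) mul0r.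
by rewrite coroot_val_delta mulr_ge0 // (J_core_dominant co).
Qed.

(** Take for kappa the core nu' of d' itself, and let lambda grow from nu' by the
J-boxes that account for the unframed part. *)
Lemma partitions_of_leaf (d : {ffun I -> nat}) nu n d' : ell_core l nu -> J_core J nu ->
  intd d = Res l nu + delta l *+ n -> (leaf d th d' !=set0)%classic ->
  exists (n' : nat) (la ka : int_partition),
    [/\ (n' <= n)%N, block l nu (n' * l.+1 + size (boxes nu)) la,
        is_Core_J J la ka & d' = Res l ka + delta l *+ (n - n')].
Proof.
move=> co Jco dE [p [_ [M [rM ss [M0 [M1 [ind sM1 M1inf ds d'E]]] _]]]].
have sM0 := semisimple_indecomposable ss ind.
have rk v : (\rank (M0 v) + \rank (M1 v))%N = hatd d v.
  have [/eqmxP sum cap] := ds v.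
  by rewrite -mxrank_sum_cap cap mxrank0 addn0 sum /gr_full mxrank1.
have r1 : \rank (M0 None) = 1%N by have := rk None; rewrite M1inf mxrank0 addn0.
have := simple_subrep_has_simple rM sM0 r1; rewrite -d'E => sd'.
have [nu' [n'' [co' Jco' nuE]]] := has_simple_class sd'.
(* the dimension vector of the unframed part *)
pose g := intd d - d'.
have gE i : g i = (\rank (M1 (Some i)))%:Z.
  have arith (a b c : nat) : (a + b)%N = c -> c%:Z - a%:Z = b%:Z by lia.
  by rewrite /g d'E !ffunE; apply: arith (rk (Some i)).
have E : Res l nu' + g + delta l *+ n'' = Res l nu + delta l *+ n.
  by rewrite addrAC -nuE /g addrCA subrr addr0.
have [i|i iJ|j jJ|la [reach laE]] := grow_to J_proper (ka := nu') (g := g).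
- by rewrite gE.
- by rewrite gE (unframed_subrep_support st th0 rM sM1 M1inf iJ).
- by rewrite -(coroot_val_delta _ n'') E coroot_val_delta; apply: J_core_dominant Jco jJ.
rewrite -laE in E; have [le coreE sz] := is_Core_ell_of_Res co E.
exists (n - n'')%N, la, nu'; split; rewrite ?leq_subr ?subKn //.
Qed.

(** The boxes of lambda outside its J-core tell how many new coordinates are needed
at each vertex of J. *)
Lemma leaf_of_partitions (d : {ffun I -> nat}) nu n d' n' la ka :
  intd d = Res l nu + delta l *+ n -> (n' <= n)%N ->
  block l nu (n' * l.+1 + size (boxes nu)) la -> is_Core_J J la ka ->
  d' = Res l ka + delta l *+ (n - n') -> (leaf d th d' !=set0)%classic.
Proof.
move=> dE n'n [sz [reach _]] [reachJ Jco] d'E.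
have [k [laE sz']] := clos_remove_ell reach.
have kE : k = n'.
  by move: sz; rewrite sz' => /addIn/eqP; rewrite eqn_pmul2r // => /eqP.
have sd' : has_simple th d' by rewrite d'E; apply: has_simple_of_J_core.
(* d' is nonnegative, so it is an honest dimension vector e *)
pose e : {ffun I -> nat} := [ffun i => `|d' i|%N].
have eE : intd e = d'.
  by apply/ffunP => i; rewrite !ffunE gez0_abs // (has_simple_nonneg sd').
have [M rM sM] : in_E e th by apply/in_E_has_simple; rewrite eE.
have diff i : (d i)%:Z - (e i)%:Z = Res l la i - Res l ka i.
  have /ffunP/(_ i) := dE; have /ffunP/(_ i) := eE; rewrite d'E laE kE.
  rewrite [intd e i]ffunE [intd d i]ffunE => -> ->.
  rewrite !(fun x y : {ffun I -> int} => ffunE (fun k => x k + y k)) !ffunMnE [delta l i]ffunE.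
  by rewrite !natz; lia.
have le i : (e i <= d i)%N.
  by have [le _] := Res_remove_J reachJ i; move: (diff i) le; rewrite -lez_nat; lia.
have th_e i : e i != d i -> th i = 0.
  move=> ne; apply: standard_zero st _; apply: contraR ne => iJ.
  have [_ /(_ iJ) eq] := Res_remove_J reachJ i.
  by move: (diff i); rewrite eq subrr => /eqP; rewrite subr_eq0 eq_sym.
have rB := ext_rep_in_Rep rM le th_e.
exists (Defs.point th (ext_rep d M)); split; first by exists (ext_rep d M).
exists (ext_rep d M); split=> //; first exact: ext_rep_semisimple sM le.
by rewrite -eE; apply: ext_rep_dimreg sM le.
Qed.

End Classification.

Theorem corollary3p33 (R : realType) (l : nat) (J : {set 'I_l.+1})
    (th : {ffun 'I_l.+1 -> R[i]%C}) (d : {ffun 'I_l.+1 -> nat}) :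
  standard J th -> \sum_i th i != 0 -> in_E d th ->
  (exists (nu : int_partition) (n : nat),
     [/\ ell_core l nu, J_core J nu & intd d = Res l nu + delta l *+ n]) /\
  forall (nu : int_partition) (n : nat),
    ell_core l nu -> J_core J nu -> intd d = Res l nu + delta l *+ n ->
    forall d' : {ffun 'I_l.+1 -> int},
      (leaf d th d' !=set0)%classic <->
      (exists (n' : nat) (la ka : int_partition),
         [/\ (n' <= n)%N,
             block l nu (n' * l.+1 + size (boxes nu)) la,
             is_Core_J J la ka
           & d' = Res l ka + delta l *+ (n - n')]).
Proof.
pose C : numClosedFieldType := R[i]%C.
move=> st th0 /in_E_has_simple sd; split; first exact: (@has_simple_class C) sd.
move=> nu n co Jco dE d'; split; first exact: (@partitions_of_leaf C).
move=> [n' [la [ka [n'n bl cJ d'E]]]].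
exact: (@leaf_of_partitions C _ _ _ st th0 _ _ _ _ _ _ _ dE n'n bl cJ d'E).
Qed.
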